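(* Let $\Omega_1$ and $\Omega_2$ be coherently diagonal complexes, and let $D$ be a binary operator of the alternating planar algebra (i.e. an operator defined from a basic 2-input planar diagram) such that $D(\Omega_1,\Omega_2)$ is well defined. Then $D(\Omega_1,\Omega_2)$ is a diagonal complex.
   Context: **Oriented smoothings.** A smoothing with $2k$ boundary points is a crossingless tangle in a disc: a disjoint union of $k$ properly embedded arcs (strands) joining $2k$ fixed boundary points, possibly together with closed loops, up to isotopy. It is oriented (alternatingly) if its strands and loops are oriented so that orientations alternate in and out around the boundary circle and come from a checkerboard colouring of the complement: every component has a black region on its left and a white (negative) region on its right. **The category.** $\mathcal{C}ob^3_o(k)$ has as objects oriented smoothings with $2k$ boundary points, with formal grading shifts $\sigma\{q\}$. Its morphisms are formal $\mathbb{Z}$-linear combinations of dotted cobordisms (in disc $\times[0,1]$, product on the boundary, compatible with the orientations), modulo Bar-Natan's local relations: a sphere is $0$; a sphere with one dot is $1$; a component with two dots is $0$; neck cutting (a neck equals the sum of the two surfaces obtained by cutting it, capping both sides and putting one dot on one of the caps). Composition is stacking. The degree of a cobordism $C$ is $\chi(C)-k-2\,\#\{\text{dots}\}$; a morphism $C:\sigma\{m\}\to\tau\{n\}$ has degree $\deg C+n-m$. $\mathrm{Mat}(\mathcal{C}ob^3_o(k))$ is the additive closure (formal direct sums, written as vectors, and matrices). $\mathrm{Kob}_o(k)=\mathrm{Kom}(\mathrm{Mat}(\mathcal{C}ob^3_o(k)))$ is the category of chain complexes over it, and $\mathrm{Kob}_o=\bigcup_k\mathrm{Kob}_o(k)$.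 A complex is bounded if almost all of its chain objects are zero. **Rotation numbers.** For a strand $\alpha$ of an oriented smoothing with $2k$ boundary points, number the boundary points $0,1,\dots,2k-1$ counterclockwise starting at the tail of $\alpha$; if the head is $i$, then $R(\alpha)=\frac{i-k}{2k}$. A loop has $R=1$ if counterclockwise and $R=-1$ if clockwise. $R(\sigma)$ is the sum over all components of $\sigma$. The degree-shifted rotation number is $R(\sigma\{q\})=R(\sigma)+q$. **Planar diagrams.** A $d$-input type-$\mathcal{A}$ (alternating) planar diagram is an output disc with $d$ disjoint input discs removed, together with disjoint oriented embedded arcs ending on the boundary circles, such that each boundary circle has an even number of endpoints with alternating orientations (coming from a checkerboard colouring with black on the left of each arc and white on the right), and every arc starting on the external boundary ends on an input disc. Arcs are curls (both ends on the same input disc), interconnecting arcs (ends on different input discs) or boundary arcs (one end on the external boundary). An alternating planar algebra is a planar algebra whose diagrams are all of type $\mathcal{A}$. A basic planar diagram is either a 1-input type-$\mathcal{A}$ diagram with one curl, or a 2-input type-$\mathcal{A}$ diagram with only one interconnecting arc, all other arcs being boundary arcs. A binary operator is an operator defined from a basic 2-input planar diagram. A unary operator is an operator defined by a 1-input type-$\mathcal{A}$ diagram. The associated rotation number of a diagram $D$ is $R_D=\frac12(1+i_D-d)-w_D$, where $i_D$ is the number of curls and interconnecting arcs and $w_D$ is the number of white regions whose boundary does not meet the external boundary. **Action on complexes.** $D$ acts on smoothings by gluing them into the input discs (numbers of boundary points and orientations must match; grading shifts add), on cobordisms by gluing with $D\times[0,1]$, and extends multilinearly to $\mathrm{Mat}$.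 For complexes $(\Omega_i,d_i)$, $D(\Omega_1,\dots,\Omega_n)$ is the complex with $$\Omega^r=\bigoplus_{r=r_1+\dots+r_n}D(\Omega_1^{r_1},\dots,\Omega_n^{r_n}),\qquad d|_{D(\Omega_1^{r_1},\dots,\Omega_n^{r_n})}=\sum_{i=1}^n(-1)^{\sum_{j<i}r_j}D(I_{\Omega_1^{r_1}},\dots,d_i,\dots,I_{\Omega_n^{r_n}}).$$ **Reduced form.** A reduced form of a complex is a homotopy equivalent complex obtained by delooping (replacing each loop by $\emptyset\{+1\}\oplus\emptyset\{-1\}$, up to isomorphism) and Gaussian elimination of the invertible entries of the differentials, so that no loops and no invertible entries remain. **Diagonal complexes.** A complex $(\Omega,d)$ in $\mathrm{Kob}_o$ with degree-preserving differential is diagonal if there is a constant $C_\Omega$ (its rotation constant) such that $2r-R(\sigma\{q\})=C_\Omega$ for every homological degree $r$ and every shifted smoothing $\sigma\{q\}$ occurring in $\Omega^r$. A bounded diagonal complex $(\Omega,d)$ with rotation constant $C_R$ is coherently diagonal if for every appropriate unary operator $U$ (its input matches $\Omega$, and its output disc has a nonempty set of boundary points, i.e. $U$ gives a partial closure of $\Omega$), with associated rotation number $R_U$, the closure $U(\Omega)$ has a reduced form which is a diagonal complex with rotation constant $C_R-R_U$. *)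

(* Defs.v *)
From mathcomp Require Import all_boot all_order all_algebra.
Set Implicit Arguments.
Unset Strict Implicit.
Unset Printing Implicit Defensive.
Import Order.TTheory GRing.Theory Num.Theory.
Local Open Scope ring_scope.

Definition symrel (T : finType) (e : rel T) : rel T :=
  [rel x y | e x y || e y x].

Lemma symrel_connect_sym (T : finType) (e : rel T) : connect_sym (symrel e).
Proof. by apply: sym_connect_sym => x y; apply: orbC. Qed.

(* Quotient by the equivalence relation generated by e; [val] picks a          *)
(* representative of each class.                                              *)
Definition quo (T : finType) (e : rel T) : finType :=
  {x : T | roots (symrel e) x}.

Definition qpi (T : finType) (e : rel T) (x : T) : quo e :=
  exist _ (fingraph.root (symrel e) x) (roots_root (symrel_connect_sym e) x).
Arguments qpi {T} e x.

(******************************************************************************)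
(* Boundary types.  A boundary circle carries 2k points 0, ..., 2k-1, numbered*)
(* counterclockwise from a base point; the intervals ("gaps") of the circle   *)
(* are numbered so that point p lies between gap p and gap p+1.  Gaps 0 and   *)
(* 2k are the same interval, the one containing the base point.  The boolean  *)
(* tells whether that interval is black; the colours of the other gaps        *)
(* alternate.  Facing into the disc from point p, gap p is on the left.  As   *)
(* black is on the left of every strand, p is a tail iff gap p is black.      *)
(******************************************************************************)

Record btype := BType { half : nat; base_black : bool }.

Definition point (B : btype) := 'I_(2 * half B).
Definition gap (B : btype) := 'I_(2 * half B).+1.

Definition before (B : btype) (p : point B) : gap B := widen_ord (leqnSn _) p.
Definition after (B : btype) (p : point B) : gap B := lift ord0 p.

Definition gap_black (B : btype) (j : gap B) : bool := base_black B (+) odd j.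
Definition is_tail (B : btype) (p : point B) : bool := gap_black (before p).

(******************************************************************************)
(* Oriented smoothings.  A crossingless tangle in a disc, up to isotopy, is   *)
(* encoded by its components (strands and loops), the regions of its          *)
(* complement, the two regions adjacent to each component (black on the left, *)
(* white on the right), the component ending at each boundary point and the   *)
(* region meeting each gap.  [smoothing_ok] says that the regions are         *)
(* checkerboard coloured, that every component has two or zero boundary       *)
(* points, and that every component separates the disc (Jordan): the dual     *)
(* graph, with regions as vertices and components as edges, is a tree.        *)
(* These data determine the tangle up to isotopy, including the positions of  *)
(* its loops, and every such datum comes from a tangle.                       *)
(******************************************************************************)

Record smoothing (B : btype) := Smoothing {
  cmp : finType;
  reg : finType;
  reg_black : reg -> bool;
  blk : cmp -> reg;
  wht : cmp -> reg;
  at_pt : point B -> cmp;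
  at_gap : gap B -> reg
}.
Arguments at_pt [B] s p.
Arguments at_gap [B] s j.
Arguments blk [B s] c.
Arguments wht [B s] c.
Arguments reg_black [B s] r.

Definition is_loop B (s : smoothing B) (c : cmp s) : bool :=
  [forall p, at_pt s p != c].

Definition crossing_avoiding B (s : smoothing B) (P : pred (cmp s)) :
    rel (reg s) :=
  symrel [rel r r' | [exists c, [&& ~~ P c, blk c == r & wht c == r']]].

Definition smoothing_ok B (s : smoothing B) : bool :=
  [&& [forall c : cmp s, reg_black (blk c) && ~~ reg_black (wht c)],
      [forall j : gap B, reg_black (at_gap s j) == gap_black j],
      at_gap s ord0 == at_gap s ord_max,
      [forall p : point B,
         (if is_tail p then @blk B s else @wht B s) (at_pt s p) == at_gap s (before p)],
      [forall p : point B,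
         (if is_tail p then @wht B s else @blk B s) (at_pt s p) == at_gap s (after p)],
      [forall c : cmp s,
         is_loop c || (#|[set p | at_pt s p == c]| == 2%N)],
      [forall r : reg s, forall r' : reg s,
         connect (crossing_avoiding (@pred0 (cmp s))) r r']
    & [forall c : cmp s,
         ~~ connect (crossing_avoiding (pred1 c)) (blk c) (wht c)]].

(* A loop is counterclockwise iff its inside (the side that does not meet the *)
(* boundary of the disc) is on its left, i.e. is the black side.              *)
Definition ccw B (s : smoothing B) (c : cmp s) : bool :=
  ~~ connect (crossing_avoiding (pred1 c)) (blk c) (at_gap s ord0).

(* Rotation number of a component; for a strand from p to q, the number of q  *)
(* counted counterclockwise from p is (q - p) mod 2k.                         *)
Definition rot_cmp B (s : smoothing B) (c : cmp s) : rat :=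
  let k := half B in
  if [pick pq : point B * point B | [&& at_pt s pq.1 == c, at_pt s pq.2 == c,
        is_tail pq.1 & ~~ is_tail pq.2]] is Some (p, q)
  then (((q + 2 * k - p) %% (2 * k))%N%:R - k%:R) / (2 * k)%N%:R
  else if ccw c then 1 else -1.

Definition rot B (s : smoothing B) : rat := \sum_(c : cmp s) rot_cmp c.

(******************************************************************************)
(* Dotted cobordisms between smoothings with the same boundary type.  A       *)
(* surface with the prescribed boundary is given, up to diffeomorphism rel    *)
(* boundary, by its connected components, the component containing each       *)
(* strand or loop of its source and target, and the Euler characteristic and  *)
(* the number of dots of each component.  Embeddings in disc x [0,1] are not  *)
(* recorded: modulo the local relations every surface is a combination of     *)
(* dotted discs, so that a surface only depends on its diffeomorphism type.   *)
(* Compatibility with the orientations is automatic once source and target    *)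
(* have the same boundary type.                                               *)
(******************************************************************************)

Record cob B (s t : smoothing B) := Cob {
  surf : finType;
  att : cmp s + cmp t -> surf;
  chi : surf -> int;
  dots : surf -> nat
}.

Section Cobordisms.
Variable B : btype.
Implicit Types s t u : smoothing B.

(* The boundary of a cobordism is the closed curve s U (points x [0,1]) U t;  *)
(* its circles are the connected components of [bd_rel s t].                  *)
Definition bd_rel s t : rel (cmp s + cmp t) :=
  symrel [rel x y | [exists p, (x == inl (at_pt s p)) && (y == inr (at_pt t p))]].

Definition bd_circles s t (C : cob s t) (z : surf C) : nat :=
  n_comp (@bd_rel s t) [pred x | att C x == z].

(* The vertical boundary is the product, and each component z has a genus     *)
(* g >= 0, with chi z = 2 - 2g - (number of boundary circles of z).           *)
Definition cob_ok s t (C : cob s t) : bool :=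
  [forall p : point B, att C (inl (at_pt s p)) == att C (inr (at_pt t p))] &&
  [forall z : surf C, let twog := 2 - chi z - (bd_circles z)%:Z in
     (0 <= twog) && (2 %| twog)%Z].

Definition cob_id s : cob s s :=
  @Cob B s s (cmp s) (fun x => match x with inl c => c | inr c => c end)
    (fun c => if is_loop c then 0 else 1) (fun=> 0%N).

(* Stacking: Euler characteristics add up, minus that of the glued curve t,   *)
(* to which each strand contributes 1 and each loop 0.                        *)
Definition cob_comp_rel s t u (C : cob s t) (C' : cob t u) :
    rel (surf C + surf C') :=
  [rel x y | [exists c : cmp t,
     (x == inl (att C (inr c))) && (y == inr (att C' (inl c)))]].
Arguments cob_comp_rel [s t u] C C' x y.

Definition cob_comp s t u (C : cob s t) (C' : cob t u) : cob s u :=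
  let pi := qpi (cob_comp_rel C C') in
  @Cob B s u (quo (cob_comp_rel C C'))
    (fun x => match x with
              | inl c => pi (inl (att C (inl c)))
              | inr c => pi (inr (att C' (inr c)))
              end)
    (fun z => \sum_(y | pi (inl y) == z) chi y
              + \sum_(y | pi (inr y) == z) chi y
              - (#|[set c : cmp t | ~~ is_loop c
                     & pi (inl (att C (inr c))) == z]|)%:Z)
    (fun z => \sum_(y | pi (inl y) == z) dots y
              + \sum_(y | pi (inr y) == z) dots y)%N.

Definition cob_deg s t (C : cob s t) : int :=
  \sum_(z : surf C) chi z - (half B)%:Z - 2 * (\sum_(z : surf C) dots z)%N%:Z.

Definition cob_iso s t (C C' : cob s t) : Prop :=
  exists h : surf C -> surf C',
    [/\ bijective h, (forall x, att C' x = h (att C x)),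
        (forall z, chi (h z) = chi z) & (forall z, dots (h z) = dots z)].

Definition cob_dot s t (C : cob s t) (x : surf C) : cob s t :=
  Cob (att C) (@chi _ _ _ C) (fun z => dots z + (z == x))%N.

(* C with a neck (tube) joining the components x and y; x = y is allowed.     *)
Definition cob_tube s t (C : cob s t) (x y : surf C) : cob s t :=
  let e := [rel a b : surf C | (a == x) && (b == y)] in
  let pi := qpi e in
  @Cob B s t (quo e) (fun c => pi (att C c))
    (fun z => \sum_(a | pi a == z) chi a - (if pi x == z then 2 else 0))
    (fun z => \sum_(a | pi a == z) dots a)%N.

(* Disjoint union of C and a sphere with n dots.                              *)
Definition cob_sphere s t (C : cob s t) (n : nat) : cob s t :=
  @Cob B s t (option (surf C)) (fun c => Some (att C c))
    (fun z => if z is Some a then chi a else 2)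
    (fun z => if z is Some a then dots a else n).

(******************************************************************************)
(* Morphisms: formal integral combinations of cobordisms, with equality       *)
(* [meq] generated by additivity, diffeomorphism and the local relations.     *)
(******************************************************************************)

Definition mor s t := seq (int * cob s t).

Definition mor_ok s t (f : mor s t) : bool := all (fun aC => cob_ok aC.2) f.

Definition mor_scale s t (a : int) (f : mor s t) : mor s t :=
  [seq (a * bC.1, bC.2) | bC <- f].

Definition mor_id s : mor s s := [:: (1, cob_id s)].

(* First f, then g.                                                           *)
Definition mor_comp s t u (f : mor s t) (g : mor t u) : mor s u :=
  [seq (aC.1 * bC.1, cob_comp aC.2 bC.2) | aC <- f, bC <- g].

Inductive meq s t : mor s t -> mor s t -> Prop :=
| meq_refl f : meq f f
| meq_sym f g : meq f g -> meq g f
| meq_trans f g h : meq f g -> meq g h -> meq f h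
| meq_cat f f' g g' : meq f f' -> meq g g' -> meq (f ++ g) (f' ++ g')
| meq_catC f g : meq (f ++ g) (g ++ f)
| meq_scale a f g : meq f g -> meq (mor_scale a f) (mor_scale a g)
| meq_add a b C : meq [:: (a, C); (b, C)] [:: (a + b, C)]
| meq_zero C : meq [:: (0, C)] [::]
| meq_iso C C' : cob_iso C C' -> meq [:: (1, C)] [:: (1, C')]
| meq_sphere C : cob_ok C -> meq [:: (1, cob_sphere C 0)] [::]
| meq_dotted_sphere C : cob_ok C -> meq [:: (1, cob_sphere C 1)] [:: (1, C)]
| meq_two_dots C (z : surf C) :
    cob_ok C -> (2 <= dots z)%N -> meq [:: (1, C)] [::]
| meq_neck C (x y : surf C) : cob_ok C ->
    meq [:: (1, cob_tube x y)] [:: (1, cob_dot x); (1, cob_dot y)].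

Definition mor_nth s t (f : mor s t) : 'I_(size f) -> int * cob s t :=
  match f return 'I_(size f) -> int * cob s t with
  | [::] => fun i => match notF (ltn_ord i) with end
  | aC :: f' => fun i => nth aC (aC :: f') i
  end.

Definition invertible s t (f : mor s t) : Prop :=
  exists g : mor t s, [/\ mor_ok g, meq (mor_comp f g) (mor_id s)
                        & meq (mor_comp g f) (mor_id t)].

(* As a morphism s{m} -> t{n}, with n - m = q, f is homogeneous of degree 0.  *)
Definition degree0 s t (q : int) (f : mor s t) : Prop :=
  exists g : mor s t, [/\ meq f g, mor_ok g
                        & all (fun aC => cob_deg aC.2 + q == 0) g].

End Cobordisms.

(******************************************************************************)
(* Bounded complexes over Mat(Cob).  The direct sum of all chain objects is   *)
(* written as one finite family of shifted smoothings [smo x]{[qsh x]}, each  *)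
(* with its homological degree [hdeg x], and the differential as one square   *)
(* matrix, whose entry [dif x y] maps the summand x to the summand y.         *)
(******************************************************************************)

Record cplx (B : btype) := Cplx {
  idx : finType;
  hdeg : idx -> int;
  smo : idx -> smoothing B;
  qsh : idx -> int;
  dif : forall x y : idx, mor (smo x) (smo y)
}.

Section Complexes.
Variable B : btype.
Implicit Types O P : cplx B.

Definition is_complex O : Prop :=
  [/\ (forall x : idx O, smoothing_ok (smo x)),
      (forall x y : idx O, mor_ok (dif x y)),
      (forall x y : idx O, hdeg y != hdeg x + 1 -> meq (dif x y) [::])
    & (forall x z : idx O,
         meq (\big[cat/[::]]_(y : idx O) mor_comp (dif x y) (dif y z)) [::])].

Definition rot_shifted O (x : idx O) : rat := rot (smo x) + (qsh x)%:~R.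

Definition diagonal O (C : rat) : Prop :=
  [/\ is_complex O,
      (forall x y : idx O, degree0 (qsh y - qsh x) (dif x y))
    & (forall x : idx O, 2 * (hdeg x)%:~R - rot_shifted x = C)].

(* The (x, y) entry of the identity matrix.                                   *)
Definition id_entry O (x y : idx O) : mor (smo x) (smo y) :=
  match x =P y with
  | ReflectT exy => ecast z (mor (smo x) (smo z)) exy (mor_id (smo x))
  | ReflectF _ => [::]
  end.

Definition hmat O P := forall (x : idx O) (y : idx P), mor (smo x) (smo y).

Definition hmat_deg O P (n : int) (f : hmat O P) : Prop :=
  forall x y, mor_ok (f x y) /\ (hdeg y != hdeg x + n -> meq (f x y) [::]).

Definition hmat_comp O P Q (f : hmat O P) (g : hmat P Q) : hmat O Q :=
  fun x z => \big[cat/[::]]_(y : idx P) mor_comp (f x y) (g y z).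

Definition hmat_eq O P (f g : hmat O P) : Prop :=
  forall x y, meq (f x y) (g x y).

Definition chain_map O P (f : hmat O P) : Prop :=
  hmat_deg 0 f /\ hmat_eq (hmat_comp (@dif B O) f) (hmat_comp f (@dif B P)).

Definition null_homotopic_diff O P (f g : hmat O P) : Prop :=
  exists2 h : hmat O P, hmat_deg (-1) h &
    hmat_eq f (fun x y => g x y ++ hmat_comp (@dif B O) h x y
                                ++ hmat_comp h (@dif B P) x y).

Definition homotopy_equivalent O P : Prop :=
  exists (f : hmat O P) (g : hmat P O),
    [/\ chain_map f, chain_map g,
        null_homotopic_diff (hmat_comp f g) (@id_entry O)
      & null_homotopic_diff (hmat_comp g f) (@id_entry P)].

End Complexes.

Section Delooping.
Variables (B : btype) (s : smoothing B) (l : cmp s).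

Definition inside : reg s := if ccw l then blk l else wht l.
Definition outside : reg s := if ccw l then wht l else blk l.

(* A loop bounding a disc disjoint from the rest of the smoothing.            *)
Definition removable : bool :=
  is_loop l && [forall c, (c != l) ==> (blk c != inside) && (wht c != inside)].

Definition merge_inside (r : reg s) : reg s :=
  if r == inside then outside else r.

Lemma merge_insideK r : merge_inside (merge_inside r) == merge_inside r.
Proof.
rewrite /merge_inside; case: (eqVneq r inside) => [_|/negPf->]; last by [].
by case: ifP.
Qed.

Definition merged (r : reg s) : {r : reg s | merge_inside r == r} :=
  exist _ (merge_inside r) (merge_insideK r).

(* The smoothing s with the loop l deleted.  It is meant for removable l; the *)
(* default component is never used, as l does not meet the boundary.          *)
Definition remove_cmp (nl : forall p, at_pt s p != l) : smoothing B :=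
  @Smoothing B {c : cmp s | c != l} {r : reg s | merge_inside r == r}
    (fun r => reg_black (val r))
    (fun c => merged (blk (val c))) (fun c => merged (wht (val c)))
    (fun p => exist _ (at_pt s p) (nl p))
    (fun j => merged (at_gap s j)).

Variable nl : forall p, at_pt s p != l.

(* The identity away from l, and a disc with n dots bounded by l.             *)
Definition cap_chi (c : cmp s) : int :=
  if c == l then 1 else if is_loop c then 0 else 1.

Definition cap (n : nat) : mor s (remove_cmp nl) :=
  [:: (1, @Cob B s (remove_cmp nl) (cmp s)
            (fun x => match x with inl c => c | inr c => val c end)
            cap_chi (fun c => if c == l then n else 0%N))].

Definition cup (n : nat) : mor (remove_cmp nl) s :=
  [:: (1, @Cob B (remove_cmp nl) s (cmp s)
            (fun x => match x with inl c => val c | inr c => c end)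
            cap_chi (fun c => if c == l then n else 0%N))].

End Delooping.

(* The summand s{q} at x0 is replaced by s'{q+1} (index [inr true]) and       *)
(* s'{q-1} (index [inr false]), where s' is s without the loop l, and the     *)
(* differential is transported along the isomorphism whose components are the *)
(* dotted and the plain cap; its inverse consists of the plain and the dotted *)
(* cup.                                                                       *)
Definition deloop B (O : cplx B) (x0 : idx O) (l : cmp (smo x0))
    (nl : forall p, at_pt (smo x0) p != l) : cplx B :=
  let I := ({x : idx O | x != x0} + bool)%type in
  let sm (i : I) := match i with
                    | inl x => smo (val x)
                    | inr _ => remove_cmp nl
                    end in
  @Cplx B I
    (fun i => match i with inl x => hdeg (val x) | inr _ => hdeg x0 end)
    sm
    (fun i => match i with
              | inl x => qsh (val x)
              | inr b => qsh x0 + (if b then 1 else -1)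
              end)
    (fun i j => match i, j return mor (sm i) (sm j) with
                | inl x, inl y => dif (val x) (val y)
                | inl x, inr b => mor_comp (dif (val x) x0) (cap nl b)
                | inr b, inl y => mor_comp (cup nl (~~ b)) (dif x0 (val y))
                | inr b, inr b' =>
                    mor_comp (cup nl (~~ b)) (mor_comp (dif x0 x0) (cap nl b'))
                end).

(* Gaussian elimination of the entry [dif x0 y0], with inverse psi.           *)
Definition gauss B (O : cplx B) (x0 y0 : idx O)
    (psi : mor (smo y0) (smo x0)) : cplx B :=
  @Cplx B {x : idx O | (x != x0) && (x != y0)}
    (fun x => hdeg (val x)) (fun x => smo (val x)) (fun x => qsh (val x))
    (fun x y => dif (val x) (val y) ++
       mor_scale (-1)
         (mor_comp (dif (val x) y0) (mor_comp psi (dif x0 (val y))))).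

Inductive reduces B (O : cplx B) : cplx B -> Prop :=
| reduces_refl : reduces O O
| reduces_deloop P (x0 : idx P) (l : cmp (smo x0))
    (nl : forall p, at_pt (smo x0) p != l) :
    reduces O P -> removable l -> reduces O (deloop nl)
| reduces_gauss P (x0 y0 : idx P) (psi : mor (smo y0) (smo x0)) :
    reduces O P -> x0 != y0 -> mor_ok psi ->
    meq (mor_comp (dif x0 y0) psi) (mor_id (smo x0)) ->
    meq (mor_comp psi (dif x0 y0)) (mor_id (smo y0)) ->
    reduces O (gauss psi).

Definition reduced_form B (O P : cplx B) : Prop :=
  [/\ homotopy_equivalent O P, reduces O P,
      (forall (x : idx P) (c : cmp (smo x)), ~~ is_loop c)
    & (forall x y : idx P, ~ invertible (dif x y))].

(******************************************************************************)
(* Planar diagrams of type A with d input discs, as combinatorial maps.  The  *)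
(* circle None is the external one, Some i is the boundary of the i-th input  *)
(* disc; points and gaps of every circle are numbered counterclockwise.  The  *)
(* boundary type of an input circle is that of the smoothings to be glued in, *)
(* so that an arc of the diagram starts at an external tail or at an input    *)
(* head.  The combinatorial map determines the diagram up to isotopy if the   *)
(* diagram is connected, which is required here.  It is automatic for 1-input *)
(* diagrams with nonempty output boundary (all arcs from the external circle  *)
(* reach the input disc) and for basic 2-input diagrams.                      *)
(******************************************************************************)

Definition circ_type d (Bin : 'I_d -> btype) (Bout : btype)
    (c : option 'I_d) : btype :=
  if c is Some i then Bin i else Bout.

Section Diagrams.
Variables (d : nat) (Bin : 'I_d -> btype) (Bout : btype).

Definition endpt : finType := {c : option 'I_d & point (circ_type Bin Bout c)}.
Definition dgap : finType := {c : option 'I_d & gap (circ_type Bin Bout c)}.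

Definition ext_pt (p : point Bout) : endpt :=
  @existT _ (fun c => point (circ_type Bin Bout c)) None p.
Definition in_pt (i : 'I_d) (p : point (Bin i)) : endpt :=
  @existT _ (fun c => point (circ_type Bin Bout c)) (Some i) p.
Definition ext_gap (j : gap Bout) : dgap :=
  @existT _ (fun c => gap (circ_type Bin Bout c)) None j.
Definition in_gap (i : 'I_d) (j : gap (Bin i)) : dgap :=
  @existT _ (fun c => gap (circ_type Bin Bout c)) (Some i) j.

Definition dbefore (e : endpt) : dgap :=
  @existT _ (fun c => gap (circ_type Bin Bout c)) (tag e) (before (tagged e)).
Definition dafter (e : endpt) : dgap :=
  @existT _ (fun c => gap (circ_type Bin Bout c)) (tag e) (after (tagged e)).
Definition dgap_black (g : dgap) : bool := gap_black (tagged g).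

Definition is_ext (e : endpt) : bool := tag e == None.

Definition arc_source (e : endpt) : bool :=
  if is_ext e then is_tail (tagged e) else ~~ is_tail (tagged e).

(* Two gaps lie in the same region iff they are linked by moving along arcs.  *)
(* Counterclockwise is seen from opposite sides at the two ends of an arc     *)
(* joining two input points, and from the same side at the two ends of an arc *)
(* joining an external and an input point.                                    *)
Definition region_rel (arc : endpt -> endpt) : rel dgap :=
  [rel g h |
     [exists c : option 'I_d,
        (g == @existT _ (fun c => gap (circ_type Bin Bout c)) c ord0) &&
        (h == @existT _ (fun c => gap (circ_type Bin Bout c)) c ord_max)] ||
     [exists e : endpt,
        if is_ext e (+) is_ext (arc e)
        then (g == dbefore e) && (h == dbefore (arc e)) ||
             (g == dafter e) && (h == dafter (arc e))
        else (g == dafter e) && (h == dbefore (arc e))]].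

Definition circ_rel (arc : endpt -> endpt) : rel (option 'I_d) :=
  [rel c c' | [exists e : endpt, (tag e == c) && (tag (arc e) == c')]].

(* [arc] sends each end of an arc to its other end.  The last condition is    *)
(* Euler's formula (circles) - (arcs) + (regions) = 2, i.e. planarity.        *)
Record diagram := Diagram {
  arc : endpt -> endpt;
  arcK : involutive arc;
  arc_oriented : forall e, arc_source (arc e) = ~~ arc_source e;
  arc_ext : forall e, is_ext e -> ~~ is_ext (arc e);
  arc_connected : forall c c', connect (circ_rel arc) c c';
  arc_planar :
    (d.+1 + #|quo (region_rel arc)| = #|[set e | arc_source e]| + 2)%N
}.

Variable D : diagram.

Definition region : finType := quo (region_rel (arc D)).

Definition curls : {set endpt} :=
  [set e | [&& arc_source e, ~~ is_ext e & tag (arc D e) == tag e]].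

Definition interconnecting : {set endpt} :=
  [set e | [&& arc_source e, ~~ is_ext e, ~~ is_ext (arc D e)
             & tag (arc D e) != tag e]].

(* White regions whose boundary does not meet the external circle; all gaps   *)
(* in a region have the same colour.                                          *)
Definition inner_white : {set region} :=
  [set z : region | ~~ dgap_black (val z) &
     [forall j : gap Bout, qpi (region_rel (arc D)) (ext_gap j) != z]].

Definition rot_diagram : rat :=
  (1 + (#|curls| + #|interconnecting|)%N%:R - d%:R) / 2 - #|inner_white|%:R.

Section OnSmoothings.
Variable s : forall i, smoothing (Bin i).

Definition glue_reg_rel :
    rel (dgap + {i : 'I_d & reg (s i)}) :=
  [rel x y | match x, y with
   | inl g, inl h => region_rel (arc D) g h
   | inl g, inr r => [exists j : gap (Bin (tag r)),
       (g == in_gap j) && (at_gap (s (tag r)) j == tagged r)]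
   | _, _ => false
   end].

Definition glue_cmp_rel : rel (endpt + {i : 'I_d & cmp (s i)}) :=
  [rel x y | match x, y with
   | inl e, inl e' => arc D e == e'
   | inl e, inr c => [exists p : point (Bin (tag c)),
       (e == in_pt p) && (at_pt (s (tag c)) p == tagged c)]
   | _, _ => false
   end].

Definition glue_reg (x : dgap + {i : 'I_d & reg (s i)}) : quo glue_reg_rel :=
  qpi glue_reg_rel x.
Definition glue_cmp (x : endpt + {i : 'I_d & cmp (s i)}) : quo glue_cmp_rel :=
  qpi glue_cmp_rel x.

(* The region on the left (if b) or right of a component, read off from any   *)
(* piece of the component.                                                    *)
Definition glue_side (b : bool) (c : quo glue_cmp_rel) : quo glue_reg_rel :=
  match val c with
  | inl e => let g := dbefore e in
      glue_reg (inl (if dgap_black g == b then g else dafter e))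
  | inr (existT i a) =>
      glue_reg (inr (@existT _ (fun i => reg (s i)) i
                       (if b then blk a else wht a)))
  end.

Definition act_smoothing : smoothing Bout :=
  @Smoothing Bout (quo glue_cmp_rel) (quo glue_reg_rel)
    (fun r => match val r with
              | inl g => dgap_black g
              | inr (existT i a) => reg_black a
              end)
    (glue_side true) (glue_side false)
    (fun p => glue_cmp (inl (ext_pt p)))
    (fun j => glue_reg (inl (ext_gap j))).

End OnSmoothings.

(******************************************************************************)
(* Action on cobordisms: the surfaces are glued to (arcs of D) x [0,1].  Each *)
(* arc contributes a disc, glued along the interval {p} x [0,1] for each of   *)
(* its ends p on an input circle.                                             *)
(******************************************************************************)

Section OnCobordisms.
Variables s t : forall i, smoothing (Bin i).
Variable C : forall i, cob (s i) (t i).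

Definition glue_surf_rel : rel (endpt + {i : 'I_d & surf (C i)}) :=
  [rel x y | match x, y with
   | inl e, inl e' => arc D e == e'
   | inl e, inr z => [exists p : point (Bin (tag z)),
       (e == in_pt p) &&
       (att (C (tag z)) (inl (at_pt (s (tag z)) p)) == tagged z)]
   | _, _ => false
   end].

Definition glue_surf (x : endpt + {i : 'I_d & surf (C i)}) :
  quo glue_surf_rel := qpi glue_surf_rel x.

Definition surf_in (i : 'I_d) (z : surf (C i)) : quo glue_surf_rel :=
  glue_surf (inr (@existT _ (fun i => surf (C i)) i z)).

Definition act_cob : cob (act_smoothing s) (act_smoothing t) :=
  @Cob Bout (act_smoothing s) (act_smoothing t) (quo glue_surf_rel)
    (fun x => match x with
     | inl c => match val c with
                | inl e => glue_surf (inl e)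
                | inr (existT i a) => surf_in (att (C i) (inl a))
                end
     | inr c => match val c with
                | inl e => glue_surf (inl e)
                | inr (existT i a) => surf_in (att (C i) (inr a))
                end
     end)
    (fun z => \sum_i \sum_(y : surf (C i) | surf_in y == z) chi y
              + (#|[set e | arc_source e & glue_surf (inl e) == z]|)%:Z
              - (#|[set e | ~~ is_ext e & glue_surf (inl e) == z]|)%:Z)
    (fun z => \sum_i \sum_(y : surf (C i) | surf_in y == z) dots y)%N.

End OnCobordisms.

(* Multilinear extension to formal combinations: the index x chooses one term *)
(* in each of the d combinations.                                             *)
Definition act_mor (s t : forall i, smoothing (Bin i))
    (f : forall i, mor (s i) (t i)) : mor (act_smoothing s) (act_smoothing t) :=
  [seq (\prod_i (mor_nth (x i)).1, act_cob (fun i => (mor_nth (x i)).2))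
  | x : {dffun forall i : 'I_d, 'I_(size (f i))}].

Definition act_cplx (O : forall i, cplx (Bin i)) : cplx Bout :=
  @Cplx Bout {dffun forall i : 'I_d, idx (O i)}
    (fun x => \sum_i hdeg (x i))
    (fun x => act_smoothing (fun i => smo (x i)))
    (fun x => \sum_i qsh (x i))
    (fun x y => \big[cat/[::]]_(i : 'I_d)
       mor_scale ((-1) ^ (\sum_(j < d | (j < i)%N) hdeg (x j)))
         (act_mor (fun j => if j == i then dif (x j) (y j)
                            else id_entry (x j) (y j)))).

End Diagrams.

Definition in1 (B : btype) : 'I_1 -> btype := fun=> B.

Definition act1 B Bout (U : diagram (in1 B) Bout) (O : cplx B) : cplx Bout :=
  act_cplx U (fun=> O).

Definition in2 (B1 B2 : btype) : 'I_2 -> btype :=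
  fun i => if i == ord0 then B1 else B2.

Definition pair2 B1 B2 (O1 : cplx B1) (O2 : cplx B2) (i : 'I_2) :
    cplx (in2 B1 B2 i) :=
  match i == ord0 as b return cplx (if b then B1 else B2) with
  | true => O1
  | false => O2
  end.

Definition act2 B1 B2 Bout (D : diagram (in2 B1 B2) Bout)
    (O1 : cplx B1) (O2 : cplx B2) : cplx Bout :=
  act_cplx D (pair2 O1 O2).

Definition basic2 B1 B2 Bout (D : diagram (in2 B1 B2) Bout) : Prop :=
  #|interconnecting D| = 1%N /\ #|curls D| = 0%N.

Definition coherently_diagonal B (O : cplx B) : Prop :=
  exists C : rat, diagonal O C /\
    forall (Bout : btype) (U : diagram (in1 B) Bout), (0 < half Bout)%N ->
      exists2 P : cplx Bout, reduced_form (act1 U O) P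
                           & diagonal P (C - rot_diagram U).

(* Main.v *)
(* In the basic diagram only one arc links the two inputs, so gluing along it *)
(* merges one strand of each smoothing and identifies its black (and its      *)
(* white) sides: the dual trees of the two smoothings are glued along an edge.*)
(* Planarity enters through Euler's formula, which forces every region of the *)
(* diagram to contain exactly one external gap.                               *)
(* The rotation number of a smoothing with 2k > 0 boundary points is          *)
(* N - (number of clockwise loops) - (k + 1) / 2, where N counts the          *)
(* components having a given region on their right, plus one if that region   *)
(* is black.  Seen from the black region at the link, N drops by one under    *)
(* the gluing, as does k0 + k1: the rotation number is additive, and so is    *)
(* the rotation constant.                                                     *)
(* Glued surfaces are boundary connected sums, so Euler characteristics and   *)
(* numbers of boundary circles both drop by one, whence genera and degrees    *)
(* add up.  That the result is a complex with a degree-preserving             *)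
(* differential follows because gluing is functorial and respects the local   *)
(* relations.                                                                 *)
Require Import Defs.
From mathcomp Require Import all_boot all_order all_algebra.
From HB Require Import structures.
From mathcomp Require Import generic_quotient boolp.
From mathcomp Require Import zify ring lra.
Import Defs.
Set Implicit Arguments.
Unset Strict Implicit.
Unset Printing Implicit Defensive.
Import Order.TTheory GRing.Theory Num.Theory.
Local Open Scope ring_scope.

(** A smoothing is handled through its dual tree, with regions as vertices and components as edges.
    Deleting the edge of a component [c] leaves two halves, and [right_of c] is the indicator
    function of the white half. By connectedness it is the only Boolean function that is true at
    [wht c], false at [blk c] and changes across [c] alone ([right_uniq]). The gaps to the right of
    a strand are those met counterclockwise from its tail to its head, so averaging the indicators
    over the boundary gaps gives the closed formula [rotE] for the rotation number.

    A basic binary diagram has one link between its inputs ([basic_one_link]), and all its other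
    arcs lead outside. Euler's formula then makes regions and external points equinumerous, so that
    a function on the input gaps descends to the regions once it agrees across the link
    ([region_lift]). Hence the glued smoothing is the union of two trees along one edge: components
    are identified at the link only ([dcmp_pinch]), and the indicators of the inputs extend to the
    glue ([glue_potential], [glue_potential_link]), which is therefore a smoothing
    ([act_smoothing_ok]). Evaluating [rotE] at the black region of the link shows that rotation
    numbers add up ([rot_glue]).

    The same identification of two points governs surfaces ([dsurf_pinch]) and boundary circles
    ([circle_pinch]), whence genera and degrees add up ([act_cob_ok], [act_cob_deg]). Gluing
    commutes with stacking ([act_comp]) and carries local relations to local relations
    ([act_sphere], [act_tube], [act_dot]). It thus induces a biadditive operation [actm] on classes
    of morphisms with an interchange law ([actm_comp]), and the glued differential squares to zero
    by the sign computation for tensor products ([act_is_complex]). In [act_diagonal], homological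
    degrees, shifts and rotation numbers are all sums over the two inputs, and so is the rotation
    constant. *)

(** * Quotients of finite types *)

Section Quotients.
Variables (T : finType) (e : rel T).

Lemma qpi_connect x y : (qpi e x == qpi e y) = connect (symrel e) x y.
Proof. by rewrite -val_eqE /= root_connect //; apply: symrel_connect_sym. Qed.

Lemma qpi_val (z : quo e) : qpi e (val z) = z.
Proof. by apply: val_inj; apply/eqP: (valP z). Qed.

Lemma qpi_surj (z : quo e) : exists x, qpi e x = z.
Proof. by exists (val z); apply: qpi_val. Qed.

Lemma qpi_eq x y : e x y -> qpi e x = qpi e y.
Proof.
by move=> exy; apply/eqP; rewrite qpi_connect; apply: connect1; rewrite /symrel /= exy.
Qed.

Lemma qpi_inv (A : Type) (f : T -> A) :
  (forall x y, e x y -> f x = f y) -> forall x y, qpi e x = qpi e y -> f x = f y.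
Proof.
move=> fe x y /eqP; rewrite qpi_connect => /connectP[p + ->].
elim: p x => //= z p IHp x /andP[/orP[/fe->|/fe<-]]; exact: IHp.
Qed.

(** Maps out of a quotient are written as [f] at the canonical representative; this is their value
    on arbitrary elements. *)
Lemma qpi_lift (A : Type) (f : T -> A) :
  (forall x y, e x y -> f x = f y) -> forall x, f (val (qpi e x)) = f x.
Proof. by move=> fe x; apply: (qpi_inv fe); apply: qpi_val. Qed.

End Quotients.

Lemma connect_invariant (T : finType) (e : rel T) (A : Type) (f : T -> A) :
  (forall x y, e x y -> f x = f y) -> forall x y, connect e x y -> f x = f y.
Proof.
move=> fe x y /connectP[p + ->].
by elim: p x => //= z p IHp x /andP[/fe->]; apply: IHp.
Qed.

(** Both sets are quotients of [T] by the same kernel. Glued surfaces are compared in this way. *)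
Lemma surj_bij (T A B : finType) (p : T -> A) (q : T -> B) :
    (forall a, exists u, p u = a) -> (forall b, exists u, q u = b) ->
    (forall u v, p u = p v <-> q u = q v) ->
  exists2 h : A -> B, bijective h & forall u, h (p u) = q u.
Proof.
move=> sp sq pq.
have sp' a : exists u, p u == a by have [u <-] := sp a; exists u.
have sq' b : exists u, q u == b by have [u <-] := sq b; exists u.
pose h a := q (xchoose (sp' a)); pose g b := p (xchoose (sq' b)).
have hp u : h (p u) = q u.
  by apply/pq; apply/eqP; apply: (xchooseP (sp' (p u))).
have gq u : g (q u) = p u.
  by apply/pq; apply/eqP; apply: (xchooseP (sq' (q u))).
exists h => //; exists g => [a|b].
  by have [u <-] := sp a; rewrite hp gq.
by have [u <-] := sq b; rewrite gq hp.
Qed.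

Lemma big_fiber (R : nmodType) (T Q : finType) (q : T -> Q) (P : pred Q)
    (w : T -> R) :
  \sum_(y | P y) \sum_(x | q x == y) w x = \sum_(x | P (q x)) w x.
Proof.
rewrite (partition_big q P) //=; apply: eq_bigr => y Py.
by apply: eq_bigl => x; case: eqP => [->|]; rewrite ?Py ?andbF.
Qed.

Lemma ord2P (P : 'I_2 -> Prop) : P ord0 -> P ord_max -> forall i, P i.
Proof.
move=> P0 P1 i; case: (unliftP ord0 i) => [j|] -> //.
by rewrite (_ : lift _ _ = ord_max) //; apply: val_inj; rewrite (ord1 j).
Qed.

Lemma eq_existT (I : eqType) (T : I -> eqType) i (a b : T i) :
  (existT T i a == existT T i b) = (a == b).
Proof. by rewrite -tag_eqE /tag_eq /= eqxx tagged_asE. Qed.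

Lemma neq_existT (I : eqType) (T : I -> eqType) i j (a : T i) (b : T j) :
  i != j -> (existT T i a == existT T j b) = false.
Proof. by move=> ij; rewrite -tag_eqE /tag_eq /= (negPf ij). Qed.

(** * Smoothings and rotation numbers *)

(** Boolean test functions suffice because [connect e x] is itself an invariant one, true at [x]. *)
Lemma connect_bool (T : finType) (e : rel T) :
  (forall f : T -> bool, (forall x y, e x y -> f x = f y) ->
     forall x y, f x = f y) ->
  connect_sym e -> forall x y, connect e x y.
Proof.
move=> He se x y.
rewrite -(He (connect e x) _ x y) ?connect0 // => u v /connect1 euv.
by apply/idP/idP => [/connect_trans|xv]; [apply|rewrite (connect_trans xv) // se].
Qed.

Lemma sum_ltn n b : (b <= n)%N -> (\sum_(j < n) (j < b) = b)%N.
Proof.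
elim: n b => [|n IHn] b; first by rewrite leqn0 big_ord0 => /eqP.
rewrite big_ord_recr /= leq_eqVlt => /orP[/eqP->|].
  rewrite ltnS leqnn -[RHS]addn1; congr addn; rewrite -[RHS](IHn n) //.
  by apply: eq_bigr => j _; rewrite ltn_ord ltnS ltnW.
by rewrite ltnS => bn; rewrite IHn // ltnNge bn addn0.
Qed.

(** Colours alternate around the circle, so half of the gaps are black, whatever the base colour
    [b]. *)
Lemma sum_odd_half (b : bool) k :
  (\sum_(j < 2 * k) (b (+) odd j.+1) = k)%N.
Proof.
elim: k => [|k IHk]; first by rewrite big_ord0.
rewrite mulnS addnC addn2 !big_ord_recr /= IHk oddM /=.
by case: b {IHk}; rewrite /= ?addn0 addn1.
Qed.

Section Toggles.
Variables (F : nat -> bool) (n x y : nat).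
Hypothesis constF : forall j, (j < n)%N -> j != x -> j != y -> F j.+1 = F j.
Hypothesis togF : forall j, (j < n)%N -> (j == x) || (j == y) -> F j.+1 = ~~ F j.
Hypothesis neq_xy : x != y.

(** In the applications [F] tells on which side of a strand with ends [x] and [y] a gap lies;
    walking along the boundary, it changes exactly at these ends. *)
Lemma toggle_val j : (j <= n)%N -> F j = F 0 (+) (x < j)%N (+) (y < j)%N.
Proof.
elim: j => [|j IHj] jn; first by rewrite !addbF.
have := constF jn; have := togF jn; rewrite {}(IHj (ltnW jn)).
rewrite [(x < j.+1)%N]ltnS [(x <= j)%N]leq_eqVlt.
rewrite [(y < j.+1)%N]ltnS [(y <= j)%N]leq_eqVlt ![j == _]eq_sym.
case: (eqVneq x j) neq_xy => [->|xj] yj.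
  move=> /(_ isT) -> _; rewrite orTb ltnn eq_sym (negPf yj) /=.
  by case: (F 0); case: (y < j)%N.
case: (eqVneq y j) => [->|yj'] => [/(_ isT)-> _|_ -> //].
by rewrite orTb ltnn; case: (F 0); case: (x < j)%N.
Qed.

End Toggles.

(** The gaps on the right of a strand are swept counterclockwise from its tail [t] to its head [h],
    and the remainder modulo [n] accounts for a passage through the base point. As [F j.+1] concerns
    the gap after point [j], each gap of the circle is counted once, gap [n] standing for gap 0. *)
Lemma toggle_count (F : nat -> bool) n t h :
    (forall j, (j < n)%N -> j != t -> j != h -> F j.+1 = F j) ->
    (t < n)%N -> (h < n)%N ->
    ~~ F t -> F t.+1 -> F h -> ~~ F h.+1 ->
  (\sum_(j < n) F j.+1 = (h + n - t) %% n)%N.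
Proof.
move=> cF tn hn Ft Ft1 Fh Fh1.
have th : t != h by apply: contraNneq Ft => ->.
have tF j : (j < n)%N -> (j == t) || (j == h) -> F j.+1 = ~~ F j.
  by move=> _ /orP[]/eqP->; [rewrite Ft1 | rewrite Fh; apply/negbTE].
have FE := toggle_val cF tF th.
have F0 : F 0 = (h < t)%N.
  by move: Ft; rewrite FE ?(ltnW tn) // ltnn addbF; case: (F 0); case: ltnP.
have ->: (\sum_(j < n) F j.+1 =
    \sum_(j < n) ((h < t) (+) (t < j.+1) (+) (h < j.+1)))%N.
  by apply: eq_bigr => j _; rewrite FE ?F0.
have := sum_ltn (ltnW tn); have := sum_ltn (ltnW hn).
(* For [h < t] the sweep passes the base point; for [t < h] it does not. *)
case: (ltngtP h t) th => // [lt_ht|lt_th] _ sh st.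
  have: (\sum_(j < n) (true (+) (t < j.+1) (+) (h < j.+1))
     + \sum_(j < n) (j < t) = n + \sum_(j < n) (j < h))%N.
    rewrite -big_split /=; transitivity (\sum_(j < n) (1 + (j < h)))%N; last first.
      by rewrite big_split /= sum1_card card_ord.
    by apply: eq_bigr => j _; rewrite !ltnS; do 4?case: ltnP => //=; lia.
  by rewrite sh st => e; rewrite modn_small; lia.
have: (\sum_(j < n) (false (+) (t < j.+1) (+) (h < j.+1))
     + \sum_(j < n) (j < t) = \sum_(j < n) (j < h))%N.
  rewrite -big_split /=.
  by apply: eq_bigr => j _; rewrite !ltnS; do 4?case: ltnP => //=; lia.
rewrite sh st => e.
by rewrite -addnBAC ?(ltnW lt_th) // modnDr modn_small; lia.
Qed.

Section SmoothingTheory.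
Variables (B : btype) (s : smoothing B).

(** The half of the dual tree beyond [c] on its white side, as an indicator function of regions. *)
Definition right_of (c : cmp s) (r : reg s) : bool :=
  connect (crossing_avoiding (pred1 c)) (wht c) r.

Lemma crossing_avoiding_invariant (A : Type) (P : pred (cmp s)) (f : reg s -> A) :
  (forall c, ~~ P c -> f (blk c) = f (wht c)) ->
  forall r r', crossing_avoiding P r r' -> f r = f r'.
Proof.
move=> Pf r r' /orP[]/existsP[c /and3P[Pc /eqP<- /eqP<-]]; rewrite ?Pf //.
Qed.

Lemma crossing_avoiding_sym (P : pred (cmp s)) :
  connect_sym (crossing_avoiding P).
Proof. exact: symrel_connect_sym. Qed.

Lemma crossing_avoiding_step (P : pred (cmp s)) c r :
  ~~ P c -> connect (crossing_avoiding P) r (blk c)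
            = connect (crossing_avoiding P) r (wht c).
Proof.
move=> Pc; apply: (same_connect_r (@crossing_avoiding_sym P)).
by apply: connect1; apply/orP; left; apply/existsP; exists c; rewrite Pc !eqxx.
Qed.

(* Separation and connectedness are expressed by functions on the regions:    *)
(* this form is stable under gluing.                                          *)
Lemma smoothing_okI :
    (forall c : cmp s, reg_black (blk c) && ~~ reg_black (wht c)) ->
    (forall j : gap B, reg_black (at_gap s j) = gap_black j) ->
    at_gap s ord0 = at_gap s ord_max ->
    (forall p : point B,
       (if is_tail p then @blk B s else @wht B s) (at_pt s p) = at_gap s (before p)) ->
    (forall p : point B,
       (if is_tail p then @wht B s else @blk B s) (at_pt s p) = at_gap s (after p)) ->
    (forall c : cmp s, is_loop c || (#|[set p | at_pt s p == c]| == 2)%N) ->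
    (forall f : reg s -> bool, (forall c : cmp s, f (blk c) = f (wht c)) ->
       forall r r', f r = f r') ->
    (forall c : cmp s, exists2 f : reg s -> bool, f (blk c) != f (wht c) &
       forall c', c' != c -> f (blk c') = f (wht c')) ->
  smoothing_ok s.
Proof.
move=> h1 h2 h3 h4 h5 h6 h7 h8; apply/and5P; split; try exact/forallP.
- by apply/forallP => j; rewrite h2.
- exact/eqP.
- by apply/forallP => p; rewrite h4.
apply/and4P; split; try exact/forallP.
- by apply/forallP => p; rewrite h5.
- apply/forallP => r; apply/forallP => r'.
  apply: connect_bool (@crossing_avoiding_sym _) r r' => f fe; apply: h7 => c.
  by apply: fe; apply/orP; left; apply/existsP; exists c; rewrite !eqxx.
apply/forallP => c; have [f fc fe] := h8 c.
apply: contra fc => /(connect_invariant (f := f)) -> //.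
by apply: crossing_avoiding_invariant.
Qed.

Hypothesis ok : smoothing_ok s.

Lemma blk_black (c : cmp s) : reg_black (blk c).
Proof. by case/and5P: ok => /forallP/(_ c)/andP[]. Qed.

Lemma wht_black (c : cmp s) : reg_black (wht c) = false.
Proof. by case/and5P: ok => /forallP/(_ c)/andP[_ /negbTE]. Qed.

Lemma at_gap_black j : reg_black (at_gap s j) = gap_black j.
Proof. by case/and5P: ok => _ /forallP/(_ j)/eqP. Qed.

Lemma at_gap_ends : at_gap s ord0 = at_gap s ord_max.
Proof. by case/and5P: ok => _ _ /eqP. Qed.

Lemma at_gap_before p :
  at_gap s (before p) = (if is_tail p then @blk B s else @wht B s) (at_pt s p).
Proof. by case/and5P: ok => _ _ _ /forallP/(_ p)/eqP. Qed.

Lemma at_gap_after p :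
  at_gap s (after p) = (if is_tail p then @wht B s else @blk B s) (at_pt s p).
Proof. by case/and5P: ok => _ _ _ _ /and4P[/forallP/(_ p)/eqP]. Qed.

Lemma strand_card (c : cmp s) : ~~ is_loop c -> #|[set p | at_pt s p == c]| = 2%N.
Proof.
by case/and5P: ok => _ _ _ _ /and4P[_ /forallP/(_ c)/orP[->|/eqP]].
Qed.

Lemma reg_invariant (A : Type) (f : reg s -> A) :
  (forall c : cmp s, f (blk c) = f (wht c)) -> forall r r', f r = f r'.
Proof.
case/and5P: ok => _ _ _ _ /and4P[_ _ /forallP con _] fe r r'.
have /forallP/(_ r')/(connect_invariant (f := f)) := con r; apply.
exact: crossing_avoiding_invariant.
Qed.

Lemma right_wht (c : cmp s) : right_of c (wht c).
Proof. exact: connect0. Qed.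

Lemma right_blk (c : cmp s) : right_of c (blk c) = false.
Proof.
case/and5P: ok => _ _ _ _ /and4P[_ _ _ /forallP/(_ c)/negbTE <-].
exact: crossing_avoiding_sym.
Qed.

Lemma right_cross (c c' : cmp s) :
  c' != c -> right_of c (blk c') = right_of c (wht c').
Proof. by move=> cc'; rewrite /right_of crossing_avoiding_step. Qed.

(** The exclusive or of two such functions changes across no component, and the dual graph is
    connected. *)
Lemma right_uniq (f : reg s -> bool) c :
    f (blk c) = false -> f (wht c) = true ->
    (forall c', c' != c -> f (blk c') = f (wht c')) ->
  forall r, right_of c r = f r.
Proof.
move=> fb fw fe r.
have: f r (+) right_of c r = f (wht c) (+) right_of c (wht c).
  apply: (reg_invariant (f := fun r => f r (+) right_of c r)) => c'.
  by have [->|/[dup]/fe-> /right_cross->//] := eqVneq c' c;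
    rewrite right_blk right_wht fb fw.
by rewrite fw right_wht; case: right_of; case: (f r).
Qed.

(** The outside of a counterclockwise loop is its white side. *)
Lemma ccwE (c : cmp s) : ccw c = right_of c (at_gap s ord0).
Proof.
symmetry; rewrite /ccw.
pose f r := ~~ connect (crossing_avoiding (pred1 c)) (blk c) r.
rewrite -/(f _); apply: right_uniq; rewrite /f.
- by rewrite connect0.
- by case/and5P: ok => _ _ _ _ /and4P[_ _ _ /forallP/(_ c)->].
by move=> c' cc'; rewrite crossing_avoiding_step.
Qed.

(** Indexing gaps by naturals makes the toggle lemmas applicable; [inord] is meaningful for [j] up
    to [2 * half B]. *)
Definition gap_right (c : cmp s) (j : nat) : bool :=
  right_of c (at_gap s (inord j)).

Lemma gap_right_before c (p : point B) :
  gap_right c p = right_of c (at_gap s (before p)).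
Proof.
congr (right_of _ (at_gap s _)); apply: val_inj; rewrite /= inordK //.
exact: leqW (ltn_ord p).
Qed.

Lemma gap_right_after c (p : point B) :
  gap_right c p.+1 = right_of c (at_gap s (after p)).
Proof.
congr (right_of _ (at_gap s _)); apply: val_inj; rewrite /= inordK //.
exact: ltn_ord p.
Qed.

Lemma gap_right_const c (p : point B) :
  at_pt s p != c -> gap_right c p.+1 = gap_right c p.
Proof.
move=> pc; rewrite gap_right_before gap_right_after.
by rewrite at_gap_before at_gap_after; case: is_tail; rewrite right_cross.
Qed.

Lemma gap_right_start (p : point B) : gap_right (at_pt s p) p = ~~ is_tail p.
Proof.
rewrite gap_right_before at_gap_before.
by case: is_tail; rewrite ?right_blk ?right_wht.
Qed.

Lemma gap_right_end (p : point B) : gap_right (at_pt s p) p.+1 = is_tail p.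
Proof.
rewrite gap_right_after at_gap_after.
by case: is_tail; rewrite ?right_blk ?right_wht.
Qed.

(** Walking along the boundary from one end of the strand to the other, the side changes once, and
    the side just before an end decides whether it is a tail. So the two ends are of opposite
    kinds. *)
Lemma strand_ends c : ~~ is_loop c -> exists t h : point B,
  [/\ at_pt s t = c, at_pt s h = c, is_tail t, ~~ is_tail h &
      forall p, at_pt s p = c -> p = t \/ p = h].
Proof.
move=> /strand_card /eqP /cards2P[x [y [xy e]]].
have cE p : (at_pt s p == c) = (p == x) || (p == y).
  by have := in_set2 p x y; rewrite -e inE.
have /eqP xc: at_pt s x == c by rewrite cE eqxx.
have /eqP yc: at_pt s y == c by rewrite cE eqxx orbT.
have FE := @toggle_val (gap_right c) (2 * half B) x y.
have {}FE : forall j, (j <= 2 * half B)%N ->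
    gap_right c j = gap_right c 0 (+) (x < j)%N (+) (y < j)%N.
  apply: FE => // j jn.
    by move=> jx jy; apply: (@gap_right_const c (Ordinal jn));
      rewrite cE negb_or -!val_eqE /= jx.
  have: at_pt s (Ordinal jn) == c -> gap_right c j.+1 = ~~ gap_right c j.
    move/eqP=> <-; rewrite (gap_right_end (Ordinal jn)).
    by rewrite (gap_right_start (Ordinal jn)) negbK.
  by rewrite cE -!val_eqE.
have txy : is_tail x != is_tail y.
  have := gap_right_start x; have := gap_right_start y.
  rewrite xc yc (FE _ (ltnW (ltn_ord x))) (FE _ (ltnW (ltn_ord y))) !ltnn.
  move: xy; rewrite -val_eqE /=.
  by case: (ltngtP x y) => // _ _; case: (gap_right c 0); do 2 case: is_tail.
have inP p : at_pt s p = c -> p = x \/ p = y.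
  by move/eqP; rewrite cE => /orP[]/eqP; [left|right].
have [tx|ntx] := boolP (is_tail x).
  by exists x, y; split=> //; move: txy; rewrite tx; case: is_tail.
exists y, x; split=> // [|p /inP[]]; [|by right|by left].
by move: txy; rewrite (negPf ntx); case: is_tail.
Qed.

Lemma half_gt0 (p : point B) : (0 < half B)%N.
Proof. by have := leq_ltn_trans (leq0n p) (ltn_ord p); rewrite muln_gt0. Qed.

(** The number [i] of the head counted from the tail is the number of gaps on the right
    ([toggle_count]), and [(i - k) / 2k] is [i / 2k - 1 / 2]. *)
Lemma rot_strand (c : cmp s) : ~~ is_loop c ->
  rot_cmp c = (\sum_(p : point B) (right_of c (at_gap s (after p)))%N%:R)
              / (2 * half B)%N%:R - 2^-1.
Proof.
move=> nlc; have [t [h [tc hc tt hh tP]]] := strand_ends nlc.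
rewrite /rot_cmp; case: pickP => [[p q] /= /and4P[/eqP pc /eqP qc tp hq]|]; last first.
  by move/(_ (t, h)); rewrite /= tc hc eqxx tt hh.
have ->: p = t by case: (tP _ pc) => // eph; move: tp; rewrite eph (negPf hh).
have ->: q = h by case: (tP _ qc) => // eqt; move: hq; rewrite eqt tt.
have k0: (half B)%:R != 0 :> rat by rewrite pnatr_eq0 -lt0n (half_gt0 t).
rewrite -natr_sum.
rewrite (eq_bigr (fun p : point B => gap_right c p.+1 : nat)); last first.
  by move=> j _; rewrite gap_right_after.
rewrite (@toggle_count (gap_right c) _ t h).
- by rewrite natrM; field.
- move=> j jn jt jh; apply: (gap_right_const (p := Ordinal jn)).
  apply/eqP=> /tP[/(congr1 val)/= e|/(congr1 val)/= e].
    by rewrite e eqxx in jt.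
  by rewrite e eqxx in jh.
- exact: ltn_ord.
- exact: ltn_ord.
- by rewrite -tc gap_right_start tt.
- by rewrite -tc gap_right_end tt.
- by rewrite -hc gap_right_start.
by rewrite -hc gap_right_end.
Qed.

(** A walk around the boundary circle never crosses a loop. *)
Lemma loop_right_gap (c : cmp s) j : is_loop c -> right_of c (at_gap s j) = ccw c.
Proof.
move=> /forallP lc; rewrite ccwE; case: j => j; elim: j => [|j IHj] jn.
  by congr (right_of _ (at_gap s _)); apply: val_inj.
have jn' : (j < 2 * half B)%N by [].
have <- := IHj (ltnW jn).
have := gap_right_const (lc (Ordinal jn')).
rewrite gap_right_before gap_right_after => e.
by rewrite -(_ : after (Ordinal jn') = Ordinal jn) ?e //;
  [congr (right_of _ (at_gap s _))|]; apply: val_inj.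
Qed.

Lemma rot_loop (c : cmp s) : is_loop c -> rot_cmp c = if ccw c then 1 else -1.
Proof.
move=> /forallP lc; rewrite /rot_cmp; case: pickP => [[p q] /= /and4P[]|//].
by rewrite (negPf (lc p)).
Qed.

Lemma card_strands : #|[set c : cmp s | ~~ is_loop c]| = half B.
Proof.
apply/eqP; rewrite -(eqn_pmul2l (isT : 0 < 2)%N); apply/eqP.
rewrite -[RHS](card_ord (2 * half B)) -[RHS]sum1_card.
rewrite [RHS](partition_big (at_pt s) (mem [set c : cmp s | ~~ is_loop c])) /=; last first.
  by move=> p _; rewrite inE negb_forall; apply/existsP; exists p; rewrite negbK.
rewrite mulnC -sum_nat_const; apply: eq_bigr => c; rewrite inE => /strand_card e.
by rewrite sum1dep_card e.
Qed.

(* Independent of the region [r]: crossing a component changes both terms.    *)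
Definition black_count (r : reg s) : nat :=
  (\sum_(c : cmp s) right_of c r + reg_black r)%N.

Lemma black_count_const r r' : black_count r = black_count r'.
Proof.
move: r r'; apply: (reg_invariant (f := black_count)) => c; rewrite /black_count.
rewrite blk_black wht_black (bigD1 c) //= [in RHS](bigD1 c) //=.
rewrite right_blk right_wht add0n addn0 addnC; congr (1 + _)%N.
by apply: eq_bigr => c' cc'; rewrite right_cross // eq_sym.
Qed.

(** At each gap the indicators [right_of c] sum up to [black_count r], minus one if the gap is
    black, which half of the gaps are; their average is [black_count r - 1 / 2]. Each strand
    subtracts a further [1 / 2]. A loop has contributed [ccw c] to the average and needs the
    correction [ccw c - 1]. *)
Lemma rotE r : (0 < half B)%N ->
  rot s = (black_count r)%:R - 2^-1 - (half B)%:R / 2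
          + \sum_(c : cmp s | is_loop c) ((ccw c)%N%:R - 1).
Proof.
move=> k0; have k0' : (half B)%:R != 0 :> rat by rewrite pnatr_eq0 -lt0n.
pose S c : rat := \sum_(p : point B) (right_of c (at_gap s (after p)))%N%:R.
have rE c : rot_cmp c = S c / (2 * half B)%N%:R - (~~ is_loop c)%N%:R / 2
                        + (if is_loop c then (ccw c)%N%:R - 1 else 0).
  case: ifPn => [lc|nlc]; last by rewrite addr0 rot_strand // mul1r.
  rewrite mul0r subr0 rot_loop // /S.
  rewrite (eq_bigr (fun=> (ccw c)%N%:R)) => [|p _]; last by rewrite loop_right_gap.
  rewrite sumr_const card_ord -[_ *+ _]mulr_natr mulfK; last first.
    by rewrite natrM mulf_neq0.
  by case: (ccw c).
rewrite /rot (eq_bigr _ (fun c _ => rE c)) !big_split /= -big_mkcond /=.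
congr (_ + _); last by rewrite big_split.
rewrite sumrN -!mulr_suml exchange_big /=.
have SE : \sum_(p : point B) \sum_c (right_of c (at_gap s (after p)))%N%:R
   = (2 * half B)%N%:R * (black_count r)%:R - (half B)%:R :> rat.
  have e p : \sum_c (right_of c (at_gap s (after p)))%N%:R =
      (black_count r)%:R - (gap_black (after p))%N%:R :> rat.
    rewrite (black_count_const r (at_gap s (after p))) /black_count.
    by rewrite at_gap_black natrD addrK natr_sum.
  rewrite (eq_bigr _ (fun p _ => e p)) big_split /= sumr_const card_ord.
  rewrite mulr_natl sumrN -natr_sum.
  by congr (_ - _%:R); apply: sum_odd_half.
rewrite SE -natr_sum.
have -> : (\sum_(c : cmp s) ~~ is_loop c)%N = half B.
  transitivity (\sum_(c : cmp s | ~~ is_loop c) 1)%N; last by rewrite sum1dep_card card_strands.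
  rewrite [RHS]big_mkcond /=.
  by apply: eq_bigr => c _; case: is_loop.
rewrite natrM; field.
by rewrite k0'.
Qed.

End SmoothingTheory.

(** * Diagrams with a single interconnecting arc *)

(** The condition is symmetric in the two ends: it does not fix the direction of the link. *)
Definition one_link d (Bin : 'I_d -> btype) Bout (D : diagram Bin Bout)
    (i0 i1 : 'I_d) (p0 : point (Bin i0)) (p1 : point (Bin i1)) : Prop :=
  [/\ i0 != i1, arc D (in_pt Bout p0) = in_pt Bout p1 &
      forall e, ~~ is_ext e -> ~~ is_ext (arc D e) ->
        e = in_pt Bout p0 \/ e = in_pt Bout p1].

Lemma basic_one_link d (Bin : 'I_d -> btype) Bout (D : diagram Bin Bout) :
    #|interconnecting D| = 1%N -> #|curls D| = 0%N ->
  exists i0 i1 (p0 : point (Bin i0)) (p1 : point (Bin i1)), one_link D p0 p1.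
Proof.
move=> /eqP/cards1P[e0 eI] /eqP; rewrite cards_eq0 => /eqP eC.
have inI e : (e \in interconnecting D) = (e == e0) by rewrite eI inE.
have: e0 \in interconnecting D by rewrite inI.
rewrite !inE => /and4P[src0 ext0 ext1 t01].
(* A source of an arc between input points is interconnecting, as there are no curls; any other end
   is handled through its partner. *)
have linkE e : ~~ is_ext e -> ~~ is_ext (arc D e) -> e = e0 \/ e = arc D e0.
  have H e' : arc_source e' -> ~~ is_ext e' -> ~~ is_ext (arc D e') -> e' = e0.
    move=> se ne na; apply/eqP; rewrite -inI inE se ne na /=.
    have: e' \notin curls D by rewrite eC inE.
    by rewrite inE se ne.
  case se: (arc_source e) => ne na; [by left; apply: H | right].
  by rewrite -(H (arc D e)) ?arcK // arc_oriented se.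
move: src0 ext0 ext1 t01 linkE; move ea: (arc D e0) => e1.
case: e0 e1 {inI eI eC} ea => [[i0|] p0] [[i1|] p1] //= ea _ _ _ t01 linkE.
exists i0, i1, p0, p1; split => //.
by apply: contra t01 => /eqP->.
Qed.

Section Regions.
Variables (d : nat) (Bin : 'I_d -> btype) (Bout : btype) (D : diagram Bin Bout).
Implicit Types (e : endpt Bin Bout) (g : dgap Bin Bout).

Definition next_pt e : endpt Bin Bout :=
  @existT _ (fun c => point (circ_type Bin Bout c)) (tag e) (ordS (tagged e)).

Local Notation rpi := (qpi (region_rel (arc D))).

(** At the last point of a circle this uses the identification of its last gap with gap 0. *)
Lemma region_next e : rpi (dafter e) = rpi (dbefore (next_pt e)).
Proof.
case: e => c p; rewrite /dafter /dbefore /=.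
have [pn|pn] := ltnP p.+1 (2 * half (circ_type Bin Bout c)).
  congr rpi; congr existT; apply: val_inj.
  by rewrite /= /bump leq0n modn_small.
have pn1 : (p.+1 = 2 * half (circ_type Bin Bout c))%N.
  by apply/eqP; rewrite eqn_leq pn ltn_ord.
symmetry; apply: qpi_eq; apply/orP; left; apply/existsP; exists c.
apply/andP; split; apply/eqP; congr existT; apply: val_inj => /=.
  by rewrite pn1 modnn.
by rewrite /bump leq0n add1n pn1.
Qed.

(** The number of points on a circle is even. Hence the point following a link end is off the
    link. *)
Lemma next_pt_neq e : next_pt e != e.
Proof.
case: e => c p; rewrite -tag_eqE /tag_eq /= eqxx /= tagged_asE -val_eqE /=.
have := ltn_ord p; move: (half _) (val p) => k m mk.
have [pn|pn] := ltnP m.+1 (2 * k); first by rewrite modn_small //; lia.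
have -> : m.+1 = (2 * k)%N by lia.
by rewrite modnn; lia.
Qed.

Lemma region_arc_ext e : is_ext e (+) is_ext (arc D e) ->
  rpi (dbefore e) = rpi (dbefore (arc D e)).
Proof.
move=> ee; apply: qpi_eq; apply/orP; right; apply/existsP; exists e.
by rewrite ee !eqxx.
Qed.

Lemma region_arc_ext_after e : is_ext e (+) is_ext (arc D e) ->
  rpi (dafter e) = rpi (dafter (arc D e)).
Proof.
move=> ee; apply: qpi_eq; apply/orP; right; apply/existsP; exists e.
by rewrite ee !eqxx orbT.
Qed.

Lemma region_arc_in e : ~~ is_ext e -> ~~ is_ext (arc D e) ->
  rpi (dafter e) = rpi (dbefore (arc D e)).
Proof.
move=> ee ea; apply: qpi_eq; apply/orP; right; apply/existsP; exists e.
by rewrite (negPf ee) (negPf ea) !eqxx.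
Qed.

Lemma extP e : is_ext e -> exists p, e = ext_pt Bin p.
Proof. by case: e => [[i|] p] // _; exists p. Qed.

Lemma inptP e : ~~ is_ext e -> exists i (p : point (Bin i)), e = in_pt Bout p.
Proof. by case: e => [[i|] p] // _; exists i, p. Qed.

(** The ends of an arc are of opposite kinds if both lie on inputs and of the same kind if one is
    external, which fits the way [region_rel] matches their gaps. *)
Lemma region_color g h : region_rel (arc D) g h -> dgap_black g = dgap_black h.
Proof.
have bE e : dgap_black (dbefore e) = is_tail (tagged e) by [].
have aE e : dgap_black (dafter e) = ~~ is_tail (tagged e).
  by rewrite /dgap_black /is_tail /gap_black /= addbN.
move=> /orP[/existsP[c /andP[/eqP-> /eqP->]]|/existsP[e]].
  by rewrite /dgap_black /gap_black /= oddM.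
have := arc_oriented D e; rewrite /arc_source.
case ee: (is_ext e); case ea: (is_ext (arc D e)) => //= ts.
- by have := arc_ext D ee; rewrite ea.
- by case/orP=> /andP[/eqP-> /eqP->]; rewrite ?bE ?aE; move: ts;
    do 2 case: is_tail.
- by case/orP=> /andP[/eqP-> /eqP->]; rewrite ?bE ?aE; move: ts;
    do 2 case: is_tail.
case/andP=> /eqP-> /eqP->; rewrite ?bE ?aE; move: ts.
by do 2 case: is_tail.
Qed.

End Regions.

(** * Regions of a diagram with one link *)

Section OneLink.
Variables (Bin : 'I_2 -> btype) (Bout : btype) (D : diagram Bin Bout).
Variables (i0 i1 : 'I_2) (p0 : point (Bin i0)) (p1 : point (Bin i1)).
Hypothesis link : one_link D p0 p1.
Implicit Types (e : endpt Bin Bout) (g : dgap Bin Bout).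

Local Notation rpi := (qpi (region_rel (arc D))).
Local Notation e0 := (in_pt Bout p0).
Local Notation e1 := (in_pt Bout p1).

Lemma link_neq : i0 != i1. Proof. by case: link. Qed.

Lemma link_arc0 : arc D e0 = e1. Proof. by case: link. Qed.

Lemma link_arc1 : arc D e1 = e0. Proof. by rewrite -link_arc0 arcK. Qed.

Lemma link_side i : i = i0 \/ i = i1.
Proof.
suff: (i == i0) || (i == i1) by case/orP => /eqP->; [left | right].
have := link_neq; rewrite -!val_eqE /=.
by have := ltn_ord i; have := ltn_ord i0; have := ltn_ord i1; lia.
Qed.

Lemma big_link (R : Type) (idx : R) (op : Monoid.com_law idx) (F : 'I_2 -> R) :
  \big[op/idx]_i F i = op (F i0) (F i1).
Proof.
rewrite (bigD1 i0) //= (bigD1 i1) ?(eq_sym i1) ?link_neq //= big1 ?Monoid.mulm1 //.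
by move=> i /andP[n0 n1]; case: (link_side i) n0 n1 => ->; rewrite eqxx ?andbF.
Qed.

Lemma link_in_half i : (0 < half (Bin i))%N.
Proof. by case: (link_side i) => ->; apply: half_gt0; [exact: p0|exact: p1]. Qed.

Lemma link_ext_arc e : ~~ is_ext e -> e != e0 -> e != e1 -> is_ext (arc D e).
Proof.
move=> ne n0 n1; apply/negPn/negP => na.
by case: link => _ _ /(_ e ne na)[] e_; rewrite e_ eqxx in n0 n1.
Qed.

Lemma e01_neq : e0 != e1.
Proof. by apply: contra link_neq => /eqP/(congr1 tag)/=[->]. Qed.

Section Lift.
Variables (A : Type) (f : forall i, gap (Bin i) -> A).
Hypothesis f_ends : forall i, @f i ord0 = @f i ord_max.
Hypothesis f_left : f (before p0) = f (after p1).
Hypothesis f_right : f (after p0) = f (before p1).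

(** The dummy value [a] is for external gaps; only values at input gaps matter below. *)
Let fg (a : A) g : A :=
  match g with existT (Some i) j => @f i j | existT None _ => a end.

Let fg_next a e : ~~ is_ext e -> fg a (dafter e) = fg a (dbefore (next_pt e)).
Proof.
case/inptP => i [p ->]; rewrite /fg /=.
have [pn|pn] := ltnP p.+1 (2 * half (Bin i)).
  by congr f; apply: val_inj; rewrite /= /bump leq0n modn_small.
have pn1 : (p.+1 = 2 * half (Bin i))%N.
  by apply/eqP; rewrite eqn_leq pn ltn_ord.
have -> : after p = ord_max by apply: val_inj; rewrite /= /bump leq0n add1n pn1.
by rewrite -f_ends; congr f; apply: val_inj; rewrite /= pn1 modnn.
Qed.

(** An input point off the link is joined to an external point, with the same gap before it. From a
    link end one passes to the gap after the other link end and on to the next point there, which is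
    off the link; [f_left] and [f_right] carry the value of [f] along. *)
Lemma region_before_ext a e : ~~ is_ext e ->
  exists p : point Bout, rpi (dbefore (ext_pt Bin p)) = rpi (dbefore e) /\
     fg a (dbefore (arc D (ext_pt Bin p))) = fg a (dbefore e).
Proof.
have H e' : ~~ is_ext e' -> e' != e0 -> e' != e1 ->
    exists p : point Bout, rpi (dbefore (ext_pt Bin p)) = rpi (dbefore e') /\
     fg a (dbefore (arc D (ext_pt Bin p))) = fg a (dbefore e').
  move=> ne n0 n1; have ea := link_ext_arc ne n0 n1.
  have [p pE] := extP ea; exists p; rewrite -pE arcK; split=> //.
  by rewrite -region_arc_ext // ea (negPf ne).
have nx e' : ~~ is_ext e' -> next_pt e' != e0 -> next_pt e' != e1 ->
    exists p : point Bout, rpi (dbefore (ext_pt Bin p)) = rpi (dafter e') /\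
     fg a (dbefore (arc D (ext_pt Bin p))) = fg a (dafter e').
  by move=> ne n0 n1; rewrite region_next fg_next //; apply: H.
move=> ne; have [->|n0] := eqVneq e e0.
  have [//|||p [p1E p2E]] := nx e1.
  - by apply/eqP=> /(congr1 tag)/=[ii]; move: link_neq; rewrite ii eqxx.
  - exact: next_pt_neq.
  exists p; rewrite p1E p2E; split; last by rewrite /fg /= f_left.
  by rewrite region_arc_in ?link_arc1.
have [->|n1] := eqVneq e e1; last exact: H.
have [//|||p [p1E p2E]] := nx e0.
- exact: next_pt_neq.
- by apply/eqP=> /(congr1 tag)/=[ii]; move: link_neq; rewrite ii eqxx.
exists p; rewrite p1E p2E; split; last by rewrite /fg /= f_right.
by rewrite region_arc_in ?link_arc0.
Qed.

Lemma in_gap_before i (j : gap (Bin i)) : exists p : point (Bin i),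
  rpi (in_gap Bout j) = rpi (dbefore (in_pt Bout p)) /\ f j = f (before p).
Proof.
have k0 : (0 < 2 * half (Bin i))%N by rewrite muln_gt0 link_in_half.
have [jn|jn] := ltnP j (2 * half (Bin i)).
  have -> : j = before (Ordinal jn) by apply: val_inj.
  by exists (Ordinal jn).
have -> : j = ord_max by apply/val_inj/eqP; rewrite eqn_leq jn -ltnS ltn_ord.
exists (Ordinal k0); have e : before (Ordinal k0) = ord0 by apply: val_inj.
split; last by rewrite e f_ends.
symmetry; apply: qpi_eq; apply/orP; left; apply/existsP; exists (Some i).
by apply/andP; split; apply/eqP => //; congr existT; apply: val_inj.
Qed.

(** With [n] external points there are [n] boundary arcs and the link, so [n + 1] arcs; Euler's
    formula with three circles leaves [n] regions. *)
Lemma card_region : #|region D| = #|point Bout|.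
Proof.
have cs : (#|[set e | arc_source (Bin := Bin) (Bout := Bout) e]|
         = #|[set e | ~~ arc_source (Bin := Bin) (Bout := Bout) e]|)%N.
  rewrite -(card_imset _ (inv_inj (arcK D))); apply: eq_card => e.
  rewrite inE; apply/imsetP/idP => [[e' ]|ne].
    by rewrite inE => se ->; rewrite arc_oriented se.
  by exists (arc D e); rewrite ?arcK // inE arc_oriented.
have ce : #|[set e | is_ext (Bin := Bin) (Bout := Bout) e]| = #|point Bout|.
  rewrite -(card_imset (mem predT) (f := @ext_pt _ Bin Bout)); last first.
    by move=> p q /eqP; rewrite -tag_eqE /tag_eq /= tagged_asE => /eqP.
  apply: eq_card => e; rewrite inE; apply/idP/imsetP => [/extP[p ->]|[p _ ->//]].
  by exists p.
have ci : #|[set e | ~~ is_ext (Bin := Bin) (Bout := Bout) e]|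
    = (#|point Bout| + 2)%N.
  have -> : [set e | ~~ is_ext (Bin := Bin) (Bout := Bout) e]
      = [set arc D e | e in [set e | is_ext e]] :|: [set e0; e1].
    apply/setP => e; rewrite !inE; apply/idP/orP => [ne|[/imsetP[e' ]|]].
    - have [->|n0] := eqVneq e e0; first by right.
      have [->|n1] := eqVneq e e1; first by right; rewrite orbT.
      left; apply/imsetP; exists (arc D e); rewrite ?arcK // inE.
      exact: link_ext_arc.
    - by rewrite inE => /(arc_ext D) n ->.
    by case/orP => /eqP->.
  rewrite cardsU cards2 e01_neq (card_imset _ (inv_inj (arcK D))) ce.
  rewrite (_ : _ :&: _ = set0) ?cards0 ?subn0 //.
  apply/setP => e; rewrite !inE; apply/negbTE/negP => /andP[/imsetP[e' ]].
  rewrite inE => ee' -> /orP[]/eqP/(canRL (arcK D)) e_; move: ee'.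
    by rewrite e_ link_arc0.
  by rewrite e_ link_arc1.
have tot (P : pred (endpt Bin Bout)) :
    (#|[set e | P e]| + #|[set e | ~~ P e]|)%N = #|endpt Bin Bout|.
  rewrite -(cardsC [set e | P e]); congr addn.
  by apply: eq_card => e; rewrite !inE.
have := arc_planar D; have := tot (@arc_source _ _ _); have := tot (@is_ext _ _ _).
rewrite ce ci -cs => <- t2 t3; apply: (@addnI 3); rewrite t3.
by lia.
Qed.

Lemma out_half_gt0 : (0 < half Bout)%N.
Proof.
have ne : ~~ is_ext e0 by [].
pose e := next_pt e0; have ne' : ~~ is_ext e by [].
have ee : is_ext (arc D e).
  apply: link_ext_arc => //; first exact: next_pt_neq.
  by apply/eqP=> /(congr1 tag)/=[ii]; move: link_neq; rewrite ii eqxx.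
by have [p _] := extP ee; apply: half_gt0 p.
Qed.

(** The gap before an external point defines a map onto the regions, which is injective by
    [card_region]. So each region singles out one external point, and [f] is read off at the input
    end of its arc. *)
Lemma region_lift :
  exists F : region D -> A, forall i (j : gap (Bin i)), F (rpi (in_gap Bout j)) = f j.
Proof.
pose a := f (before p0).
pose phi (p : point Bout) : region D := rpi (dbefore (ext_pt Bin p)).
have phi_surj z : exists p, phi p == z.
  have [[[i|] j] <-] := qpi_surj z.
    have [q [qE _]] := in_gap_before j.
    have [//|p [pE _]] := @region_before_ext a (in_pt Bout q).
    by exists p; rewrite /phi pE -qE.
  have k0 : (0 < 2 * half Bout)%N by rewrite muln_gt0 out_half_gt0.
  have [jn|jn] := ltnP j (2 * half Bout).
    exists (Ordinal jn); apply/eqP; congr rpi; congr existT; exact: val_inj.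
  exists (Ordinal k0); apply/eqP/qpi_eq; apply/orP; left.
  apply/existsP; exists None; apply/andP; split; apply/eqP; congr existT.
    exact: val_inj.
  by apply/val_inj/eqP; rewrite eqn_leq jn -ltnS ltn_ord.
have phi_inj : injective phi.
  have /imset_injP : #|phi @: predT| == #|point Bout|.
    rewrite -card_region; apply/eqP/eq_card => z; rewrite !inE.
    by apply/imsetP; have [p /eqP <-] := phi_surj z; exists p.
  by move=> inj x y; apply: inj.
exists (fun z => fg a (dbefore (arc D (ext_pt Bin (xchoose (phi_surj z)))))).
move=> i j; have [q [qE jE]] := in_gap_before j.
have [//|p [pE fE]] := @region_before_ext a (in_pt Bout q).
rewrite jE -[RHS]fE; do 4 congr (_ _); apply: phi_inj.
by rewrite (eqP (xchooseP (phi_surj _))) qE.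
Qed.

End Lift.

Lemma region_in (z : region D) : exists i (j : gap (Bin i)), rpi (in_gap Bout j) = z.
Proof.
have [[[i|] j] <-] := qpi_surj z; first by exists i, j.
have k0 : (0 < 2 * half Bout)%N by rewrite muln_gt0 out_half_gt0.
have H (p : point Bout) : exists i (j : gap (Bin i)),
    rpi (in_gap Bout j) = rpi (dbefore (ext_pt Bin p)).
  have ee : is_ext (ext_pt Bin p) by [].
  have na := arc_ext D ee; have [i [q qE]] := inptP na.
  by exists i, (before q); rewrite region_arc_ext ?qE //= -qE na.
have [jn|jn] := ltnP j (2 * half Bout).
  have [i [j' E]] := H (Ordinal jn); exists i, j'; rewrite E.
  congr rpi; congr existT; exact: val_inj.
have [i [j' E]] := H (Ordinal k0); exists i, j'; rewrite E.
apply/qpi_eq; apply/orP; left.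
apply/existsP; exists None; apply/andP; split; apply/eqP; congr existT.
  exact: val_inj.
by apply/val_inj/eqP; rewrite eqn_leq jn -ltnS ltn_ord.
Qed.

End OneLink.

(** * Gluing smoothings *)

(** The trace of a single link: components, surfaces and boundary circles of the inputs all map to
    those of the glue in this way. *)
Definition pinch (X Z : finType) (q : X -> Z) (x0 x1 : X) : Prop :=
  [/\ forall z, exists x, q x = z, x0 != x1, q x0 = q x1 &
      forall x y, q x = q y -> x = y \/ (x \in pred2 x0 x1) && (y \in pred2 x0 x1)].

Section Pinch.
Variables (X Z : finType) (q : X -> Z) (x0 x1 : X).
Hypothesis pq : pinch q x0 x1.

Lemma pinch_fiber0 (R : nmodType) (w : X -> R) :
  \sum_(x | q x == q x0) w x = w x0 + w x1.
Proof.
have [_ n01 q01 qi] := pq.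
rewrite (bigD1 x0) //= (bigD1 x1) /=; last by rewrite q01 eqxx eq_sym.
rewrite big1 ?addr0 // => x /andP[/andP[/eqP qx nx0] nx1].
case: (qi _ _ qx) => [xx|/andP[]]; first by rewrite xx eqxx in nx0.
by rewrite !inE (negPf nx0) (negPf nx1).
Qed.

Lemma pinch_fiber (R : nmodType) (w : X -> R) y :
  q y != q x0 -> \sum_(x | q x == q y) w x = w y.
Proof.
have [_ n01 q01 qi] := pq => nq.
rewrite (bigD1 y) //= big1 ?addr0 // => x /andP[/eqP qx nx].
case: (qi _ _ qx) => [xx|/andP[_]]; first by rewrite xx eqxx in nx.
by rewrite !inE => /orP[]/eqP yx; move: nq; rewrite yx ?q01 eqxx.
Qed.

(** The fibre over [q x0] has two elements, every other fibre has one. *)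
Lemma pinch_big (R : nmodType) (F : Z -> R) :
  \sum_x F (q x) = \sum_z F z + F (q x0).
Proof.
have [sq _ _ _] := pq.
rewrite -(big_fiber q predT) /= [in RHS](bigD1 (q x0)) //=.
rewrite [LHS](bigD1 (q x0)) //= (pinch_fiber0 (fun x => F (q x))).
have [_ _ <- _] := pq; rewrite [RHS]addrAC; congr (_ + _).
apply: eq_bigr => z nz; have [x xz] := sq z; rewrite -xz.
by rewrite (pinch_fiber (fun x => F (q x))) // xz.
Qed.

Lemma pinch_bign (F : Z -> nat) :
  (\sum_x F (q x) = \sum_z F z + F (q x0))%N.
Proof. exact: pinch_big. Qed.

End Pinch.

Lemma sum_sigma (Rg : Type) (idx : Rg) (op : Monoid.com_law idx)
    (I : finType) (T : I -> finType)
    (P : pred {i : I & T i}) (F : {i : I & T i} -> Rg) :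
  \big[op/idx]_(x | P x) F x
  = \big[op/idx]_i \big[op/idx]_(a : T i | P (existT T i a)) F (existT T i a).
Proof.
rewrite (@sig_big_dep _ _ op _ T predT (fun i a => P (existT T i a))
  (fun i a => F (existT T i a))) /=.
by apply: eq_big => [[i a]|[i a]].
Qed.

Arguments sum_sigma {Rg idx op I T} P F.

(** * Gluing smoothings along an arbitrary diagram *)

Section Glue.
Variables (d : nat) (Bin : 'I_d -> btype) (Bout : btype) (D : diagram Bin Bout).
Variable s : forall i, smoothing (Bin i).
Hypothesis ok : forall i, smoothing_ok (s i).
Implicit Types (e : endpt Bin Bout) (g : dgap Bin Bout).

Local Notation C := {i : 'I_d & cmp (s i)}.
Local Notation R := {i : 'I_d & reg (s i)}.
Local Notation tagc i a := (existT (fun k => cmp (s k)) i a).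
Local Notation tagr i r := (existT (fun k => reg (s k)) i r).
Local Notation S := (act_smoothing D s).
Local Notation rpi := (qpi (region_rel (arc D))).

Definition dcmp (x : C) : cmp S := glue_cmp D (inr x).
Definition dreg (y : R) : reg S := glue_reg D (inr y).
Definition ecmp e : cmp S := glue_cmp D (inl e).
Definition greg g : reg S := glue_reg D (inl g).

Definition side (b : bool) (x : C) : R :=
  tagr (tag x) (if b then blk (tagged x) else wht (tagged x)).

Definition pt_cmp i (p : point (Bin i)) : C := tagc i (at_pt (s i) p).

Lemma ecmp_arc e : ecmp (arc D e) = ecmp e.
Proof. by symmetry; apply: qpi_eq; exact: eqxx. Qed.

Lemma ecmp_in i (p : point (Bin i)) : ecmp (in_pt Bout p) = dcmp (pt_cmp p).
Proof.
by apply: qpi_eq; apply/existsP; exists p; rewrite /= !eqxx.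
Qed.

Lemma greg_in i (j : gap (Bin i)) :
  greg (in_gap Bout j) = dreg (tagr i (at_gap (s i) j)).
Proof.
by apply: qpi_eq; apply/existsP; exists j; rewrite /= !eqxx.
Qed.

Lemma greg_region g h : rpi g = rpi h -> greg g = greg h.
Proof. by apply: (@qpi_inv _ _ _ greg) => g' h' gh; apply: qpi_eq. Qed.

Lemma glue_cmp_inv (A : Type) (fe : endpt Bin Bout -> A) (f : C -> A) :
    (forall e, fe (arc D e) = fe e) ->
    (forall i (p : point (Bin i)), fe (in_pt Bout p) = f (pt_cmp p)) ->
  let F x := match x with inl e => fe e | inr c => f c end in
  forall x, F (val (glue_cmp D x)) = F x.
Proof.
move=> fa fp F; apply: qpi_lift => -[e|x] [e'|[i y]] //=.
  by move/eqP <-; rewrite /F fa.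
by case/existsP => p /andP[/eqP-> /eqP/= <-]; rewrite /F fp.
Qed.

Lemma glue_reg_inv (A : Type) (fg : dgap Bin Bout -> A) (f : R -> A) :
    (forall g h, region_rel (arc D) g h -> fg g = fg h) ->
    (forall i (j : gap (Bin i)), fg (in_gap Bout j) = f (tagr i (at_gap (s i) j))) ->
  let F x := match x with inl e => fg e | inr c => f c end in
  forall x, F (val (glue_reg D x)) = F x.
Proof.
move=> fa fp F; apply: qpi_lift => -[e|x] [e'|[i y]] //=.
  exact: fa.
by case/existsP => p /andP[/eqP-> /eqP/= <-]; rewrite /F fp.
Qed.

Lemma dcmp_surj z : exists x, dcmp x = z.
Proof.
have [[e|x] <-] := qpi_surj z; last by exists x.
have H e' : ~~ is_ext e' -> exists x, dcmp x = ecmp e'.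
  by case/inptP => i [p ->]; rewrite ecmp_in; exists (pt_cmp p).
have [/(arc_ext D)/H|/H//] := boolP (is_ext e).
by rewrite ecmp_arc.
Qed.

(** [glue_side] looks at the canonical representative only; every piece of the component, arc end or
    input component, has to give the same region. *)
Lemma side_glue b : (forall x, glue_side (D := D) b (dcmp x) = dreg (side b x)) /\
  (forall e, glue_side (D := D) b (ecmp e) =
    greg (if dgap_black (dbefore e) == b then dbefore e else dafter e)).
Proof.
pose fe e := greg (if dgap_black (dbefore e) == b then dbefore e else dafter e).
pose F x := match x with inl e => fe e | inr c => dreg (side b c) end.
have FE x : F (val (glue_cmp D x)) = F x.
  apply: glue_cmp_inv => [e|i p].
    rewrite /fe; apply: greg_region.
    have bE e' : dgap_black (dbefore e') = is_tail (tagged e') by [].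
    have := arc_oriented D e; rewrite /arc_source !bE.
    case ee: (is_ext e); case ea: (is_ext (arc D e)) => ts.
    - by have := arc_ext D ee; rewrite ea.
    - have -> : is_tail (tagged (arc D e)) = is_tail (tagged e).
        by move: ts; do 2 case: is_tail.
      by case: ifP => _; [rewrite region_arc_ext|rewrite region_arc_ext_after];
        rewrite ?arcK ?ee ?ea.
    - have -> : is_tail (tagged (arc D e)) = is_tail (tagged e).
        by move: ts; do 2 case: is_tail.
      by case: ifP => _; [rewrite region_arc_ext|rewrite region_arc_ext_after];
        rewrite ?arcK ?ee ?ea.
    have -> : is_tail (tagged (arc D e)) = ~~ is_tail (tagged e).
      by move: ts; do 2 case: is_tail.
    have r1 : rpi (dafter e) = rpi (dbefore (arc D e)).
      by rewrite region_arc_in ?ee ?ea.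
    have r2 : rpi (dafter (arc D e)) = rpi (dbefore e).
      by rewrite region_arc_in ?arcK ?ee ?ea.
    by clear F fe; case: b; case: is_tail; rewrite /= ?r1 ?r2.
  rewrite /fe /side /pt_cmp /=.
  have -> : dgap_black (dbefore (in_pt Bout p)) = is_tail p by [].
  have gb : greg (dbefore (in_pt Bout p)) = dreg (tagr i (at_gap (s i) (before p))).
    exact: greg_in.
  have ga : greg (dafter (in_pt Bout p)) = dreg (tagr i (at_gap (s i) (after p))).
    exact: greg_in.
  case: eqP => [<-|]; first by rewrite gb at_gap_before //; case: is_tail.
  by rewrite ga at_gap_after //; clear F fe; case: b; case: is_tail.
have E c : glue_side (D := D) b c = F (val c).
  by rewrite /glue_side; case: (val c) => // -[].
by split=> [x|e]; rewrite E FE.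
Qed.

Lemma blk_dcmp x : @blk _ S (dcmp x) = dreg (side true x).
Proof. exact: (side_glue true).1. Qed.

Lemma wht_dcmp x : @wht _ S (dcmp x) = dreg (side false x).
Proof. exact: (side_glue false).1. Qed.

Lemma reg_black_glue : (forall y, @reg_black _ S (dreg y) = reg_black (tagged y)) /\
  (forall g, @reg_black _ S (greg g) = dgap_black g).
Proof.
pose F (x : dgap Bin Bout + R) := match x with
  | inl g => dgap_black g | inr y => reg_black (tagged y) end.
have FE x : F (val (glue_reg D x)) = F x.
  apply: glue_reg_inv => [g h /region_color//|i j].
  by rewrite /= at_gap_black.
have E c : @reg_black _ S c = F (val c) by rewrite /=; case: (val c) => // -[].
by split=> [x|e]; rewrite E FE.
Qed.

Lemma big_pt_cmp (Rg : nmodType) (w : forall i, point (Bin i) -> Rg) (P : pred C) :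
  \sum_i \sum_(p : point (Bin i) | P (pt_cmp p)) w i p
  = \sum_(x | P x) \sum_(p | at_pt (s (tag x)) p == tagged x) w (tag x) p.
Proof.
rewrite sum_sigma /=.
by apply: eq_bigr => i _; rewrite big_fiber.
Qed.

Lemma big_in_pt (Rg : nmodType) (w : endpt Bin Bout -> Rg) (P : pred (endpt Bin Bout)) :
  \sum_(e | ~~ is_ext e && P e) w e
  = \sum_i \sum_(p : point (Bin i) | P (in_pt Bout p)) w (in_pt Bout p).
Proof.
pose f (x : {i : 'I_d & point (Bin i)}) : endpt Bin Bout := in_pt Bout (tagged x).
have fI : injective f.
  move=> [i p] [j q] /eqP; rewrite -tag_eqE /tag_eq /= => /andP[/eqP[ij]].
  by case: j / ij q => q; rewrite tagged_asE => /eqP->.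
rewrite -(sum_sigma (fun x => P (f x)) (fun x => w (f x))).
have := @big_imset_cond _ _ _ _ _ f predT (fun e => P e) w => /= <-; last first.
  by move=> x y _ _; apply: fI.
apply: eq_bigl => e; congr (_ && _); apply/idP/imsetP => [/inptP[i [p ->]]|[x _ ->//]].
by exists (existT _ i p).
Qed.

Lemma strand_cardE B (r : smoothing B) (c : cmp r) : smoothing_ok r ->
  (\sum_(p | at_pt r p == c) 1 = 2 * ~~ is_loop c)%N.
Proof.
move=> okr; rewrite sum1dep_card.
have [lc|/(strand_card okr) //] := boolP (is_loop c).
by apply: eq_card0 => p; rewrite !inE; apply/negbTE; move/forallP: lc.
Qed.

Lemma card_in_ends z :
  (#|[set e | ~~ is_ext e & ecmp e == z]|
   = 2 * \sum_(x | dcmp x == z) ~~ is_loop (tagged x))%N.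
Proof.
rewrite -sum1dep_card big_in_pt.
rewrite (eq_bigr (fun i => \sum_(p : point (Bin i) | dcmp (pt_cmp p) == z) 1))%N; last first.
  by move=> i _; apply: eq_bigl => p; rewrite ecmp_in.
rewrite (big_pt_cmp (fun _ _ => 1%N) (fun x => dcmp x == z)) big_distrr /=.
by apply: eq_bigr => x _; rewrite strand_cardE.
Qed.

Lemma card_ext_ends z :
  #|[set e | is_ext e & ecmp e == z]| = #|[set p | at_pt S p == z]|.
Proof.
have eI : injective (@ext_pt _ Bin Bout).
  by move=> p q /eqP; rewrite -tag_eqE /tag_eq /= tagged_asE => /eqP.
rewrite -[RHS](card_imset _ eI); apply: eq_card => e; rewrite !inE.
apply/andP/imsetP => [[/extP[p ->] ez]|[p]]; first by exists p; rewrite ?inE.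
by rewrite inE => ez ->.
Qed.

(** The involution [arc D] exchanges sources and targets and preserves the glued component. *)
Lemma card_arc_ends z :
  (2 * #|[set e | arc_source e & ecmp e == z]| =
   #|[set e | is_ext e & ecmp e == z]| + #|[set e | ~~ is_ext e & ecmp e == z]|)%N.
Proof.
have split_by (P : pred (endpt Bin Bout)) :
    (#|[set e | P e & ecmp e == z]| + #|[set e | ~~ P e & ecmp e == z]|)%N
    = #|[set e | ecmp e == z]|.
  rewrite -(cardsID [set e | P e] [set e | ecmp e == z]); congr addn.
    by apply: eq_card => e; rewrite !inE andbC.
  by apply: eq_card => e; rewrite !inE.
rewrite split_by -(split_by (@arc_source _ _ _)) mul2n -addnn; congr addn.
rewrite -(card_imset _ (inv_inj (arcK D))); apply: eq_card => e.
rewrite inE; apply/imsetP/andP => [[e']|[ne ez]].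
  by rewrite inE => /andP[se ez] ->; rewrite arc_oriented se ecmp_arc.
by exists (arc D e); rewrite ?arcK // inE arc_oriented ne ecmp_arc.
Qed.

(* The left side is the Euler characteristic (strands + arcs - inner ends) of *)
(* a component of the glued curve; the identity is a double count of the ends.*)
Lemma glue_curve_chi z : smoothing_ok S ->
  (\sum_(x | dcmp x == z) (~~ is_loop (tagged x))%:Z
   + #|[set e | arc_source e & ecmp e == z]|%:Z
   - #|[set e | ~~ is_ext e & ecmp e == z]|%:Z = (~~ is_loop z)%:Z)%R.
Proof.
move=> okS; have := card_arc_ends z; rewrite card_ext_ends card_in_ends.
have := strand_cardE z okS; rewrite sum1dep_card => ->; rewrite -(big_morph Posz PoszD (erefl _)).
by lia.
Qed.

End Glue.

(** * Gluing smoothings along one link: dual trees and rotation numbers *)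

Section GlueLink.
Variables (Bin : 'I_2 -> btype) (Bout : btype) (D : diagram Bin Bout).
Variables (i0 i1 : 'I_2) (p0 : point (Bin i0)) (p1 : point (Bin i1)).
Hypothesis link : one_link D p0 p1.
Variable s : forall i, smoothing (Bin i).
Hypothesis ok : forall i, smoothing_ok (s i).

Local Notation C := {i : 'I_2 & cmp (s i)}.
Local Notation R := {i : 'I_2 & reg (s i)}.
Local Notation tagc i a := (existT (fun k => cmp (s k)) i a).
Local Notation tagr i r := (existT (fun k => reg (s k)) i r).
Local Notation S := (act_smoothing D s).
Local Notation rpi := (qpi (region_rel (arc D))).
Local Notation x0 := (pt_cmp s p0).
Local Notation x1 := (pt_cmp s p1).
Local Notation dcmp := (@dcmp _ _ _ D s).
Local Notation dreg := (@dreg _ _ _ D s).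
Local Notation ecmp := (@ecmp _ _ _ D s).
Local Notation c0 := (at_pt (s i0) p0).
Local Notation c1 := (at_pt (s i1) p1).

Lemma dcmp_link : dcmp x0 = dcmp x1.
Proof. by rewrite -!ecmp_in -(link_arc0 link) ecmp_arc. Qed.

Lemma x01_neq : x0 != x1.
Proof. by rewrite -tag_eqE /tag_eq /= (negPf (link_neq link)). Qed.

(** External ends take the value at the input end of their arc, so the link is the only source of a
    condition. *)
Lemma dcmp_lift (A : Type) (f : C -> A) : f x0 = f x1 ->
  exists F : cmp S -> A, forall x, F (dcmp x) = f x.
Proof.
move=> f01.
pose fi (e : endpt Bin Bout) : A := match e with
  | existT (Some i) p => f (@pt_cmp _ _ s i p) | existT None _ => f x0 end.
pose fe e := if is_ext e then fi (arc D e) else fi e.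
have FE := @glue_cmp_inv _ _ _ D s A fe f.
exists (fun z => match val z with inl e => fe e | inr c => f c end) => x.
apply: FE => // e; rewrite /fe arcK.
case ee: (is_ext e); first by rewrite (negPf (arc_ext D ee)).
case: ifPn => // ea; have [_ _ h] := link.
have [||e_|e_] := h e; rewrite ?ee // e_.
  by rewrite (link_arc0 link).
by rewrite (link_arc1 link).
Qed.

Lemma dcmp_pinch : pinch dcmp x0 x1.
Proof.
split; [exact: dcmp_surj | exact: x01_neq | exact: dcmp_link | move=> x y].
(* The map that moves only [x1], to [x0], descends to the glue and therefore separates all other
   components. *)
have [|F FE] := @dcmp_lift _ (fun x => if x == x1 then x0 else x).
  by rewrite eqxx (negPf x01_neq).
move/(congr1 F); rewrite !FE !inE.
do 2 case: eqP => [->|_]; rewrite ?eqxx ?orbT; try by move=> ->; rewrite ?eqxx; (left + right).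
by right.
Qed.

Lemma link_tail : is_tail p1 = ~~ is_tail p0.
Proof.
have := arc_oriented D (in_pt Bout p0); rewrite (link_arc0 link) /arc_source /=.
by move/negb_inj.
Qed.

Lemma dreg_surj y : exists r, dreg r = y.
Proof.
have [[g|r] <-] := qpi_surj y; last by exists r.
have [i [j e]] := region_in link (rpi g).
exists (tagr i (at_gap (s i) j)); rewrite -greg_in.
exact: greg_region.
Qed.

Lemma dreg_lift (A : Type) (f : R -> A) :
    f (tagr i0 (at_gap (s i0) (before p0))) = f (tagr i1 (at_gap (s i1) (after p1))) ->
    f (tagr i0 (at_gap (s i0) (after p0))) = f (tagr i1 (at_gap (s i1) (before p1))) ->
  exists F : reg S -> A, forall y, F (dreg y) = f y.
Proof.
move=> fl fr.
have [//|//|//|G GE] := @region_lift _ _ _ _ _ _ _ link A (fun i j => f (tagr i (at_gap (s i) j))).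
  by move=> i /=; rewrite at_gap_ends.
have FE := @glue_reg_inv _ _ _ D s A (fun g => G (rpi g)) f.
exists (fun z => match val z with inl g => G (rpi g) | inr c => f c end) => y.
apply: FE => [g h gh|i j]; last exact: GE.
by congr G; apply: qpi_eq.
Qed.

Lemma dreg_left : dreg (tagr i0 (at_gap (s i0) (before p0)))
                = dreg (tagr i1 (at_gap (s i1) (after p1))).
Proof.
rewrite -!greg_in; apply: greg_region.
have e := region_arc_in (e := in_pt Bout p1) (D := D); symmetry; apply: etrans (e _ _) _ => //.
  by rewrite (link_arc1 link).
by rewrite (link_arc1 link).
Qed.

Lemma dreg_right : dreg (tagr i0 (at_gap (s i0) (after p0)))
                = dreg (tagr i1 (at_gap (s i1) (before p1))).
Proof.
rewrite -!greg_in; apply: greg_region.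
have e := region_arc_in (e := in_pt Bout p0) (D := D); apply: etrans (e _ _) _ => //.
  by rewrite (link_arc0 link).
by rewrite (link_arc0 link).
Qed.

Lemma dreg_side b : dreg (side b x0) = dreg (side b x1).
Proof.
have := dreg_left; have := dreg_right.
rewrite !at_gap_before // !at_gap_after // link_tail /side /pt_cmp /=.
by case: b; case: is_tail.
Qed.

(** It is unknown which of [i0] and [i1] is [ord0], so the dependent family is obtained by finite
    choice. *)
Lemma link_family (T : 'I_2 -> Type) (u : T i0) (v : T i1) :
  exists f : forall i, T i, f i0 = u /\ f i1 = v.
Proof.
pose P i (x : T i) :=
  (forall e : i0 = i, x = ecast i (T i) e u) /\ (forall e : i1 = i, x = ecast i (T i) e v).
have [i|f fP] := @fin_all_exists _ T P.
  have n01 := link_neq link.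
  case: (link_side link i) => ->.
    exists u; split=> e; first by rewrite eq_axiomK.
    by rewrite e eqxx in n01.
  exists v; split=> e; last by rewrite eq_axiomK.
  by rewrite e eqxx in n01.
exists f; have [[f0 _] [_ f1]] := (fP i0, fP i1).
by rewrite (f0 (erefl _)) (f1 (erefl _)).
Qed.

Lemma link_cmp : exists cc : forall i, cmp (s i),
  [/\ cc i0 = c0, cc i1 = c1 & forall x, (x \in pred2 x0 x1) = (tagged x == cc (tag x))].
Proof.
have [cc [cc0 cc1]] := @link_family (fun i => cmp (s i)) c0 c1.
exists cc; split=> // -[i a]; rewrite !inE /=.
have n01 := link_neq link.
case: (link_side link i) a => -> a; rewrite ?cc0 ?cc1.
  by rewrite (neq_existT _ _ n01) orbF eq_existT.
by rewrite neq_existT 1?eq_sym // eq_existT.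
Qed.

(** The two gaps next to [p] are separated only by the component ending at [p]. *)
Lemma right_gap B (r : smoothing B) (a : cmp r) p : smoothing_ok r ->
    at_pt r p != a ->
  right_of a (at_gap r (before p)) = right_of a (blk (at_pt r p)) /\
  right_of a (at_gap r (after p)) = right_of a (blk (at_pt r p)).
Proof.
move=> okr pa; rewrite at_gap_before // at_gap_after //.
by case: is_tail; rewrite -?(right_cross pa).
Qed.

(* The whole of the other input lies on the same side of [x] as the link.     *)
Lemma glue_potential (x : C) : x != x0 -> x != x1 ->
  exists F : reg S -> bool,
  [/\ forall r : reg (s (tag x)), F (dreg (tagr (tag x) r)) = right_of (tagged x) r,
      forall a i (r : reg (s i)), tagc (tag x) a \in pred2 x0 x1 -> i != tag x ->
        F (dreg (tagr i r)) = right_of (tagged x) (blk a) &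
      forall c, c != dcmp x -> F (blk c) = F (wht c)].
Proof.
have [cc [cc0 cc1 ccP]] := link_cmp.
case: x => i a n0 n1.
have na : cc i != a.
  by have := ccP (tagc i a); rewrite inE (negPf n0) (negPf n1) /= eq_sym => <-.
pose f (y : R) := if i =P tag y is ReflectT e then
    right_of (ecast k (cmp (s k)) e a) (tagged y)
  else right_of a (blk (cc i)).
have fE r : f (tagr i r) = right_of a r.
  by rewrite /f /=; case: eqP => // e; rewrite eq_axiomK.
have fN j (r : reg (s j)) : j != i -> f (tagr j r) = right_of a (blk (cc i)).
  by rewrite /f /= => /eqP ji; case: eqP => // e; case: ji.
have fC y : y != tagc i a -> f (side true y) = f (side false y).
  case: y => j b; rewrite /side /=.
  have [ji|ji _] := eqVneq j i; last by rewrite !fN.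
  case: i / ji a n0 n1 {na} @f fE fN b => a _ _ f fE fN b; rewrite eq_existT => ab.
  by rewrite !fE right_cross.
have fL j (p : point (Bin j)) : pt_cmp s p \in pred2 x0 x1 ->
   f (tagr j (at_gap (s j) (before p))) = right_of a (blk (cc i)) /\
   f (tagr j (at_gap (s j) (after p))) = right_of a (blk (cc i)).
  have [ji|ji _] := eqVneq j i; last by rewrite !fN.
  case: i / ji a n0 n1 na @f fE fN fC => a _ _ na f fE fN fC.
  rewrite ccP /= => /eqP pc; rewrite !fE -pc.
  by apply: right_gap; rewrite // pc.
have [in0 in1] : (x0 \in pred2 x0 x1) /\ (x1 \in pred2 x0 x1).
  by rewrite !inE !eqxx orbT.
have [||F FE] := @dreg_lift _ f.
- by rewrite (fL _ _ in0).1 (fL _ _ in1).2.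
- by rewrite (fL _ _ in0).2 (fL _ _ in1).1.
exists F; split=> [r|b j r bin ji|c].
- by rewrite FE fE.
- by move: bin; rewrite ccP /= => /eqP->; rewrite FE fN.
have [y <-] := dcmp_surj c => yx.
by rewrite blk_dcmp // wht_dcmp // !FE fC //; apply: contraNneq yx => ->.
Qed.

(** As [p0] and [p1] are of opposite kinds, the indicators of the right halves of [c0] and [c1]
    agree on both sides of the link and fit together. *)
Lemma glue_potential_link :
  exists F : reg S -> bool,
  [/\ forall r : reg (s i0), F (dreg (tagr i0 r)) = right_of c0 r,
      forall r : reg (s i1), F (dreg (tagr i1 r)) = right_of c1 r &
      forall c, c != dcmp x0 -> F (blk c) = F (wht c)].
Proof.
have [cc [cc0 cc1 ccP]] := link_cmp.
pose f (y : R) := right_of (cc (tag y)) (tagged y).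
have rb B (r : smoothing B) p : smoothing_ok r ->
    right_of (at_pt r p) (at_gap r (before p)) = ~~ is_tail p /\
    right_of (at_pt r p) (at_gap r (after p)) = is_tail p.
  move=> okr; rewrite at_gap_before // at_gap_after //.
  by case: is_tail; rewrite ?right_wht ?right_blk.
have [||F FE] := @dreg_lift _ f.
- by rewrite /f /= cc0 cc1 (rb _ _ _ (ok i0)).1 (rb _ _ _ (ok i1)).2 link_tail.
- rewrite /f /= cc0 cc1 (rb _ _ _ (ok i0)).2 (rb _ _ _ (ok i1)).1 link_tail.
  by rewrite negbK.
exists F; split=> [r|r|c]; first by rewrite FE /f /= cc0.
  by rewrite FE /f /= cc1.
have [[i a] <-] := dcmp_surj c => yx.
rewrite blk_dcmp // wht_dcmp // !FE /f /= right_cross //.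
apply: contraNneq yx => ac; have: tagc i a \in pred2 x0 x1 by rewrite ccP /= ac.
by rewrite !inE => /orP[]/eqP->; rewrite ?dcmp_link.
Qed.

(** All arcs but the link match inner ends with external ones, and both ends of the link lie on the
    linked component. *)
Lemma card_in_ext z :
  (#|[set e | ~~ is_ext e & ecmp e == z]|
   = #|[set e | is_ext e & ecmp e == z]| + 2 * (z == dcmp x0))%N.
Proof.
rewrite -(cardsID [set e | is_ext (arc D e)]); congr addn.
  rewrite -(card_imset [set e | is_ext e & ecmp e == z] (inv_inj (arcK D))).
  apply: eq_card => e; rewrite !inE; apply/andP/imsetP => [[/andP[ne ez] ee]|[e']].
    by exists (arc D e); rewrite ?arcK // inE ee ecmp_arc.
  rewrite inE => /andP[ee ez] ->.
  by rewrite arcK ecmp_arc ez ee (arc_ext D ee).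
have -> : [set e | ~~ is_ext e & ecmp e == z] :\: [set e | is_ext (arc D e)]
   = [set e in [set in_pt Bout p0; in_pt Bout p1] | z == dcmp x0].
  apply/setP => e; rewrite !inE; apply/andP/andP => [[na /andP[ne /eqP<-]]|[]].
    have [_ _ h] := link; case: (h e ne na) => ->; rewrite eqxx ?orbT ecmp_in //.
    by rewrite dcmp_link.
  move=> ein /eqP->; have ez : ecmp e = dcmp x0.
    by case/orP: ein => /eqP->; rewrite ecmp_in // dcmp_link.
  by case/orP: (ein) => /eqP e_; rewrite ez eqxx e_ ?(link_arc0 link) ?(link_arc1 link).
have [_|_] := eqVneq z (dcmp x0); last by apply: eq_card0 => e; rewrite !inE andbF.
rewrite -[RHS](_ : #|[set in_pt Bout p0; in_pt Bout p1]| = 2)%N.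
  by apply: eq_card => e; rewrite !inE andbT.
by rewrite cards2 (e01_neq link).
Qed.

Lemma link_strand : is_loop c0 = false /\ is_loop c1 = false.
Proof.
by split; apply/negbTE; rewrite negb_forall; apply/existsP;
  [exists p0|exists p1]; rewrite eqxx.
Qed.

(** The linked component has four inner ends, from two strands; the link uses up two of them. *)
Lemma card_pt_dcmp x :
  (#|[set p | at_pt S p == dcmp x]| = 2 * ~~ is_loop (tagged x))%N.
Proof.
have [l0 l1] := link_strand.
have := card_in_ext (dcmp x); rewrite card_ext_ends card_in_ends //.
have [xx|nx] := eqVneq (dcmp x) (dcmp x0).
  rewrite xx (pinch_fiber0 dcmp_pinch (fun x => ~~ is_loop (tagged x) : nat)) /=.
  rewrite l0 l1 => h.
  have -> : is_loop (tagged x) = false; last by lia.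
  have [_ _ _ /(_ _ _ xx)] := dcmp_pinch.
  by case=> [->|/andP[]]//; rewrite !inE => /orP[]/eqP->.
rewrite (pinch_fiber dcmp_pinch (fun x => ~~ is_loop (tagged x) : nat)) //.
by rewrite muln0 addn0.
Qed.

Lemma is_loop_dcmp x : is_loop (dcmp x) = is_loop (tagged x).
Proof.
transitivity (#|[set p | at_pt S p == dcmp x]| == 0)%N.
  rewrite cards_eq0; apply/forallP/eqP => [h|/setP h p].
    by apply/setP => p; rewrite !inE; apply/negbTE.
  by have := h p; rewrite !inE => ->.
by rewrite card_pt_dcmp; case: is_loop.
Qed.

(** Connectedness: an invariant function is constant on the regions of each input, and the inputs
    share a region at the link. Separation: the extended indicators change across a single
    component. *)
Lemma act_smoothing_ok : smoothing_ok S.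
Proof.
have sideE b p : glue_side (D := D) b (at_pt S p) =
    greg D s (if is_tail p == b then dbefore (ext_pt Bin p) else dafter (ext_pt Bin p)).
  exact: (side_glue D ok b).2.
apply: smoothing_okI.
- move=> c; have [x <-] := dcmp_surj c; rewrite blk_dcmp // wht_dcmp //.
  rewrite !(reg_black_glue D ok).1 /side /=.
  by rewrite blk_black // wht_black.
- by move=> j; rewrite [LHS](reg_black_glue D ok).2.
- apply: greg_region; apply: qpi_eq; apply/orP; left; apply/existsP.
  by exists None; rewrite !eqxx.
- move=> p; have := sideE (is_tail p) p; rewrite eqxx.
  by case: is_tail.
- move=> p; have := sideE (~~ is_tail p) p;
  by case: is_tail.
- move=> c; have [x <-] := dcmp_surj c; rewrite card_pt_dcmp is_loop_dcmp.
  by case: is_loop.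
- move=> f fe.
  have fi i (r r' : reg (s i)) : f (dreg (tagr i r)) = f (dreg (tagr i r')).
    apply: (reg_invariant (ok i) (f := fun r => f (dreg (tagr i r)))) => c.
    by have := fe (dcmp (tagc i c)); rewrite blk_dcmp // wht_dcmp.
  have f0 (y : R) : f (dreg y) = f (dreg (tagr i0 (at_gap (s i0) (before p0)))).
    case: y => i r; case: (link_side link i) r => -> r; first exact: fi.
    by rewrite dreg_left; apply: fi.
  move=> r r'; have [y <-] := dreg_surj r; have [y' <-] := dreg_surj r'.
  by rewrite !f0.
move=> c; have [x <-] := dcmp_surj c.
have H x' : x' \in pred2 x0 x1 -> exists2 f : reg S -> bool,
    f (blk (dcmp x')) != f (wht (dcmp x')) &
    forall c', c' != dcmp x' -> f (blk c') = f (wht c').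
  move=> xin; have -> : dcmp x' = dcmp x0.
    by move: xin; rewrite !inE => /orP[]/eqP->; rewrite -?dcmp_link.
  have [F [F0 F1 FC]] := glue_potential_link.
  exists F; rewrite // blk_dcmp // wht_dcmp // /side /pt_cmp /= !F0.
  by rewrite right_blk // right_wht.
have [x_0|n0] := eqVneq x x0; first by apply: H; rewrite x_0 inE eqxx.
have [x_1|n1] := eqVneq x x1; first by apply: H; rewrite x_1 !inE eqxx orbT.
have [F [F0 _ FC]] := glue_potential n0 n1.
exists F; rewrite // blk_dcmp // wht_dcmp // /side /= !F0.
by rewrite right_blk // right_wht.
Qed.

Let okS := act_smoothing_ok.

(** By [right_uniq], the function of [glue_potential] is the indicator of the glued component. *)
Lemma right_dcmp x : x != x0 -> x != x1 ->
  (forall r : reg (s (tag x)),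
     right_of (dcmp x) (dreg (tagr (tag x) r)) = right_of (tagged x) r) /\
  forall a i (r : reg (s i)), tagc (tag x) a \in pred2 x0 x1 -> i != tag x ->
    right_of (dcmp x) (dreg (tagr i r)) = right_of (tagged x) (blk a).
Proof.
move=> n0 n1; have [F [F0 F1 FC]] := glue_potential n0 n1.
have FE : forall r, right_of (dcmp x) r = F r.
  by apply: right_uniq => //; rewrite ?blk_dcmp ?wht_dcmp // /side /= F0
    ?right_blk ?right_wht.
by split=> [r|a i r ain ix]; rewrite FE ?F0 //; apply: F1.
Qed.

Lemma loop_neq (x : C) : is_loop (tagged x) -> x != x0 /\ x != x1.
Proof.
have [l0 l1] := link_strand.
by move=> lx; split; apply: contraTneq lx => ->; rewrite ?l0 ?l1.
Qed.

(** All gaps of its own input lie on the same side of a loop. The other input lies on the side of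
    the link, which is again the side of these gaps. *)
Lemma ccw_dcmp (x : C) : is_loop (tagged x) -> ccw (dcmp x) = ccw (tagged x).
Proof.
move=> lx; have [n0 n1] := loop_neq lx; have [RI RO] := right_dcmp n0 n1.
have [i [j ij]] := region_in link (rpi (ext_gap Bin (@ord0 (2 * half Bout)))).
rewrite ccwE // (_ : at_gap S ord0 = dreg (tagr i (at_gap (s i) j))); last first.
  by rewrite -greg_in; apply: greg_region.
have [ix|ix] := eqVneq i (tag x).
  move: (esym ix) => {}ix; case: i / ix j {ij} => j.
  by rewrite RI loop_right_gap.
have [q qin] : exists q, pt_cmp s (i := tag x) q \in pred2 x0 x1.
  case: (link_side link (tag x)) => ->; [exists p0|exists p1];
  by rewrite !inE eqxx ?orbT.
rewrite (RO _ _ _ qin ix) -(loop_right_gap (ok _) (before q) lx).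
by have [->] := right_gap (ok _) (forallP lx q).
Qed.

(** Strands are counted; the link merges two of them. *)
Lemma half_glue : (half Bout + 1 = half (Bin i0) + half (Bin i1))%N.
Proof.
have := pinch_bign dcmp_pinch (fun z => ~~ is_loop z : nat).
have H B (r : smoothing B) : smoothing_ok r ->
    (\sum_(c : cmp r) ~~ is_loop c = half B)%N.
  move=> okr; rewrite -(card_strands okr) -sum1dep_card [RHS]big_mkcond /=.
  by apply: eq_bigr => c _; case: is_loop.
rewrite (H _ S okS) is_loop_dcmp /= (proj1 link_strand) => <-.
rewrite (eq_bigr (fun x => ~~ is_loop (tagged x) : nat)); last first.
  by move=> x _; rewrite is_loop_dcmp.
by rewrite (sum_sigma predT) /= (big_link link) !H.
Qed.

Lemma right_link i (a : cmp (s i)) (p : point (Bin i)) :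
    pt_cmp s p \in pred2 x0 x1 ->
  right_of (dcmp (tagc i a)) (dreg (side true (pt_cmp s p)))
  = right_of a (blk (at_pt (s i) p)).
Proof.
move=> pin; have [->|ap] := eqVneq a (at_pt (s i) p).
  by rewrite -[tagc i _]/(pt_cmp s p) -blk_dcmp // !right_blk.
have [cc [_ _ ccP]] := link_cmp.
have : tagc i a \notin pred2 x0 x1.
  by move: pin; rewrite !ccP /= => /eqP <-.
rewrite !inE negb_or => /andP[n0 n1].
by rewrite (right_dcmp n0 n1).1.
Qed.

(** [rotE] is applied at the black region of the link. There the linked component counts 0, so the
    numbers of components with the region on their right add up, while the extra one for a black
    region occurs once instead of twice. As [half] also drops by one and loops keep their terms, the
    constants in [rotE] balance. *)
Lemma rot_glue : rot S = rot (s i0) + rot (s i1).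
Proof.
have k0 := half_gt0 p0; have k1 := half_gt0 p1.
rewrite (rotE okS (dreg (side true x0)) (out_half_gt0 link)).
rewrite (rotE (ok i0) (blk c0) k0) (rotE (ok i1) (blk c1) k1).
pose L B (r : smoothing B) (c : cmp r) : rat :=
  if is_loop c then (ccw c)%N%:R - 1 else 0.
have LE B (r : smoothing B) :
    \sum_(c : cmp r | is_loop c) ((ccw c)%N%:R - 1) = \sum_(c : cmp r) L B r c.
  by rewrite big_mkcond.
rewrite (LE _ S) (LE _ (s i0)) (LE _ (s i1)).
have Ld x : L _ _ (dcmp x) = L _ _ (tagged x).
  by rewrite /L is_loop_dcmp; case: ifP => // /ccw_dcmp->.
have := pinch_big dcmp_pinch (L _ S).
rewrite Ld {3}/L /= (proj1 link_strand) addr0 => <-.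
rewrite (sum_sigma predT) /= (big_link link).
have Lsum i : \sum_(a : cmp (s i)) L _ _ (dcmp (tagc i a)) = \sum_(a : cmp (s i)) L _ _ a.
  by apply: eq_bigr => a _; rewrite Ld.
rewrite !Lsum [Algebra.Algebra_add__canonical__Monoid_ComLaw _ _ _]/=.
have bc : (black_count (dreg (side true x0)) + 1
   = black_count (blk c0) + black_count (blk c1))%N.
  rewrite /black_count (reg_black_glue D ok).1 /= !blk_black //.
  have := pinch_bign dcmp_pinch (fun z => right_of z (dreg (side true x0)) : nat).
  have -> : right_of (dcmp x0) (dreg (side true x0)) = false.
    by rewrite -blk_dcmp // right_blk.
  rewrite addn0 => <-.
  rewrite (sum_sigma predT) /= (big_link link).
  rewrite (eq_bigr (fun a => right_of a (blk c0) : nat)); last first.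
    by move=> a _; rewrite right_link // !inE eqxx.
  rewrite [X in (_ + X + _ + _)%N](eq_bigr (fun a => right_of a (blk c1) : nat)).
    by rewrite -!addnA; congr addn; rewrite [RHS]addnCA.
  by move=> a _; rewrite dreg_side right_link // !inE eqxx orbT.
have : (black_count (dreg (side true x0)))%:R + 1
   = (black_count (blk c0))%:R + (black_count (blk c1))%:R :> rat.
  by rewrite natr1 -!natrD -bc addn1.
have : (half Bout)%:R + 1 = (half (Bin i0))%:R + (half (Bin i1))%:R :> rat.
  by rewrite natr1 -!natrD -half_glue addn1.
lra.
Qed.

End GlueLink.

(** * Gluing cobordisms *)

(** [T] is a common set of pieces, from which both surfaces arise by the same identifications. *)
Lemma cob_iso_of_surj B (s t : smoothing B) (C C' : cob s t) (T : finType)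
    (p : T -> surf C) (q : T -> surf C') :
    (forall a, exists u, p u = a) -> (forall b, exists u, q u = b) ->
    (forall u v, p u = p v -> q u = q v) -> (forall u v, q u = q v -> p u = p v) ->
    (forall c, exists2 u, att C c = p u & att C' c = q u) ->
    (forall u, chi (q u) = chi (p u)) -> (forall u, dots (q u) = dots (p u)) ->
  cob_iso C C'.
Proof.
move=> sp sq pq qp Ha Hc Hd.
have [h hbij hE] := surj_bij sp sq (fun u v => conj (pq u v) (qp u v)).
exists h; split=> // [c|z|z].
- by have [u -> ->] := Ha c; rewrite hE.
- by have [u <-] := sp z; rewrite hE.
by have [u <-] := sp z; rewrite hE.
Qed.

Section SurfaceGlue.
Variables (d : nat) (Bin : 'I_d -> btype) (Bout : btype) (D : diagram Bin Bout).
Variables s t : forall i, smoothing (Bin i).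
Variable C : forall i, cob (s i) (t i).
Implicit Types (e : endpt Bin Bout).

Local Notation S := (act_smoothing D s).
Local Notation T := (act_smoothing D t).
Local Notation tagf i z := (existT (fun k => surf (C k)) i z).

Definition dsurf (y : {i : 'I_d & surf (C i)}) : surf (act_cob D C) :=
  glue_surf D (inr y).
Definition esurf e : surf (act_cob D C) := glue_surf D (C := C) (inl e).
Definition pt_surf i (p : point (Bin i)) := tagf i (att (C i) (inl (at_pt (s i) p))).

Lemma esurf_arc e : esurf (arc D e) = esurf e.
Proof. by symmetry; apply: qpi_eq; exact: eqxx. Qed.

Lemma esurf_in i (p : point (Bin i)) : esurf (in_pt Bout p) = dsurf (pt_surf p).
Proof. by apply: qpi_eq; apply/existsP; exists p; rewrite /= !eqxx. Qed.

Lemma dsurf_surj z : exists y, dsurf y = z.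
Proof.
have [[e|y] <-] := qpi_surj z; last by exists y.
have H e' : ~~ is_ext e' -> exists y, dsurf y = esurf e'.
  by case/inptP => i [p ->]; rewrite esurf_in; exists (pt_surf p).
have [/(arc_ext D)/H|/H//] := boolP (is_ext e).
by rewrite esurf_arc.
Qed.

Lemma glue_surf_inv (A : Type) (F : endpt Bin Bout + {i : 'I_d & surf (C i)} -> A) :
    (forall e, F (inl (arc D e)) = F (inl e)) ->
    (forall i (p : point (Bin i)), F (inl (in_pt Bout p)) = F (inr (pt_surf p))) ->
  forall x y, glue_surf D x = glue_surf D y -> F x = F y.
Proof.
move=> fa fp; apply: qpi_inv => -[e|x] [e'|[i y]] //=.
  by move/eqP <-; rewrite fa.
by case/existsP => p /andP[/eqP-> /eqP/= <-]; rewrite fp.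
Qed.

Lemma att_act_inl x :
  att (act_cob D C) (inl (dcmp D x)) = dsurf (tagf (tag x) (att (C (tag x)) (inl (tagged x)))).
Proof.
pose F (y : endpt Bin Bout + {i : 'I_d & cmp (s i)}) := match y with
  | inl e => esurf e
  | inr x => dsurf (tagf (tag x) (att (C (tag x)) (inl (tagged x)))) end.
rewrite -[RHS]/(F (inr x)); have <- : F (val (dcmp D x)) = F (inr x).
  apply: glue_cmp_inv => [e|i p]; first exact: esurf_arc.
  exact: esurf_in.
by move: (dcmp D x) => [[e'|[i a]] r].
Qed.

Lemma att_act_inl_e e : att (act_cob D C) (inl (ecmp D s e)) = esurf e.
Proof.
pose F (y : endpt Bin Bout + {i : 'I_d & cmp (s i)}) := match y with
  | inl e => esurf e
  | inr x => dsurf (tagf (tag x) (att (C (tag x)) (inl (tagged x)))) end.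
rewrite -[RHS]/(F (inl e)); have <- : F (val (ecmp D s e)) = F (inl e).
  apply: glue_cmp_inv => [e'|i p]; first exact: esurf_arc.
  exact: esurf_in.
by move: (ecmp D s e) => [[e'|[i a]] r].
Qed.

Section Ok.
Hypothesis att_ok : forall i (p : point (Bin i)),
  att (C i) (inl (at_pt (s i) p)) = att (C i) (inr (at_pt (t i) p)).

(** [glue_surf_rel] attaches arcs through the source smoothing; the product structure [att_ok] gives
    the same surface at the target. *)
Lemma att_act_inr x :
  att (act_cob D C) (inr (dcmp D x)) = dsurf (tagf (tag x) (att (C (tag x)) (inr (tagged x)))).
Proof.
pose F (y : endpt Bin Bout + {i : 'I_d & cmp (t i)}) := match y with
  | inl e => esurf e
  | inr x => dsurf (tagf (tag x) (att (C (tag x)) (inr (tagged x)))) end.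
rewrite -[RHS]/(F (inr x)); have <- : F (val (dcmp D x)) = F (inr x).
  apply: glue_cmp_inv => [e|i p]; first exact: esurf_arc.
  by rewrite /F esurf_in /pt_surf /= att_ok.
by move: (dcmp D x) => [[e'|[i a]] r].
Qed.

Lemma att_act_inr_e e : att (act_cob D C) (inr (ecmp D t e)) = esurf e.
Proof.
pose F (y : endpt Bin Bout + {i : 'I_d & cmp (t i)}) := match y with
  | inl e => esurf e
  | inr x => dsurf (tagf (tag x) (att (C (tag x)) (inr (tagged x)))) end.
rewrite -[RHS]/(F (inl e)); have <- : F (val (ecmp D t e)) = F (inl e).
  apply: glue_cmp_inv => [e'|i p]; first exact: esurf_arc.
  by rewrite /F esurf_in /pt_surf /= att_ok.
by move: (ecmp D t e) => [[e'|[i a]] r].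
Qed.

End Ok.

(* Each arc, counted at its source, adds a disc; each end on an input circle  *)
(* is an interval of gluing.                                                  *)
Definition end_chi e : int := (arc_source e)%:Z - (~~ is_ext e)%:Z.

Lemma sum_end_chi (P : pred (endpt Bin Bout)) :
  \sum_(e | P e) end_chi e
  = #|[set e | arc_source e & P e]|%:Z - #|[set e | ~~ is_ext e & P e]|%:Z.
Proof.
have H (a : pred (endpt Bin Bout)) :
    \sum_(e | P e) (a e : nat)%:Z = #|[set e | a e & P e]|%:Z.
  rewrite -sum1dep_card (big_morph Posz PoszD (erefl _)).
  rewrite [RHS]big_mkcond [LHS]big_mkcond; apply: eq_bigr => e _.
  by case: (a e); case: (P e).
by rewrite /end_chi big_split /= sumrN !H.
Qed.

Lemma chi_act z : chi (c := act_cob D C) z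
  = \sum_(y | dsurf y == z) chi (tagged y) + \sum_(e | esurf e == z) end_chi e.
Proof. by rewrite sum_end_chi sum_sigma addrA. Qed.

Lemma dots_act z : dots (c := act_cob D C) z
  = (\sum_(y | dsurf y == z) dots (tagged y))%N.
Proof. by rewrite sum_sigma. Qed.

End SurfaceGlue.

(* The surfaces of [C'] are quotients of those of [C] by the maps [f i]; [w]  *)
(* and [wd] distribute Euler characteristics and dots over [C].               *)
Section SurfaceQuotient.
Variables (d : nat) (Bin : 'I_d -> btype) (Bout : btype) (D : diagram Bin Bout).
Variables s t : forall i, smoothing (Bin i).
Variables C C' : forall i, cob (s i) (t i).
Local Notation tagf i z := (existT (fun k => surf (C k)) i z).
Local Notation U := (endpt Bin Bout + {i : 'I_d & surf (C i)})%type.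
Variable f : forall i, surf (C i) -> surf (C' i).
Variables (w : {i : 'I_d & surf (C i)} -> int) (wd : {i : 'I_d & surf (C i)} -> nat).
Hypothesis f_surj : forall i y, exists x, @f i x = y.
Hypothesis f_att : forall i c, att (C' i) c = f (att (C i) c).
Hypothesis f_chi : forall i y, chi y = \sum_(x | @f i x == y) w (tagf i x).
Hypothesis f_dots : forall i y, dots y = (\sum_(x | @f i x == y) wd (tagf i x))%N.

Definition quot_surf (u : U) : surf (act_cob D C') :=
  match u with
  | inl e => esurf D C' e
  | inr y => dsurf D (existT (fun k => surf (C' k)) (tag y) (f (tagged y)))
  end.

Lemma quot_surf_surj z : exists u, quot_surf u = z.
Proof.
have [[i y] <-] := dsurf_surj z; have [x <-] := f_surj y.
by exists (inr (tagf i x)).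
Qed.

Lemma quot_surf_arc e : quot_surf (inl (arc D e)) = quot_surf (inl e).
Proof. exact: esurf_arc. Qed.

Lemma quot_surf_in i (p : point (Bin i)) :
  quot_surf (inl (in_pt Bout p)) = quot_surf (inr (pt_surf C p)).
Proof. by rewrite /= esurf_in /pt_surf f_att. Qed.

Lemma glue_quot_surf u v :
  glue_surf D u = glue_surf D v -> quot_surf u = quot_surf v.
Proof. by apply: glue_surf_inv; [apply: quot_surf_arc|apply: quot_surf_in]. Qed.

(** The kernel of [quot_surf] is generated by the gluing and the kernels of the maps [f i]. To see
    it, [F] is carried over to [C'] by choosing preimages. *)
Lemma quot_surf_inv (A : Type) (F : U -> A) :
    (forall e, F (inl (arc D e)) = F (inl e)) ->
    (forall i (p : point (Bin i)), F (inl (in_pt Bout p)) = F (inr (pt_surf C p))) ->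
    (forall i (x y : surf (C i)), f x = f y -> F (inr (tagf i x)) = F (inr (tagf i y))) ->
  forall u v, quot_surf u = quot_surf v -> F u = F v.
Proof.
move=> fa fp ff.
have fS i y : exists x, @f i x == y by have [x <-] := @f_surj i y; exists x.
pose F' (u : endpt Bin Bout + {i : 'I_d & surf (C' i)}) := match u with
  | inl e => F (inl e)
  | inr y => F (inr (tagf (tag y) (xchoose (fS _ (tagged y))))) end.
pose M (u : U) : endpt Bin Bout + {i : 'I_d & surf (C' i)} := match u with
  | inl e => inl e
  | inr y => inr (existT (fun k => surf (C' k)) (tag y) (f (tagged y))) end.
have F'E u : F' (M u) = F u.
  case: u => //= -[i x]; apply: ff => /=; exact/eqP/(xchooseP (fS _ _)).
have qE u : quot_surf u = glue_surf D (M u) by case: u.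
move=> u v; rewrite -[F u]F'E -[F v]F'E !qE; apply: glue_surf_inv => [e|i p].
  exact: fa.
rewrite [LHS]fp -(F'E (inr _)); congr (F' (inr _)).
by rewrite /pt_surf f_att.
Qed.

Lemma quot_surf_att c : exists2 u, att (act_cob D C) c = glue_surf D u &
  att (act_cob D C') c = quot_surf u.
Proof.
case: c => c /=; case: (val c) => [e|[i a]].
- by exists (inl e).
- by exists (inr (tagf i (att (C i) (inl a)))); rewrite //= -f_att.
- by exists (inl e).
by exists (inr (tagf i (att (C i) (inr a)))); rewrite //= -f_att.
Qed.

Lemma quot_surf_chi z : chi (c := act_cob D C') z
  = \sum_(y | quot_surf (inr y) == z) w y
    + \sum_(e | quot_surf (inl e) == z) end_chi e.
Proof.
rewrite chi_act; congr (_ + _); rewrite !sum_sigma; apply: eq_bigr => i _ /=.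
rewrite (eq_bigr _ (fun y _ => f_chi y)).
exact: (big_fiber (@f i) (fun y => dsurf D (existT _ i y) == z)).
Qed.

Lemma quot_surf_dots z : dots (c := act_cob D C') z
  = (\sum_(y | quot_surf (inr y) == z) wd y)%N.
Proof.
rewrite dots_act !sum_sigma; apply: eq_bigr => i _ /=.
rewrite (eq_bigr _ (fun y _ => f_dots y)).
exact: (big_fiber (@f i) (fun y => dsurf D (existT _ i y) == z)).
Qed.

End SurfaceQuotient.

(** * Gluing respects isomorphisms and local relations *)

Section ActBijection.
Variables (d : nat) (Bin : 'I_d -> btype) (Bout : btype) (D : diagram Bin Bout).
Variables s t : forall i, smoothing (Bin i).
Variables C C' : forall i, cob (s i) (t i).
Local Notation tagf i z := (existT (fun k => surf (C k)) i z).

(** [m] counts the dots added in passing from [C] to [C']: none for isomorphisms, one on a single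
    component for [act_dot]. *)
Lemma act_bij (m : {i : 'I_d & surf (C i)} -> nat) :
    (forall i, exists f : surf (C i) -> surf (C' i),
      [/\ bijective f, (forall x, att (C' i) x = f (att (C i) x)),
          (forall z, chi (f z) = chi z) &
          (forall z, dots (f z) = dots z + m (tagf i z))%N]) ->
  exists h : surf (act_cob D C) -> surf (act_cob D C'),
    [/\ bijective h, (forall x, att (act_cob D C') x = h (att (act_cob D C) x)),
        (forall z, chi (h z) = chi z) &
        (forall z, dots (h z) = dots z + \sum_(y | dsurf D y == z) m y)%N].
Proof.
move=> /(@fin_all_exists _ (fun i => surf (C i) -> surf (C' i)))[f fP].
pose w (y : {i : 'I_d & surf (C i)}) : int := chi (tagged y).
pose wd (y : {i : 'I_d & surf (C i)}) : nat := (dots (tagged y) + m y)%N.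
have f_inj i : injective (f i) by case: (fP i) => /bij_inj.
have f_surj i y : exists x, f i x = y.
  by have [[g _ gK] _ _ _] := fP i; exists (g y).
have f_att i c : att (C' i) c = f i (att (C i) c) by case: (fP i).
have f_chi i y : chi y = \sum_(x | f i x == y) w (tagf i x).
  have [x <-] := f_surj i y; rewrite (big_pred1 x) => [|x']; last first.
    by rewrite (inj_eq (f_inj i)).
  by case: (fP i) => _ _ -> _.
have f_dots i y : dots y = (\sum_(x | f i x == y) wd (tagf i x))%N.
  have [x <-] := f_surj i y; rewrite (big_pred1 x) => [|x']; last first.
    by rewrite (inj_eq (f_inj i)).
  by case: (fP i) => _ _ _ ->.
pose q := @quot_surf _ _ _ D _ _ C C' f.
have qg u v : q u = q v <-> glue_surf D u = glue_surf D v.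
  split; last exact: glue_quot_surf.
  apply: quot_surf_inv => // [e|i p|i x y /f_inj-> //].
    exact: (esurf_arc D C).
  exact: (esurf_in D C).
have qgE u v : (q u == q v) = (glue_surf D u == glue_surf D v).
  by apply/eqP/eqP; case: (qg u v).
have [h hbij hE] := surj_bij (@qpi_surj _ _) (quot_surf_surj f_surj) (fun u v => iff_sym (qg u v)).
exists h; split=> // [c|z|z].
- have [u -> ->] := quot_surf_att f_att c; by rewrite hE.
- have [u <-] := qpi_surj z; rewrite hE (quot_surf_chi f_chi) chi_act.
  by congr (_ + _); apply: eq_bigl => y; [apply: (qgE (inr y))|apply: (qgE (inl y))].
have [u <-] := qpi_surj z; rewrite hE (quot_surf_dots f_dots) dots_act.
rewrite -big_split /=.
by apply: eq_bigl => y; apply: (qgE (inr y)).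
Qed.

Lemma act_iso : (forall i, cob_iso (C i) (C' i)) ->
  cob_iso (act_cob D C) (act_cob D C').
Proof.
move=> iC; have [i|h [hb ha hc hd]] := @act_bij (fun=> 0%N).
  have [f [fb fa fc fd]] := iC i; exists f; split=> // z.
  by rewrite fd addn0.
by exists h; split=> // z; rewrite hd big1 ?addn0.
Qed.

End ActBijection.

Lemma cob_iso_refl B (s t : smoothing B) (C : cob s t) : cob_iso C C.
Proof. by exists id; split=> //; exists id. Qed.

Section ActLocal.
Variables (d : nat) (Bin : 'I_d -> btype) (Bout : btype) (D : diagram Bin Bout).
Variables s t : forall i, smoothing (Bin i).
Variables C C' : forall i, cob (s i) (t i).
Variable k : 'I_d.
Hypothesis eqC : forall i, i != k -> C' i = C i.
Local Notation tagf i z := (existT (fun k => surf (C k)) i z).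

Lemma act_dot (x : surf (C k)) : C' k = cob_dot x ->
  cob_iso (act_cob D C') (cob_dot (dsurf D (tagf k x))).
Proof.
move=> eqk.
have [i|h [hb ha hc hd]] := @act_bij _ _ _ D _ _ C C' (fun y => (y == tagf k x)).
  have [ik|ik] := eqVneq i k.
    case: k / ik x eqk => x ->; exists id; split=> // [|z]; first by exists id.
    by rewrite eq_existT.
  rewrite (eqC ik); exists id; split=> // [|z]; first by exists id.
  by rewrite neq_existT // addn0.
have [g hg gh] := hb.
exists g; split=> [|c|z|z]; first by exists h.
- by rewrite ha hg.
- by rewrite -[in RHS](gh z) hc.
rewrite -[in RHS](gh z) hd /=; congr addn.
rewrite big_mkcond (bigD1 (tagf k x)) //= big1 => [|y /negPf->]; last by case: ifP.
by rewrite eqxx addn0 eq_sym; case: eqP.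
Qed.

(** Tubes and gluing both identify components, so the two sides are quotients of the same pieces by
    the same relation. The loss of 2 in Euler characteristic is charged to the piece [X] by the
    weight [w]. *)
Lemma act_tube (x y : surf (C k)) : C' k = cob_tube x y ->
  cob_iso (act_cob D C') (cob_tube (dsurf D (tagf k x)) (dsurf D (tagf k y))).
Proof.
move=> eqk; pose X := tagf k x; pose Y := tagf k y.
pose w (z : {i : 'I_d & surf (C i)}) : int := chi (tagged z) - (if z == X then 2 else 0).
pose wd (z : {i : 'I_d & surf (C i)}) : nat := dots (tagged z).
(* All properties are packed into [P] so that one family can be chosen: the identity off [k], the
   quotient by the tube at [k]. *)
pose P i (f : surf (C i) -> surf (C' i)) := [/\ forall z, exists u, f u = z,
   forall c, att (C' i) c = f (att (C i) c),
   forall z, chi z = \sum_(u | f u == z) w (tagf i u),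
   forall z, dots z = (\sum_(u | f u == z) wd (tagf i u))%N &
   (forall (A : Type) (F : {i : 'I_d & surf (C i)} -> A), F X = F Y ->
      forall u v, f u = f v -> F (tagf i u) = F (tagf i v)) /\
   forall e : k = i, f (ecast i (surf (C i)) e x) = f (ecast i (surf (C i)) e y)].
have [i|f fP] := @fin_all_exists _ (fun i => surf (C i) -> surf (C' i)) P.
  have [ik|ik] := eqVneq k i.
    case: i / ik; rewrite /P; move: (C' k) eqk => Ck ->.
    exists (qpi _); split; first exact: qpi_surj.
    - by [].
    - move=> z; rewrite /= /w /= [RHS]big_split /=; congr (_ + _).
      rewrite sumrN; congr (- _).
      rewrite big_mkcond (bigD1 x) //= big1 ?addr0 ?eqxx //.
      by move=> u ux; rewrite eq_existT (negPf ux) if_same.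
    - by [].
    split=> [A F XY u v|e]; last first.
      by rewrite !eq_axiomK; apply: qpi_eq; rewrite /= !eqxx.
    apply: (qpi_inv (f := fun u => F (tagf k u))) => a b /andP[/eqP-> /eqP->].
    exact: XY.
  have ik' : i != k by rewrite eq_sym.
  rewrite /P; move: (C' i) (eqC ik') => Ci ->.
  exists id; split=> //.
  - by move=> z; exists z.
  - by move=> z; rewrite (big_pred1 z) // /w neq_existT ?subr0.
  - by move=> z; rewrite (big_pred1 z).
  split=> [A F _ u v ->//|e]; by rewrite e eqxx in ik.
have f_surj i z : exists u, f i u = z by case: (fP i).
have f_att i c : att (C' i) c = f i (att (C i) c) by case: (fP i).
have f_chi i z : chi z = \sum_(u | f i u == z) w (tagf i u) by case: (fP i).
have f_dots i z : dots z = (\sum_(u | f i u == z) wd (tagf i u))%N by case: (fP i).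
have f_ker i (A : Type) (F : {i : 'I_d & surf (C i)} -> A) : F X = F Y ->
      forall u v, f i u = f i v -> F (tagf i u) = F (tagf i v).
  by case: (fP i) => _ _ _ _ [h _]; apply: h.
have f_xy : f k x = f k y.
  by case: (fP k) => _ _ _ _ [_ /(_ (erefl k))].
pose q := @quot_surf _ _ _ D _ _ C C' f.
pose e0 := [rel a b : surf (act_cob D C) | (a == dsurf D X) && (b == dsurf D Y)].
pose p u : surf (cob_tube (dsurf D X) (dsurf D Y)) := qpi e0 (glue_surf D u).
have pXY : p (inr X) = p (inr Y) by apply: qpi_eq; rewrite /= !eqxx.
have pq u v : p u = p v -> q u = q v.
  have qv u' : q (val (glue_surf D u')) = q u'.
    by apply: glue_quot_surf => //; apply: qpi_val.
  rewrite -[q u]qv -[q v]qv; apply: (qpi_inv (f := fun z => q (val z))).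
  move=> a b /andP[/eqP-> /eqP->]; rewrite !qv /=; congr (dsurf D _).
  by rewrite f_xy.
have qp u v : q u = q v -> p u = p v.
  apply: quot_surf_inv => // [e|i a|i a b].
  - by congr (qpi _ _); apply: (esurf_arc D C).
  - by congr (qpi _ _); apply: (esurf_in D C).
  exact: (f_ker i _ (fun z => p (inr z))).
have cE z : chi (c := cob_tube (dsurf D X) (dsurf D Y)) z
    = \sum_(y | p (inr y) == z) chi (tagged y)
      + \sum_(e | p (inl e) == z) end_chi e - (if p (inr X) == z then 2 else 0).
  rewrite [LHS]/= (eq_bigr _ (fun z _ => chi_act z)) big_split.
  congr (_ + _ - _); first exact: (big_fiber _ (fun a => qpi e0 a == z)).
  exact: (big_fiber _ (fun a => qpi e0 a == z)).
have dE z : dots (c := cob_tube (dsurf D X) (dsurf D Y)) z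
    = (\sum_(y | p (inr y) == z) dots (tagged y))%N.
  rewrite [LHS]/= (eq_bigr _ (fun z _ => dots_act z)).
  exact: (big_fiber _ (fun a => qpi e0 a == z)).
apply: (cob_iso_of_surj (p := q) (q := p)) => //.
- exact: quot_surf_surj.
- by move=> z; have [a <-] := qpi_surj z; have [u <-] := qpi_surj a; exists u.
- move=> c; have [u e1 e2] := quot_surf_att f_att c; exists u => //.
  by rewrite /p -e1.
- move=> u; symmetry; rewrite (quot_surf_chi f_chi) cE.
  have eqpq v : (p v == p u) = (q v == q u) by apply/eqP/eqP; [apply: pq|apply: qp].
  rewrite [RHS]addrAC (eq_bigl (fun z => p (inr z) == p u)); last first.
    by move=> z; rewrite eqpq.
  congr (_ + _); last by apply: eq_bigl => e; rewrite eqpq.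
  rewrite [LHS]big_split /=; congr (_ + _).
  rewrite sumrN; congr (- _).
  rewrite [LHS]big_mkcond (bigD1 X) //= big1 ?addr0 ?eqxx //.
  by move=> z /negPf->; rewrite if_same.
move=> u; symmetry; rewrite (quot_surf_dots f_dots) dE.
by apply: eq_bigl => z; apply/eqP/eqP; [apply: (qp (inr z))|apply: (pq (inr z))].
Qed.

End ActLocal.

Section ActSphere.
Variables (d : nat) (Bin : 'I_d -> btype) (Bout : btype) (D : diagram Bin Bout).
Variables s t : forall i, smoothing (Bin i).
Variables C C' : forall i, cob (s i) (t i).
Variables (k : 'I_d) (n : nat).
Hypothesis eqC : forall i, i != k -> C' i = C i.
Hypothesis eqk : C' k = cob_sphere (C k) n.
Local Notation tagf i z := (existT (fun k => surf (C k)) i z).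
Local Notation tagf' i z := (existT (fun k => surf (C' k)) i z).
Local Notation U := (endpt Bin Bout + {i : 'I_d & surf (C i)})%type.

Lemma sphere_family : exists (f : forall i, surf (C i) -> surf (C' i)) (star : surf (C' k)),
  [/\ forall i, injective (f i), forall x, f k x != star,
      forall y, (forall x, f (tag y) x != tagged y) -> y = tagf' k star,
      forall i c, att (C' i) c = f i (att (C i) c) &
      [/\ forall i x, chi (f i x) = chi x, forall i x, dots (f i x) = dots x,
          chi star = 2 & dots star = n]].
Proof.
pose P i (f : surf (C i) -> surf (C' i)) := [/\ injective f,
   i != k -> forall y, exists x, f x = y,
   forall c, att (C' i) c = f (att (C i) c),
   (forall x, chi (f x) = chi x) /\ (forall x, dots (f x) = dots x) &
   i = k -> exists star, [/\ forall x, f x != star,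
     forall y, (forall x, f x != y) -> y = star, chi star = 2 & dots star = n]].
have [i|f fP] := @fin_all_exists _ (fun i => surf (C i) -> surf (C' i)) P.
  have [ik|ik] := eqVneq k i.
    case: i / ik; rewrite /P; move: (C' k) eqk => Ck ->.
    exists Some; split=> //; [by move=> x y [->]|by rewrite eqxx|].
    move=> _; exists None; split=> // -[y|//] /(_ y).
    by rewrite eqxx.
  have ik' : i != k by rewrite eq_sym.
  rewrite /P; move: (C' i) (eqC ik') => Ci ->.
  exists id; split=> // [_ y|e]; first by exists y.
  by rewrite e eqxx in ik.
have [_ _ _ _ /(_ erefl)[star [s1 s2 s3 s4]]] := fP k.
exists f, star; split=> //.
- by move=> i; case: (fP i).
- move=> [i y] /= ny; have [ik|ik] := eqVneq k i.
    by case: i / ik y ny => y /s2->.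
  have [_ h _ _ _] := fP i.
  have [x xy] : exists x, f i x = y by apply: h; rewrite eq_sym.
  by have := ny x; rewrite xy eqxx.
- by move=> i; case: (fP i).
by split=> // i; case: (fP i) => _ _ _ [].
Qed.

(** The sphere meets no strand, so gluing leaves it alone; it is the piece [None] on both sides. *)
Lemma act_sphere : cob_iso (act_cob D C') (cob_sphere (act_cob D C) n).
Proof.
have [f [star [f_inj f_star f_cov f_att [f_chi f_dots s_chi s_dots]]]] := sphere_family.
pose fs (y : {i : 'I_d & surf (C i)}) := tagf' (tag y) (f _ (tagged y)).
pose p (o : option U) : surf (act_cob D C') := match o with
  | Some (inl e) => esurf D C' e
  | Some (inr y) => dsurf D (fs y)
  | None => dsurf D (tagf' k star) end.
pose q (o : option U) : surf (cob_sphere (act_cob D C) n) :=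
  omap (fun u => glue_surf D u) o.
have fs_star y : fs y != tagf' k star.
  case: y => i x; rewrite /fs /=; have [ik|ik] := eqVneq i k; last by rewrite neq_existT.
  by case: k / ik star f_star {p s_chi s_dots f_cov} => star f_star; rewrite eq_existT.
have fs_inj : injective fs.
  move=> [i x] [j y] /eqP; rewrite -tag_eqE /tag_eq /= => /andP[/eqP ij].
  by case: j / ij y => y; rewrite tagged_asE => /eqP/f_inj->.
have sum_fs (R : nmodType) (F : {i : 'I_d & surf (C' i)} -> R)
    (Q : pred {i : 'I_d & surf (C' i)}) :
    \sum_(y | Q y) F y = \sum_(x | Q (fs x)) F (fs x)
      + (if Q (tagf' k star) then F (tagf' k star) else 0).
  rewrite (bigID (pred1 (tagf' k star))) [LHS]addrC /=; congr (_ + _).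
    transitivity (\sum_(y in fs @: predT | Q y) F y); last first.
      by rewrite big_imset_cond // => x y _ _; apply: fs_inj.
    apply: eq_bigl => y; rewrite andbC; congr (_ && _).
    apply/idP/imsetP => [ny|[x _ ->]]; last exact: fs_star.
    have /existsP[x /eqP xy] : [exists x, f (tag y) x == tagged y].
      apply: contraR ny => /existsPn ny; apply/eqP/f_cov => x; exact: ny.
    by exists (tagf (tag y) x) => //; rewrite /fs /= xy; case: (y).
  case: ifP => Qs; last first.
    by rewrite big_pred0 // => y; case: eqP => [->|]; rewrite ?Qs ?andbF.
  by rewrite (big_pred1 (tagf' k star)) // => y /=; case: eqP => [->|]; rewrite ?Qs ?andbF.
have pt_fs i (p0 : point (Bin i)) : pt_surf C' p0 = fs (pt_surf C p0).
  by rewrite /pt_surf /fs /= f_att.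
have qp u v : q u = q v -> p u = p v.
  case: u v => [u|] [v|] // /Some_inj uv.
  have p1 e : p (Some (inl (arc D e))) = p (Some (inl e)) by apply: esurf_arc.
  have p2 i (p0 : point (Bin i)) :
      p (Some (inl (in_pt Bout p0))) = p (Some (inr (pt_surf C p0))).
    by rewrite /p esurf_in pt_fs.
  exact: (glue_surf_inv (F := fun u => p (Some u)) p1 p2 uv).
have pq u v : p u = p v -> q u = q v.
  pose F (u : endpt Bin Bout + {i : 'I_d & surf (C' i)}) : surf (cob_sphere (act_cob D C) n) :=
    match u with
    | inl e => Some (esurf D C e)
    | inr y => if [pick x | f (tag y) x == tagged y] is Some x
               then Some (dsurf D (tagf (tag y) x)) else None end.
  pose M o : endpt Bin Bout + {i : 'I_d & surf (C' i)} := match o with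
    | Some (inl e) => inl e
    | Some (inr y) => inr (fs y)
    | None => inr (tagf' k star) end.
  have Ffs y : F (inr (fs y)) = Some (dsurf D y).
    rewrite /F /=; case: pickP => [x /eqP/f_inj->|/(_ (tagged y))].
      by case: (y).
    by rewrite eqxx.
  have FM o : F (M o) = q o.
    case: o => [[e|y]|] //; first exact: Ffs.
    by rewrite /F /=; case: pickP => // x /eqP xs; have := f_star x; rewrite xs eqxx.
  have pM o : p o = glue_surf D (M o) by case: o => [[]|].
  rewrite !pM -[q u]FM -[q v]FM; apply: glue_surf_inv => [e|i p0].
    by rewrite /F esurf_arc.
  by rewrite pt_fs Ffs /= esurf_in.
apply: (cob_iso_of_surj (p := p) (q := q)) => //.
- move=> z; have [y <-] := dsurf_surj z.
  have [->|ny] := eqVneq y (tagf' k star); first by exists None.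
  have /existsP[x /eqP xy] : [exists x, f (tag y) x == tagged y].
    apply: contraR ny => /existsPn ny; apply/eqP/f_cov => x; exact: ny.
  exists (Some (inr (tagf (tag y) x))); rewrite /= /fs /= xy.
  by case: (y).
- move=> [z|]; last by exists None.
  by have [u <-] := qpi_surj z; exists (Some u).
- case=> c /=; case: (val c) => [e|[i a]].
  + by exists (Some (inl e)).
  + by exists (Some (inr (tagf i (att (C i) (inl a))))); rewrite //= /fs /= f_att.
  + by exists (Some (inl e)).
  by exists (Some (inr (tagf i (att (C i) (inr a))))); rewrite //= /fs /= f_att.
- move=> u; symmetry; rewrite chi_act sum_fs.
  have pqE v : (p v == p u) = (q v == q u) by apply/eqP/eqP; [apply: pq|apply: qp].
  rewrite (eq_bigl (fun x => q (Some (inr x)) == q u)); last first.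
    by move=> x; rewrite -pqE.
  rewrite [X in _ + X = _](eq_bigl (fun x => q (Some (inl x)) == q u)); last first.
    by move=> x; rewrite -pqE.
  rewrite -[dsurf D (tagf' k star)]/(p None) pqE s_chi.
  rewrite (eq_bigr (fun x => chi (tagged x))); last by move=> x _; rewrite /= f_chi.
  case: u {pqE} => [u|]; first by rewrite addr0; apply/esym/chi_act.
  by rewrite !big_pred0 // add0r addr0.
move=> u; symmetry; rewrite dots_act sum_fs.
have pqE v : (p v == p u) = (q v == q u) by apply/eqP/eqP; [apply: pq|apply: qp].
rewrite (eq_bigl (fun x => q (Some (inr x)) == q u)); last first.
  by move=> x; rewrite -pqE.
rewrite -[dsurf D (tagf' k star)]/(p None) pqE s_dots.
rewrite (eq_bigr (fun x => dots (tagged x))); last by move=> x _; rewrite /= f_dots.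
case: u {pqE} => [u|]; first by rewrite addr0; apply/esym/dots_act.
by rewrite !big_pred0 // add0r.
Qed.

End ActSphere.

(** * Gluing respects stacking *)

Lemma cob_comp_glue B (s t u : smoothing B) (C : cob s t) (C' : cob t u) c :
  qpi (@cob_comp_rel B s t u C C') (inl (att C (inr c)))
  = qpi (@cob_comp_rel B s t u C C') (inr (att C' (inl c))).
Proof. by apply: qpi_eq; apply/existsP; exists c; rewrite /= !eqxx. Qed.

Lemma chi_comp B (s t u : smoothing B) (C : cob s t) (C' : cob t u) z :
  chi (c := cob_comp C C') z
  = \sum_(y | qpi (@cob_comp_rel B s t u C C') (inl y) == z) chi y
  + \sum_(y | qpi (@cob_comp_rel B s t u C C') (inr y) == z) chi y
  - \sum_(c | qpi (@cob_comp_rel B s t u C C') (inl (att C (inr c))) == z)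
      (~~ is_loop c)%:Z.
Proof.
congr (_ - _); rewrite -sum1dep_card (big_morph Posz PoszD (erefl _)).
rewrite [LHS]big_mkcond [RHS]big_mkcond; apply: eq_bigr => c _.
by case: is_loop; case: eqP.
Qed.

Section ActComp.
Variables (d : nat) (Bin : 'I_d -> btype) (Bout : btype) (D : diagram Bin Bout).
Variables s t r : forall i, smoothing (Bin i).
Variables (C : forall i, cob (s i) (t i)) (C' : forall i, cob (t i) (r i)).
Hypothesis okT : smoothing_ok (act_smoothing D t).
Hypothesis okt : forall i, smoothing_ok (t i).
Hypothesis att_ok : forall i (p : point (Bin i)),
  att (C i) (inl (at_pt (s i) p)) = att (C i) (inr (at_pt (t i) p)).

Let CC i := cob_comp (C i) (C' i).
Local Notation tagf i z := (existT (fun k => surf (C k)) i z).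
Local Notation tagf' i z := (existT (fun k => surf (C' k)) i z).
Local Notation tagF i z := (existT (fun k => surf (CC k)) i z).
Local Notation U := (endpt Bin Bout + {i : 'I_d & surf (C i)})%type.
Local Notation U' := (endpt Bin Bout + {i : 'I_d & surf (C' i)})%type.
Local Notation pic i := (qpi (@cob_comp_rel _ _ _ _ (C i) (C' i))).
Local Notation pia := (qpi (@cob_comp_rel _ _ _ _ (act_cob D C) (act_cob D C'))).

(** The pieces of both layers, with one copy of each arc end per layer, map by [p] to the surface
    stacked before gluing and by [q] to the one glued before stacking. *)
Let p (x : U + U') : surf (act_cob D CC) :=
  match x with
  | inl (inl e) | inr (inl e) => esurf D CC e
  | inl (inr y) => dsurf D (tagF (tag y) (pic (tag y) (inl (tagged y))))
  | inr (inr y) => dsurf D (tagF (tag y) (pic (tag y) (inr (tagged y))))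
  end.

Let q (x : U + U') : surf (cob_comp (act_cob D C) (act_cob D C')) :=
  pia (match x with inl a => inl (glue_surf D a) | inr a => inr (glue_surf D a) end).

Let q_dcmp (x : {i : 'I_d & cmp (t i)}) : q (inl (inr (tagf (tag x) (att (C (tag x)) (inr (tagged x))))))
             = q (inr (inr (tagf' (tag x) (att (C' (tag x)) (inl (tagged x)))))).
Proof.
have := cob_comp_glue (act_cob D C) (act_cob D C') (dcmp D x).
by rewrite (att_act_inr D att_ok) att_act_inl.
Qed.

Let q_ecmp e : q (inl (inl e)) = q (inr (inl e)).
Proof.
have := cob_comp_glue (act_cob D C) (act_cob D C') (ecmp D t e).
by rewrite (att_act_inr_e D att_ok) att_act_inl_e.
Qed.

Let p_left a b : glue_surf D a = glue_surf D b -> p (inl a) = p (inl b).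
Proof.
apply: (glue_surf_inv (F := fun a => p (inl a))) => [e|i x].
  exact: (esurf_arc D CC).
exact: (esurf_in D CC).
Qed.

Let p_right a b : glue_surf D a = glue_surf D b -> p (inr a) = p (inr b).
Proof.
apply: (glue_surf_inv (F := fun a => p (inr a))) => [e|i x].
  exact: (esurf_arc D CC).
rewrite [LHS](esurf_in D CC); congr (dsurf D (tagF i _)).
by rewrite /= att_ok; apply: cob_comp_glue.
Qed.

Let q_p x y : q x = q y -> p x = p y.
Proof.
pose F (z : surf (act_cob D C) + surf (act_cob D C')) := match z with
  | inl z => p (inl (val z)) | inr z => p (inr (val z)) end.
have F1 a : F (inl (glue_surf D a)) = p (inl a) by apply: p_left; apply: qpi_val.
have F2 a : F (inr (glue_surf D a)) = p (inr a) by apply: p_right; apply: qpi_val.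
have FE w : p w = F (match w with inl a => inl (glue_surf D a) | inr a => inr (glue_surf D a) end).
  by case: w => a; rewrite ?F1 ?F2.
rewrite !FE; apply: qpi_inv => a b /existsP[c /andP[/eqP-> /eqP->]].
have [z <-] := dcmp_surj c; rewrite (att_act_inr D att_ok) att_act_inl F1 F2.
by congr (dsurf D (tagF _ _)); apply: cob_comp_glue.
Qed.

Let p_q x y : p x = p y -> q x = q y.
Proof.
pose F (z : endpt Bin Bout + {i : 'I_d & surf (CC i)}) := match z with
  | inl e => q (inl (inl e))
  | inr (existT i z) => match val z with
     | inl y => q (inl (inr (tagf i y)))
     | inr y => q (inr (inr (tagf' i y))) end end.
have F0 i w : F (inr (tagF i (pic i w))) = match w with
     | inl y => q (inl (inr (tagf i y)))
     | inr y => q (inr (inr (tagf' i y))) end.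
  pose G (w : surf (C i) + surf (C' i)) := match w with
     | inl y => q (inl (inr (tagf i y)))
     | inr y => q (inr (inr (tagf' i y))) end.
  have := @qpi_lift _ (@cob_comp_rel _ _ _ _ (C i) (C' i)) _ G; apply.
  move=> a b /existsP[c /andP[/eqP-> /eqP->]].
  exact: (q_dcmp (existT (fun k => cmp (t k)) i c)).
pose M (w : U + U') : endpt Bin Bout + {i : 'I_d & surf (CC i)} := match w with
  | inl (inl e) | inr (inl e) => inl e
  | inl (inr y) => inr (tagF (tag y) (pic (tag y) (inl (tagged y))))
  | inr (inr y) => inr (tagF (tag y) (pic (tag y) (inr (tagged y))))
  end.
have FM w : F (M w) = q w.
  case: w => [[e|[i z]]|[e|[i z]]]; rewrite /M ?F0 //=.
have pM w : p w = glue_surf D (M w) by case: w => [[]|[]].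
rewrite !pM -[q x]FM -[q y]FM; apply: glue_surf_inv => [e|i z].
  by rewrite /F /q; congr (pia (inl _)); apply: (esurf_arc D C).
rewrite F0 /= /F /q; congr (pia (inl _)); exact: (esurf_in D C).
Qed.

Let cls c := pia (inl (att (act_cob D C) (inr c))).

Let cls_dcmp x : cls (dcmp D x) = q (inl (inr (tagf (tag x) (att (C (tag x)) (inr (tagged x)))))).
Proof. by rewrite /cls (att_act_inr D att_ok). Qed.

Let cls_ecmp e : cls (ecmp D t e) = q (inl (inl e)).
Proof. by rewrite /cls (att_act_inr_e D att_ok). Qed.

(** The two layers contribute the arcs twice. By [glue_curve_chi], the strands of the glued middle
    level amount to those of the inputs plus one copy of the arcs, which cancels. *)
Let chi_q z : chi (c := cob_comp (act_cob D C) (act_cob D C')) z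
  = \sum_(y | q (inl (inr y)) == z) chi (tagged y)
  + \sum_(y | q (inr (inr y)) == z) chi (tagged y)
  + \sum_(e | q (inl (inl e)) == z) end_chi e
  - \sum_(x | cls (dcmp D x) == z) (~~ is_loop (tagged x))%:Z.
Proof.
rewrite chi_comp.
rewrite (eq_bigr _ (fun y _ => chi_act (C := C) y)) big_split.
rewrite (eq_bigr _ (fun y _ => chi_act (C := C') y)) big_split.
have -> : \sum_(c | cls c == z) (~~ is_loop c)%:Z =
    \sum_(x | cls (dcmp D x) == z) (~~ is_loop (tagged x))%:Z
    + \sum_(e | cls (ecmp D t e) == z) end_chi e.
  rewrite -(big_fiber (@dcmp _ _ _ D t) (fun c => cls c == z)).
  rewrite -(big_fiber (@ecmp _ _ _ D t) (fun c => cls c == z)).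
  rewrite -big_split /=; apply: eq_bigr => c _.
  rewrite sum_end_chi addrA; symmetry; exact: glue_curve_chi.
have e1 : \sum_(e | cls (ecmp D t e) == z) end_chi e = \sum_(e | q (inl (inl e)) == z) end_chi e.
  by apply: eq_bigl => e; rewrite cls_ecmp.
have e2 : \sum_(a | pia (inl a) == z) \sum_(e | esurf D C e == a) end_chi e
    = \sum_(e | q (inl (inl e)) == z) end_chi e.
  exact: (big_fiber _ (fun y => pia (inl y) == z)).
have e3 : \sum_(a | pia (inr a) == z) \sum_(e | esurf D C' e == a) end_chi e
    = \sum_(e | q (inl (inl e)) == z) end_chi e.
  rewrite (big_fiber _ (fun y => pia (inr y) == z)).
  by apply: eq_bigl => e; rewrite q_ecmp.
have e4 : \sum_(a | pia (inl a) == z) \sum_(y | dsurf D (C := C) y == a) chi (tagged y)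
    = \sum_(y | q (inl (inr y)) == z) chi (tagged y).
  exact: (big_fiber _ (fun y => pia (inl y) == z)).
have e5 : \sum_(a | pia (inr a) == z) \sum_(y | dsurf D (C := C') y == a) chi (tagged y)
    = \sum_(y | q (inr (inr y)) == z) chi (tagged y).
  exact: (big_fiber _ (fun y => pia (inr y) == z)).
rewrite e1 [X in X + _ + _ - _ = _]/= [X in _ + X - _ = _]/= e2 e3 e4 e5.
by ring.
Qed.

Let chi_p z : chi (c := act_cob D CC) z
  = \sum_(y | p (inl (inr y)) == z) chi (tagged y)
  + \sum_(y | p (inr (inr y)) == z) chi (tagged y)
  + \sum_(e | p (inl (inl e)) == z) end_chi e
  - \sum_(x : {i : 'I_d & cmp (t i)}) (if p (inl (inr (tagf (tag x) (att (C (tag x)) (inr (tagged x)))))) == z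
             then (~~ is_loop (tagged x))%:Z else 0).
Proof.
rewrite chi_act addrAC; congr (_ + _); rewrite !sum_sigma -big_split -sumrB /=.
apply: eq_bigr => i _; rewrite (eq_bigr _ (fun y _ => chi_comp y)) !big_split sumrN /=.
rewrite !(big_fiber _ (fun y => dsurf D (tagF i y) == z)).
by rewrite -big_mkcond.
Qed.

Lemma act_comp :
  cob_iso (act_cob D CC) (cob_comp (act_cob D C) (act_cob D C')).
Proof.
have pqE x y : (p x == p y) = (q x == q y) by apply/eqP/eqP; [apply: p_q|apply: q_p].
apply: (cob_iso_of_surj (p := p) (q := q)) => //.
- move=> z; have [[i y] <-] := dsurf_surj z; have [[w|w] <-] := qpi_surj y.
    by exists (inl (inr (tagf i w))).
  by exists (inr (inr (tagf' i w))).
- move=> z; have [[a|a] <-] := qpi_surj z; have [b <-] := qpi_surj a.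
    by exists (inl b).
  by exists (inr b).
- case=> c /=; case: (val c) => [e|[i a]].
  + by exists (inl (inl e)).
  + by exists (inl (inr (tagf i (att (C i) (inl a))))).
  + by exists (inr (inl e)).
  by exists (inr (inr (tagf' i (att (C' i) (inr a))))).
- move=> x; rewrite chi_p chi_q; congr (_ + _ + _ - _);
    try by apply: eq_bigl => y; rewrite pqE.
  rewrite big_mkcond; apply: eq_bigr => y _; by rewrite cls_dcmp -pqE.
move=> x.
have -> : dots (q x) = (\sum_(y | q (inl (inr y)) == q x) dots (tagged y)
   + \sum_(y | q (inr (inr y)) == q x) dots (tagged y))%N.
  rewrite [LHS]/= (eq_bigr _ (fun y _ => dots_act (C := C) y)).
  rewrite [in X in (_ + X)%N = _](eq_bigr _ (fun y _ => dots_act (C := C') y)).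
  congr (_ + _)%N.
    exact: (big_fiber _ (fun y => pia (inl y) == q x)).
  exact: (big_fiber _ (fun y => pia (inr y) == q x)).
symmetry; rewrite dots_act [X in _ = (X + _)%N](eq_bigl (fun y => p (inl (inr y)) == p x)); last first.
  by move=> y; rewrite pqE.
rewrite [X in _ = (_ + X)%N](eq_bigl (fun y => p (inr (inr y)) == p x)); last first.
  by move=> y; rewrite pqE.
rewrite !sum_sigma -big_split /=; apply: eq_bigr => i _.
rewrite big_split /=; congr (_ + _)%N.
  exact: (big_fiber _ (fun y => dsurf D (tagF i y) == p x)).
exact: (big_fiber _ (fun y => dsurf D (tagF i y) == p x)).
Qed.

End ActComp.

(** * Boundary circles and degrees of glued cobordisms *)

(** The map that moves only [x1], to [x0], is the one whose descent proves that [q] identifies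
    nothing else. *)
Lemma pinchI (X Z : finType) (q : X -> Z) x0 x1 :
    (forall z, exists x, q x = z) -> x0 != x1 -> q x0 = q x1 ->
    (forall f : X -> X, f x0 = f x1 -> exists F : Z -> X, forall x, F (q x) = f x) ->
  pinch q x0 x1.
Proof.
move=> sq n01 q01 H; split=> // x y.
have [|F FE] := H (fun x => if x == x1 then x0 else x).
  by rewrite eqxx (negPf n01).
move/(congr1 F); rewrite !FE !inE.
do 2 case: eqP => [->|_]; rewrite ?eqxx ?orbT; try by move=> ->; rewrite ?eqxx; (left + right).
by right.
Qed.

(** The generating relation of [bd_rel], kept apart so that boundary circles become elements of a
    [quo]. *)
Definition bd_edge B (s t : smoothing B) : rel (cmp s + cmp t) :=
  [rel x y | [exists p, (x == inl (at_pt s p)) && (y == inr (at_pt t p))]].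
Arguments bd_edge {B} s t.

Lemma bd_circlesE B (s t : smoothing B) (C : cob s t) z :
  bd_circles z = (\sum_(k : quo (bd_edge s t)) (att C (val k) == z))%N.
Proof.
transitivity (\sum_(k : quo (bd_edge s t) | att C (val k) == z) 1)%N; last first.
  by rewrite big_mkcond; apply: eq_bigr => k _; case: eqP.
rewrite sum1dep_card -(card_imset _ val_inj); apply: eq_card => x.
rewrite !inE; apply/andP/imsetP => [[rx ax]|[[y ry]]].
  by exists (exist _ x rx); rewrite ?inE.
by rewrite inE /= => ay ->.
Qed.

Lemma bd_edge_att B (s t : smoothing B) (C : cob s t) x :
    (forall p, att C (inl (at_pt s p)) = att C (inr (at_pt t p))) ->
  att C (val (qpi (bd_edge s t) x)) = att C x.
Proof.
move=> h; apply: qpi_lift => a b /existsP[p /andP[/eqP-> /eqP->]]; exact: h.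
Qed.

Lemma cob_ok_att B (s t : smoothing B) (C : cob s t) : cob_ok C ->
  forall p, att C (inl (at_pt s p)) = att C (inr (at_pt t p)).
Proof. by case/andP => /forallP h _ p; apply/eqP. Qed.

(* As strands have two ends, the numbers of points [p] with [f (at_pt s p)]   *)
(* and with [g (at_pt t p)] are even, so they cannot differ by one.           *)
Lemma bd_parity B (s t : smoothing B) (f : cmp s -> bool) (g : cmp t -> bool) p0 :
    smoothing_ok s -> smoothing_ok t ->
    (forall p, p != p0 -> f (at_pt s p) = g (at_pt t p)) ->
  f (at_pt s p0) = g (at_pt t p0).
Proof.
move=> oks okt h.
have ev (r : smoothing B) (u : cmp r -> bool) : smoothing_ok r ->
    ~~ odd (\sum_p u (at_pt r p)).
  move=> okr; have -> : (\sum_p u (at_pt r p) =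
      \sum_(c : cmp r) \sum_(p | at_pt r p == c) u (at_pt r p))%N.
    exact: (esym (big_fiber (at_pt r) predT (fun p => u (at_pt r p) : nat))).
  rewrite (eq_bigr (fun c => 2 * (~~ is_loop c * u c)))%N.
    by rewrite -big_distrr oddM.
  move=> c _; rewrite mulnA -strand_cardE // big_distrl /=.
  by apply: eq_bigr => p /eqP->; rewrite mul1n.
have evf := ev _ f oks; have evg := ev _ g okt.
rewrite (bigD1 p0) //= in evf; rewrite (bigD1 p0) //= in evg.
rewrite (eq_bigr _ (fun p pp0 => congr1 nat_of_bool (h p pp0))) in evf.
move: evf evg; rewrite !oddD; case: (odd (\sum_(_ | _) _)).
  by case: (f _); case: (g _).
by case: (f _); case: (g _).
Qed.

Section OkLink.
Variables (Bin : 'I_2 -> btype) (Bout : btype) (D : diagram Bin Bout).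
Variables (i0 i1 : 'I_2) (p0 : point (Bin i0)) (p1 : point (Bin i1)).
Hypothesis link : one_link D p0 p1.
Variables s t : forall i, smoothing (Bin i).
Hypotheses (oks : forall i, smoothing_ok (s i)) (okt : forall i, smoothing_ok (t i)).
Variable C : forall i, cob (s i) (t i).
Hypothesis okC : forall i, cob_ok (C i).

Local Notation S := (act_smoothing D s).
Local Notation T := (act_smoothing D t).
Local Notation AC := (act_cob D C).
Local Notation y0 := (pt_surf C p0).
Local Notation y1 := (pt_surf C p1).
Local Notation e0 := (in_pt Bout p0).
Local Notation e1 := (in_pt Bout p1).
Local Notation tags i a := (existT (fun k => cmp (s k)) i a).
Local Notation tagt i a := (existT (fun k => cmp (t k)) i a).

Let att_ok i (p : point (Bin i)) :
  att (C i) (inl (at_pt (s i) p)) = att (C i) (inr (at_pt (t i) p)).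
Proof. exact: cob_ok_att. Qed.

Lemma dsurf_pinch : pinch (@dsurf _ _ _ D _ _ C) y0 y1.
Proof.
have n01 := link_neq link.
apply: pinchI; first exact: dsurf_surj.
- by rewrite neq_existT.
- by rewrite -!esurf_in -(link_arc0 link) esurf_arc.
move=> f f01.
pose fi (e : endpt Bin Bout) := match e with
  | existT (Some i) p => f (@pt_surf _ _ _ _ C i p) | existT None _ => f y0 end.
pose fe e := if is_ext e then fi (arc D e) else fi e.
pose F x := match x with inl e => fe e | inr y => f y end.
exists (fun z => F (val z)) => x.
have := @glue_surf_inv _ _ _ D _ _ C _ F _ _ _ _ (qpi_val (dsurf D x)); apply=> //.
move=> e; rewrite /F /fe arcK.
case ee: (is_ext e); first by rewrite (negPf (arc_ext D ee)).
case: ifPn => // ea; have [_ _ h] := link.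
have [||e_|e_] := h e; rewrite ?ee // e_.
  by rewrite (link_arc0 link).
by rewrite (link_arc1 link).
Qed.

(** A boundary arc adds a disc and one interval of gluing, in total 0; the link is glued at both
    ends, in total -1. *)
Lemma sum_end_chi_link (P : pred (endpt Bin Bout)) :
  (forall e, P (arc D e) = P e) -> \sum_(e | P e) end_chi e = - (P e0)%:Z.
Proof.
move=> Pa.
have d : \sum_(e | P e) end_chi e = \sum_(e | P e) end_chi (arc D e).
  rewrite (reindex_inj (inv_inj (arcK D))); apply: eq_bigl => e; exact: Pa.
have n01 : e1 != e0 by rewrite eq_sym (e01_neq link).
have vE e : end_chi e + end_chi (arc D e) = - ((e == e0) || (e == e1))%:Z.
  have -> : end_chi e + end_chi (arc D e) = 1 - (~~ is_ext e)%:Z - (~~ is_ext (arc D e))%:Z.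
    by rewrite /end_chi arc_oriented; case: arc_source; case: is_ext; case: is_ext.
  have [->|ne0] := eqVneq e e0; first by rewrite (link_arc0 link).
  have [->|ne1] := eqVneq e e1; first by rewrite (link_arc1 link).
  case ee: (is_ext e); first by rewrite (arc_ext D ee).
  by rewrite (link_ext_arc link) ?ee.
(* In the doubled sum every end is paired with the other end of its arc. *)
suff : 2 * (\sum_(e | P e) end_chi e) = 2 * (- (P e0)%:Z) by lia.
rewrite mulr2n mulrDl mul1r {2}d -big_split /= (eq_bigr _ (fun e _ => vE e)).
rewrite sumrN big_mkcond (bigD1 e0) //= (bigD1 e1) //= big1 ?eqxx ?orbT.
  by rewrite -(link_arc0 link) Pa; case: (P _).
by move=> e /andP[/negPf-> /negPf->]; rewrite if_same.
Qed.

Lemma chi_act_link z : chi (c := AC) z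
  = \sum_(y | dsurf D y == z) chi (tagged y) - (dsurf D y0 == z)%:Z.
Proof.
rewrite chi_act sum_end_chi_link ?esurf_in // => e.
by rewrite esurf_arc.
Qed.

Let okS := act_smoothing_ok link oks.
Let okT := act_smoothing_ok link okt.

Lemma att_act_ok p : att AC (inl (at_pt S p)) = att AC (inr (at_pt T p)).
Proof.
exact: etrans (att_act_inl_e D C (ext_pt Bin p)) (esym (att_act_inr_e D att_ok _)).
Qed.

Let K := {i : 'I_2 & quo (bd_edge (s i) (t i))}.
Let emb i (x : cmp (s i) + cmp (t i)) : cmp S + cmp T := match x with
  | inl a => inl (dcmp D (tags i a)) | inr a => inr (dcmp D (tagt i a)) end.
Let E i x := qpi (bd_edge S T) (@emb i x).
(** Sends a boundary circle of an input surface to the glued boundary circle that contains its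
    strands. *)
Let theta (k : K) := E (val (tagged k)).

Let at_pt_ext q : exists i (p : point (Bin i)),
  arc D (ext_pt Bin q) = in_pt Bout p /\
  at_pt S q = dcmp D (pt_cmp s p) /\ at_pt T q = dcmp D (pt_cmp t p).
Proof.
have na := @arc_ext _ _ _ D (ext_pt Bin q) isT; have [i [p ip]] := inptP na.
exists i, p; split=> //; rewrite -!ecmp_in -ip.
by rewrite !ecmp_arc.
Qed.

Let E_pt_ext i (p : point (Bin i)) : in_pt Bout p != e0 -> in_pt Bout p != e1 ->
  E (inl (at_pt (s i) p)) = E (inr (at_pt (t i) p)).
Proof.
move=> n0 n1; have ea := link_ext_arc link (e := in_pt Bout p) isT n0 n1.
have [q qE] := extP ea; apply: qpi_eq; apply/existsP; exists q; rewrite /emb.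
rewrite -[existT _ i _]/(pt_cmp s p) -[existT _ i (at_pt (t i) p)]/(pt_cmp t p).
by rewrite -!ecmp_in -!(ecmp_arc D _ (in_pt Bout p)) qE !eqxx.
Qed.

(** The vertical segment over a link end is no longer on the boundary. But at all other points of
    that input the two strands are still joined, so [bd_parity] puts the strands of [s i] and [t i]
    at the link end on one circle as well. *)
Let E_pt i (p : point (Bin i)) : E (inl (at_pt (s i) p)) = E (inr (at_pt (t i) p)).
Proof.
have H j (q : point (Bin j)) :
    (forall p, p != q -> E (inl (at_pt (s j) p)) = E (inr (at_pt (t j) p))) ->
    E (inl (at_pt (s j) q)) = E (inr (at_pt (t j) q)).
  move=> h; pose f (a : cmp (s j)) := E (inl a) == E (inl (at_pt (s j) q)).
  pose g (a : cmp (t j)) := E (inr a) == E (inl (at_pt (s j) q)).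
  have /esym : f (at_pt (s j) q) = g (at_pt (t j) q).
    by apply: bd_parity => // p' /h; rewrite /f /g => ->.
  by rewrite /f eqxx => /eqP.
have inj j (q q' : point (Bin j)) : q != q' -> in_pt Bout q != in_pt Bout q'.
  by rewrite eq_existT.
have n01 := link_neq link.
have [p_0|n0] := eqVneq (in_pt Bout p) e0.
  apply: H => p' pp'; apply: E_pt_ext; first by rewrite -p_0 inj.
  apply/eqP => p_1; move: (congr1 tag p_0) (congr1 tag p_1) => /= [i_0] [i_1].
  by rewrite -i_0 -i_1 eqxx in n01.
have [p_1|n1] := eqVneq (in_pt Bout p) e1; last exact: E_pt_ext.
apply: H => p' pp'; apply: E_pt_ext; last by rewrite -p_1 inj.
apply/eqP => p_0; move: (congr1 tag p_0) (congr1 tag p_1) => /= [i_0] [i_1].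
by rewrite -i_0 -i_1 eqxx in n01.
Qed.

Let thetaE i x : theta (existT _ i (qpi (bd_edge (s i) (t i)) x)) = E x.
Proof.
apply: (qpi_lift (f := fun x => E x)) => a b /existsP[p /andP[/eqP-> /eqP->]].
exact: E_pt.
Qed.

Let k0 : K := existT _ i0 (qpi (bd_edge (s i0) (t i0)) (inl (at_pt (s i0) p0))).
Let k1 : K := existT _ i1 (qpi (bd_edge (s i1) (t i1)) (inl (at_pt (s i1) p1))).

(** As in a boundary connected sum, the circles through the two ends of the link become one. *)
Lemma circle_pinch : pinch theta k0 k1.
Proof.
apply: pinchI.
- move=> z; have [[c|c] <-] := qpi_surj z; have [[i a] <-] := dcmp_surj c.
    by exists (existT _ i (qpi (bd_edge (s i) (t i)) (inl a))); rewrite thetaE.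
  by exists (existT _ i (qpi (bd_edge (s i) (t i)) (inr a))); rewrite thetaE.
- by rewrite neq_existT // (link_neq link).
- by rewrite !thetaE /E /emb; congr (qpi _ (inl _)); apply: dcmp_link.
move=> f f01.
have edge i (p : point (Bin i)) : qpi (bd_edge (s i) (t i)) (inl (at_pt (s i) p))
    = qpi (bd_edge (s i) (t i)) (inr (at_pt (t i) p)).
  by apply: qpi_eq; apply/existsP; exists p; rewrite !eqxx.
have [|Fs FsE] := @dcmp_lift _ _ D _ _ _ _ link s _ (fun x =>
    f (existT _ (tag x) (qpi (bd_edge (s (tag x)) (t (tag x))) (inl (tagged x))))).
  exact: f01.
have [|Ft FtE] := @dcmp_lift _ _ D _ _ _ _ link t _ (fun x =>
    f (existT _ (tag x) (qpi (bd_edge (s (tag x)) (t (tag x))) (inr (tagged x))))).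
  by rewrite /= -!edge.
pose F (x : cmp S + cmp T) := match x with inl c => Fs c | inr c => Ft c end.
exists (fun z => F (val z)) => -[i k].
have [x <-] := qpi_surj k; rewrite thetaE /E.
rewrite (qpi_lift (f := F)); last first.
  move=> a b /existsP[q /andP[/eqP-> /eqP->]].
  have [j [p [_ [-> ->]]]] := at_pt_ext q.
  by rewrite /F FsE FtE /= edge.
by case: x => a; rewrite /F /emb ?FsE ?FtE.
Qed.

Lemma bd_circles_act z :
  ((bd_circles z : nat) + (dsurf D y0 == z) =
   \sum_(y | dsurf D y == z) bd_circles (C := C (tag y)) (tagged y))%N.
Proof.
have attE i x : att AC (@emb i x) = dsurf D (existT (fun k => surf (C k)) i (att (C i) x)).
  case: x => a; first exact: (att_act_inl D C (tags i a)).
  exact: (att_act_inr D att_ok (tagt i a)).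
pose F (k : quo (bd_edge S T)) := att AC (val k).
have FE k : F (theta k) = dsurf D (existT (fun k => surf (C k)) (tag k) (att (C _) (val (tagged k)))).
  by rewrite /F bd_edge_att ?attE //; apply: att_act_ok.
have := pinch_bign circle_pinch (fun k => F k == z : nat).
rewrite -bd_circlesE FE /= bd_edge_att // => <-.
rewrite (sum_sigma predT) (sum_sigma (fun y => dsurf D y == z)).
apply: eq_bigr => i _ /=.
rewrite (eq_bigr (fun y => \sum_(k : quo (bd_edge (s i) (t i))) (att (C i) (val k) == y)))%N.
  rewrite exchange_big /=; apply: eq_bigr => k _.
  rewrite FE /= big_mkcond (bigD1 (att (C i) (val k))) //= big1 ?addn0 ?eqxx.
    by case: eqP.
  by move=> y /negPf ny; rewrite [_ == y]eq_sym ny if_same.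
by move=> y _; rewrite bd_circlesE.
Qed.

(** On the linked component the Euler characteristic and the number of boundary circles are both one
    less than the sums, so the genera add up; other components are unchanged. *)
Lemma act_cob_ok : cob_ok AC.
Proof.
apply/andP; split; first by apply/forallP => p; rewrite att_act_ok.
apply/forallP => z; have := bd_circles_act z; rewrite chi_act_link.
have tg i (y : surf (C i)) : 0 <= 2 - chi y - (bd_circles y)%:Z /\
    (2 %| 2 - chi y - (bd_circles y)%:Z)%Z.
  by case/andP: (okC i) => _ /forallP/(_ y)/andP[].
have [y <-] := dsurf_surj z.
have [yy|ny] := eqVneq (dsurf D y) (dsurf D y0).
  rewrite yy (pinch_fiber0 dsurf_pinch (fun y => chi (tagged y))).
  rewrite (pinch_fiber0 dsurf_pinch (fun y => bd_circles (C := C (tag y)) (tagged y))) /=.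
  have := tg _ (tagged y0); have := tg _ (tagged y1) => /=.
  move: (chi _) (chi _) (bd_circles _) (bd_circles _) (bd_circles _).
  by move=> a b c d e [h1 h2] [h3 h4] h5; apply/andP; split; lia.
rewrite (pinch_fiber dsurf_pinch (fun y => chi (tagged y))) //.
rewrite (pinch_fiber dsurf_pinch (fun y => bd_circles (C := C (tag y)) (tagged y))) //=.
rewrite addn0 subr0 => ->; have [h1 h2] := tg _ (tagged y).
by rewrite h1 h2.
Qed.

(** The loss of one in Euler characteristic is offset by the same loss in [half]. *)
Lemma act_cob_deg : cob_deg AC = cob_deg (C i0) + cob_deg (C i1).
Proof.
rewrite /cob_deg.
have -> : \sum_z chi (c := AC) z = \sum_(z : surf (C i0)) chi z + \sum_(z : surf (C i1)) chi z - 1.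
  rewrite (eq_bigr _ (fun z _ => chi_act_link z)) big_split /= sumrN.
  congr (_ - _); last first.
    rewrite (bigD1 (dsurf D y0)) //= eqxx big1 ?addr0 //.
    by move=> z /negPf nz; rewrite eq_sym nz.
  by rewrite (big_fiber (@dsurf _ _ _ D _ _ C) predT) (sum_sigma predT) (big_link link).
have -> : (\sum_z dots (c := AC) z = \sum_(z : surf (C i0)) dots z + \sum_(z : surf (C i1)) dots z)%N.
  rewrite (eq_bigr _ (fun z _ => dots_act (C := C) z)).
  transitivity (\sum_(y : {i : 'I_2 & surf (C i)}) dots (tagged y))%N.
    exact: (big_fiber (@dsurf _ _ _ D _ _ C) predT).
  by rewrite (sum_sigma predT) (big_link link).
have := half_glue link oks; lia.
Qed.

End OkLink.

(** * Morphism groups and the action on morphisms *)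

Section MorphismGroup.
Local Open Scope quotient_scope.
Variables (B : btype) (s t : smoothing B).

(* Cobordisms up to isomorphism, with components numbered: [mor s t] itself   *)
(* lives in too large a universe to carry an algebraic structure.             *)
Definition cob_code := {n : nat & ({ffun cmp s + cmp t -> 'I_n} *
  {ffun 'I_n -> int} * {ffun 'I_n -> nat})%type}.

Definition encode (C : cob s t) : cob_code :=
  existT (fun n => ({ffun cmp s + cmp t -> 'I_n} *
  {ffun 'I_n -> int} * {ffun 'I_n -> nat})%type) #|surf C|
    ([ffun x => enum_rank (att C x)], [ffun i => chi (enum_val i : surf C)],
     [ffun i => dots (enum_val i : surf C)]).

Definition decode (c : cob_code) : cob s t :=
  @Cob B s t 'I_(tag c) (fun x => (tagged c).1.1 x) (fun i => (tagged c).1.2 i)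
    (fun i => (tagged c).2 i).

Lemma encodeK C : cob_iso C (decode (encode C)).
Proof.
exists (@enum_rank _); split=> [|x|z|z]; rewrite /= ?ffunE ?enum_rankK //.
by exists (@enum_val _ _); [apply: enum_rankK|apply: enum_valK].
Qed.

Definition decodes (f : seq (int * cob_code)) : mor s t :=
  [seq (x.1, decode x.2) | x <- f].
Definition encodes (f : mor s t) : seq (int * cob_code) :=
  [seq (x.1, encode x.2) | x <- f].

Lemma encodesK f : meq (decodes (encodes f)) f.
Proof.
elim: f => [|[a C] f IHf]; first exact: meq_refl.
rewrite /= -cat1s -[X in meq _ X]cat1s; apply: meq_cat => //.
have := meq_scale a (meq_iso (encodeK C)); rewrite /= mulr1.
exact: meq_sym.
Qed.

Definition meq_rel : rel (seq (int * cob_code)) :=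
  fun f g => `[< meq (decodes f) (decodes g) >].

Lemma meq_rel_refl : reflexive meq_rel.
Proof. by move=> f; apply/asboolP; apply: meq_refl. Qed.
Lemma meq_rel_sym : symmetric meq_rel.
Proof. by move=> f g; apply/asboolP/asboolP; apply: meq_sym. Qed.
Lemma meq_rel_trans : transitive meq_rel.
Proof.
by move=> f g h /asboolP gf /asboolP fh; apply/asboolP; apply: meq_trans gf fh.
Qed.

Canonical meq_equiv := EquivRel meq_rel meq_rel_refl meq_rel_sym meq_rel_trans.

Definition hom := {eq_quot meq_equiv}.
HB.instance Definition _ := EqQuotient.on hom.
HB.instance Definition _ := Choice.on hom.

Definition mcl (f : mor s t) : hom := \pi_hom (encodes f).
Definition hom_repr (x : hom) : mor s t := decodes (repr x).

Lemma mclP f g : mcl f = mcl g <-> meq f g.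
Proof.
split=> [/eqmodP/asboolP fg|fg].
  apply: (meq_trans (meq_sym (encodesK f))).
  exact: meq_trans fg (encodesK g).
apply/eqmodP/asboolP; apply: (meq_trans (encodesK f)).
exact: meq_trans fg (meq_sym (encodesK g)).
Qed.

Lemma hom_reprK x : mcl (hom_repr x) = x.
Proof.
rewrite -[RHS]reprK; apply/eqmodP/asboolP; exact: encodesK.
Qed.

Lemma mcl_surj x : exists f, mcl f = x.
Proof. by exists (hom_repr x); apply: hom_reprK. Qed.

Definition hom_add (x y : hom) : hom := mcl (hom_repr x ++ hom_repr y).
Definition hom_opp (x : hom) : hom := mcl (mor_scale (-1) (hom_repr x)).

Lemma repr_mcl f : meq (hom_repr (mcl f)) f.
Proof. by apply/mclP; apply: hom_reprK. Qed.

Lemma hom_addE f g : hom_add (mcl f) (mcl g) = mcl (f ++ g).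
Proof. by apply/mclP; apply: meq_cat; apply: repr_mcl. Qed.

Lemma hom_oppE f : hom_opp (mcl f) = mcl (mor_scale (-1) f).
Proof. by apply/mclP; apply: meq_scale; apply: repr_mcl. Qed.

Lemma hom_addA : associative hom_add.
Proof.
move=> x y z; have [f <-] := mcl_surj x; have [g <-] := mcl_surj y.
by have [h <-] := mcl_surj z; rewrite !hom_addE catA.
Qed.

Lemma hom_addC : commutative hom_add.
Proof.
move=> x y; have [f <-] := mcl_surj x; have [g <-] := mcl_surj y.
by rewrite !hom_addE; apply/mclP; apply: meq_catC.
Qed.

Lemma hom_add0 : left_id (mcl [::]) hom_add.
Proof. by move=> x; have [f <-] := mcl_surj x; rewrite hom_addE. Qed.

Lemma hom_addN : left_inverse (mcl [::]) hom_opp hom_add.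
Proof.
move=> x; have [f <-] := mcl_surj x; rewrite hom_oppE hom_addE; apply/mclP.
elim: f => [|[a C] f IHf]; first exact: meq_refl.
apply: (meq_trans (g := [:: (-1 * a, C); (a, C)] ++ (mor_scale (-1) f ++ f))).
  rewrite /= -cat1s -[X in meq _ X]cat1s; apply: meq_cat; first exact: meq_refl.
  rewrite -[X in _ ++ X]cat1s catA -[X in meq _ X]cat1s catA.
  by apply: meq_cat; [apply: meq_catC|apply: meq_refl].
rewrite -[[::]]cats0; apply: meq_cat IHf.
apply: (meq_trans (meq_add _ _ _)).
by rewrite mulN1r addNr; apply: meq_zero.
Qed.

HB.instance Definition _ := GRing.isZmodule.Build hom hom_addA hom_addC hom_add0 hom_addN.

Lemma mcl_cat f g : mcl (f ++ g) = mcl f + mcl g.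
Proof. by rewrite -hom_addE. Qed.

Lemma mcl0 : mcl [::] = 0. Proof. by []. Qed.

Definition mc (C : cob s t) : hom := mcl [:: (1, C)].

Lemma mcl_scale_nat n f : mcl (mor_scale n%:Z f) = mcl f *+ n.
Proof.
elim: n => [|n IHn].
  rewrite mulr0n; apply/mclP; elim: f => [|[a C] f IHf]; first exact: meq_refl.
  apply: (@meq_cat _ _ _ [:: (0 * a, C)] [::] _ [::]) => //.
  by rewrite mul0r; apply: meq_zero.
rewrite mulrS -IHn -mcl_cat; apply/mclP.
elim: f {IHn} => [|[a C] f IHf]; first exact: meq_refl.
rewrite /= -cat1s -[X in meq _ X]cat1s.
apply: (meq_trans (g := [:: (a, C); (n%:Z * a, C)] ++ (f ++ mor_scale n f))).
  apply: meq_cat => //; apply: meq_sym; apply: (meq_trans (meq_add _ _ _)).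
  by rewrite -{1}[a]mul1r -mulrDl -PoszD add1n; apply: meq_refl.
rewrite -[[:: (a, C); _]]cat1s -catA; apply: meq_cat; first exact: meq_refl.
rewrite catA -[X in meq _ (_ ++ X)]cat1s [X in meq _ X]catA.
by apply: meq_cat; [apply: meq_catC|apply: meq_refl].
Qed.

Lemma mcl_scale a f : mcl (mor_scale a f) = mcl f *~ a.
Proof.
case: a => n; first exact: mcl_scale_nat.
have -> : mor_scale (Negz n) f = mor_scale (-1) (mor_scale n.+1%:Z f).
  by rewrite /mor_scale -map_comp; apply: eq_map => -[b C] /=; rewrite mulN1r NegzE mulNr.
by rewrite NegzE mulrNz -pmulrn -mcl_scale_nat -hom_oppE.
Qed.

Lemma mclE f : mcl f = \sum_(x <- f) mc x.2 *~ x.1.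
Proof.
elim: f => [|[a C] f IHf]; first by rewrite big_nil.
rewrite big_cons -IHf -cat1s mcl_cat -mcl_scale /=.
by rewrite mulr1.
Qed.

Lemma mc_iso C C' : cob_iso C C' -> mc C = mc C'.
Proof. by move=> h; apply/mclP; apply: meq_iso. Qed.

Definition lin (W : zmodType) (phi : cob s t -> W) (f : mor s t) : W :=
  \sum_(x <- f) phi x.2 *~ x.1.

Section Lin.
Variables (W : zmodType) (phi : cob s t -> W).

Lemma lin_cat f g : lin phi (f ++ g) = lin phi f + lin phi g.
Proof. exact: big_cat. Qed.

Lemma lin_scale a f : lin phi (mor_scale a f) = lin phi f *~ a.
Proof.
rewrite /lin big_map mulrz_suml; apply: eq_bigr => -[b C] _ /=.
by rewrite mulrC mulrzA.
Qed.

Lemma lin_big (I : finType) (F : I -> mor s t) :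
  lin phi (\big[cat/[::]]_i F i) = \sum_i lin phi (F i).
Proof. by apply: (big_morph _ lin_cat); apply: big_nil. Qed.

(** Universal property of the morphism groups: the hypotheses cover diffeomorphisms and local
    relations, and the other generators of [meq] hold in any abelian group. *)
Lemma meq_lin :
    (forall C C', cob_iso C C' -> phi C = phi C') ->
    (forall C, cob_ok C -> phi (cob_sphere C 0) = 0) ->
    (forall C, cob_ok C -> phi (cob_sphere C 1) = phi C) ->
    (forall C (z : surf C), cob_ok C -> (2 <= dots z)%N -> phi C = 0) ->
    (forall C (x y : surf C), cob_ok C ->
       phi (cob_tube x y) = phi (cob_dot x) + phi (cob_dot y)) ->
  forall f g, meq f g -> lin phi f = lin phi g.
Proof.
move=> h1 h2 h3 h4 h5 f g; elim=> {f g}.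
- by [].
- by move=> f g _ ->.
- by move=> f g h _ -> _ ->.
- by move=> f f' g g' _ e1 _ e2; rewrite !lin_cat e1 e2.
- by move=> f g; rewrite !lin_cat addrC.
- by move=> a f g _ e; rewrite !lin_scale e.
- by move=> a b C; rewrite /lin !big_cons !big_nil !addr0 mulrzDr.
- by move=> C; rewrite /lin big_seq1 big_nil mulr0z.
- by move=> C C' /h1 e; rewrite /lin !big_seq1 /= e.
- by move=> C /h2 e; rewrite /lin big_seq1 big_nil /= e mul0rz.
- by move=> C /h3 e; rewrite /lin !big_seq1 /= e.
- by move=> C z okC /(h4 _ _ okC) e; rewrite /lin big_seq1 big_nil /= e mul0rz.
by move=> C x y /(h5 _ x y) e; rewrite /lin !big_cons !big_nil /= e !addr0 !mulr1z.
Qed.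

End Lin.

Lemma eq_lin_all (P : pred (cob s t)) (W : zmodType) (phi psi : cob s t -> W) f :
    all (fun x => P x.2) f -> (forall C, P C -> phi C = psi C) ->
  lin phi f = lin psi f.
Proof.
move=> + h; elim: f => [|x f IHf] /=; first by rewrite /lin !big_nil.
by move=> /andP[/h e /IHf]; rewrite /lin !big_cons e => ->.
Qed.

Lemma eq_lin (W : zmodType) (phi psi : cob s t -> W) f :
  phi =1 psi -> lin phi f = lin psi f.
Proof. by move=> h; apply: eq_bigr => x _; rewrite h. Qed.

Lemma linD (W : zmodType) (phi psi : cob s t -> W) f :
  lin (fun C => phi C + psi C) f = lin phi f + lin psi f.
Proof. by rewrite -big_split; apply: eq_bigr => x _; rewrite mulrzDl. Qed.

Lemma linM (W : zmodType) (phi : cob s t -> W) f a :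
  lin (fun C => phi C *~ a) f = lin phi f *~ a.
Proof.
by rewrite /lin mulrz_suml; apply: eq_bigr => x _; rewrite -!mulrzA mulrC.
Qed.

Lemma mcl_lin f : mcl f = lin mc f.
Proof. exact: mclE. Qed.

Lemma mcl_big (I : finType) (F : I -> mor s t) :
  mcl (\big[cat/[::]]_i F i) = \sum_i mcl (F i).
Proof. by rewrite mcl_lin lin_big; apply: eq_bigr => i _; rewrite mcl_lin. Qed.

End MorphismGroup.

Lemma lin_exchange B B' (s t : smoothing B) (s' t' : smoothing B') (W : zmodType)
    (G : cob s t -> cob s' t' -> W) f g :
  lin (fun C => lin (G C) g) f = lin (fun C' => lin (G^~ C') f) g.
Proof.
elim: f => [|x f IHf].
  rewrite /lin big_nil big1 // => y _.
  by rewrite big_nil mul0rz.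
transitivity (lin (G x.2) g *~ x.1 + lin (fun C => lin (G C) g) f).
  by rewrite [LHS]big_cons.
rewrite IHf -linM -linD; apply: eq_lin => C'.
by rewrite [RHS]big_cons.
Qed.

Lemma lin_comp B (s t u : smoothing B) (W : zmodType) (phi : cob s u -> W) f g :
  lin phi (mor_comp f g)
  = lin (fun C : cob s t => lin (fun C' : cob t u => phi (cob_comp C C')) g) f.
Proof.
elim: f => [|x f IHf]; first by rewrite /lin !big_nil.
rewrite -[mor_comp (x :: f) g]/([seq (x.1 * y.1, cob_comp x.2 y.2) | y <- g] ++ mor_comp f g).
rewrite lin_cat IHf [RHS]big_cons; congr (_ + _).
rewrite /lin big_map mulrz_suml; apply: eq_bigr => y _ /=.
by rewrite mulrC mulrzA.
Qed.

(** Each product piece is absorbed by the component of [C] it meets: over a strand, a disc (1) glued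
    along an interval (1); over a loop, an annulus (0) glued along a circle (0). *)
Lemma comp_id_iso B (s t : smoothing B) (C : cob s t) :
  cob_iso (cob_comp C (cob_id t)) C.
Proof.
pose p (u : surf C + surf (cob_id t)) := match u with inl z => z | inr c => att C (inr c) end.
pose q := qpi (@cob_comp_rel _ _ _ _ C (cob_id t)).
have qc c : q (inl (att C (inr c))) = q (inr c).
  exact: (cob_comp_glue C (cob_id t)).
have qE u : q u = q (inl (p u)) by case: u => // c; rewrite /= qc.
have pq a b : q a = q b -> p a = p b.
  by apply: qpi_inv => a' b' /existsP[c /andP[/eqP-> /eqP->]].
have pqE u y : (q (inl y) == q u) = (y == p u).
  by apply/eqP/eqP => [/pq|->]; rewrite -?qE.
apply: (@cob_iso_of_surj _ _ _ (cob_comp C (cob_id t)) C _ q p) => //; first exact: qpi_surj.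
- by move=> z; exists (inl z).
- by move=> u v uv; rewrite qE uv -qE.
- by case=> c; [exists (inl (att C (inl c)))|exists (inr c)].
- move=> u; rewrite chi_comp -addrA.
  have -> : \sum_(y : surf (cob_id t) | q (inr y) == q u) chi y
      = \sum_(c | q (inl (att C (inr c))) == q u) (~~ is_loop c)%:Z.
    apply: eq_big => c; first by rewrite qc.
    by rewrite /=; case: ifP.
  by rewrite subrr addr0 (big_pred1 (p u)) // => y /=; rewrite pqE.
by move=> u; rewrite /= [X in (_ + X)%N]big1 // addn0 (big_pred1 (p u)).
Qed.

Lemma id_comp_iso B (s t : smoothing B) (C : cob s t) :
  cob_iso (cob_comp (cob_id s) C) C.
Proof.
pose p (u : surf (cob_id s) + surf C) := match u with inr z => z | inl c => att C (inl c) end.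
pose q := qpi (@cob_comp_rel _ _ _ _ (cob_id s) C).
have qc c : q (inr (att C (inl c))) = q (inl c).
  exact: (esym (cob_comp_glue (cob_id s) C c)).
have qE u : q u = q (inr (p u)) by case: u => // c; rewrite /= qc.
have pq a b : q a = q b -> p a = p b.
  by apply: qpi_inv => a' b' /existsP[c /andP[/eqP-> /eqP->]].
have pqE u y : (q (inr y) == q u) = (y == p u).
  by apply/eqP/eqP => [/pq|->]; rewrite -?qE.
apply: (@cob_iso_of_surj _ _ _ (cob_comp (cob_id s) C) C _ q p) => //; first exact: qpi_surj.
- by move=> z; exists (inr z).
- by move=> u v uv; rewrite qE uv -qE.
- by case=> c; [exists (inl c)|exists (inr (att C (inr c)))].
- move=> u; rewrite chi_comp addrAC.
  have -> : \sum_(y : surf (cob_id s) | q (inl y) == q u) chi y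
      = \sum_(c | q (inl c) == q u) (~~ is_loop c)%:Z.
    by apply: eq_bigr => c _ /=; case: ifP.
  by rewrite subrr add0r (big_pred1 (p u)) // => y /=; rewrite pqE.
by move=> u; rewrite /= big1 // add0n (big_pred1 (p u)) // => y /=; rewrite pqE.
Qed.

Lemma ord2_absurd (i : 'I_2) : ord0 <> i -> ord_max <> i -> False.
Proof. by move: i; apply: ord2P. Qed.

Definition fam2 (T : 'I_2 -> Type) (u : T ord0) (v : T ord_max) (i : 'I_2) : T i :=
  match ord0 =P i, ord_max =P i with
  | ReflectT e, _ => ecast i (T i) e u
  | _, ReflectT e => ecast i (T i) e v
  | ReflectF n, ReflectF n' => False_rect _ (ord2_absurd n n')
  end.

Lemma fam2_0 T (u : T ord0) (v : T ord_max) : fam2 u v ord0 = u.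
Proof. by rewrite /fam2; case: eqP => // e; rewrite eq_axiomK. Qed.

Lemma fam2_1 T (u : T ord0) (v : T ord_max) : fam2 u v ord_max = v.
Proof.
by rewrite /fam2; case: eqP => // n; case: eqP => // e; rewrite eq_axiomK.
Qed.

Lemma big_I2 (R : Type) (idx : R) (op : Monoid.law idx) (F : 'I_2 -> R) :
  \big[op/idx]_i F i = op (F ord0) (F ord_max).
Proof.
rewrite !big_ord_recl big_ord0 Monoid.mulm1; congr (op _ (F _)).
exact: val_inj.
Qed.

Lemma sum_dffun2 (R : nmodType) (I : 'I_2 -> finType) (G : I ord0 -> I ord_max -> R) :
  \sum_(y : {dffun forall i, I i}) G (y ord0) (y ord_max) = \sum_a \sum_b G a b.
Proof.
rewrite pair_bigA /=.
pose h (ab : I ord0 * I ord_max) : {dffun forall i, I i} := [ffun i => fam2 ab.1 ab.2 i].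
rewrite (reindex h) /=; last first.
  exists (fun y : {dffun forall i, I i} => (y ord0, y ord_max)) => [[a b] _|y _].
    by rewrite /h !ffunE fam2_0 fam2_1.
  apply/ffunP; apply: ord2P; rewrite ffunE ?fam2_0 ?fam2_1 //.
by apply: eq_bigr => -[a b] _; rewrite /h !ffunE fam2_0 fam2_1.
Qed.

Lemma mor_nthE B (s t : smoothing B) (f : mor s t) x0 (i : 'I_(size f)) :
  mor_nth i = nth x0 f i.
Proof.
case: f i => [[]//|x f] i; rewrite /mor_nth.
exact: set_nth_default.
Qed.

Lemma lin_nth B (s t : smoothing B) (W : zmodType) (phi : cob s t -> W) f :
  lin phi f = \sum_(i < size f) phi (mor_nth i).2 *~ (mor_nth i).1.
Proof.
case: f => [|x f]; first by rewrite big_ord0 /lin big_nil.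
rewrite /lin (big_nth x) big_mkord; apply: eq_bigr => i _.
by rewrite (mor_nthE x).
Qed.

(** * The action on morphisms: congruence and interchange *)

Section ActMor.
Variables (Bin : 'I_2 -> btype) (Bout : btype) (D : diagram Bin Bout).

(** The sum over choice functions in [act_mor] becomes two nested additive extensions, one per
    input. *)
Lemma lin_act_mor (s t : forall i, smoothing (Bin i)) (W : zmodType)
    (phi : cob (act_smoothing D s) (act_smoothing D t) -> W)
    (F : forall i, mor (s i) (t i)) :
  lin phi (act_mor D F)
  = lin (fun C0 => lin (fun C1 => phi (act_cob D (fam2 (T := fun i => cob (s i) (t i)) C0 C1)))
      (F ord_max)) (F ord0).
Proof.
rewrite [RHS]lin_nth {1}/lin /act_mor big_map big_enum /=.
pose G (a : 'I_(size (F ord0))) (b : 'I_(size (F ord_max))) : W :=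
  phi (act_cob D (fam2 (T := fun i => cob (s i) (t i)) (mor_nth a).2 (mor_nth b).2))
    *~ ((mor_nth a).1 * (mor_nth b).1).
transitivity (\sum_a \sum_b G a b).
  rewrite -(@sum_dffun2 _ (fun i => 'I_(size (F i)))).
  apply: eq_bigr => x _; rewrite /G big_I2; congr (_ *~ _).
  congr (phi (act_cob D _)); apply: functional_extensionality_dep.
  by apply: ord2P; rewrite ?fam2_0 ?fam2_1.
apply: eq_bigr => a _; rewrite lin_nth mulrz_suml.
by apply: eq_bigr => b _; rewrite /G -mulrzA mulrC.
Qed.

Lemma act_mor_all (s t : forall i, smoothing (Bin i)) (F : forall i, mor (s i) (t i))
    (P : forall i, pred (cob (s i) (t i)))
    (Q : pred (cob (act_smoothing D s) (act_smoothing D t))) :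
    (forall i, all (fun aC => P i aC.2) (F i)) ->
    (forall C, (forall i, P i (C i)) -> Q (act_cob D C)) ->
  all (fun aC => Q aC.2) (act_mor D F).
Proof.
move=> PF PQ; rewrite /act_mor all_map; apply/allP => x _ /=; apply: PQ => i.
have := PF i; case: (F i) (x i) => [[]//|y f] j; rewrite (mor_nthE y).
by move/all_nthP; apply.
Qed.

Variables (i0 i1 : 'I_2) (p0 : point (Bin i0)) (p1 : point (Bin i1)).
Hypothesis link : one_link D p0 p1.

Section Congruence.
Variables s t : forall i, smoothing (Bin i).
Hypotheses (oks : forall i, smoothing_ok (s i)) (okt : forall i, smoothing_ok (t i)).
Variable k : 'I_2.
Variable upd : cob (s k) (t k) -> forall i, cob (s i) (t i).
Hypothesis updk : forall C, upd C k = C.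
Hypothesis updN : forall C C' i, i != k -> upd C i = upd C' i.
Hypothesis upd_ok : forall C, cob_ok C -> forall i, cob_ok (upd C i).

Let okA C : cob_ok C -> cob_ok (act_cob D (upd C)).
Proof. by move=> okC; apply: (act_cob_ok link oks okt); apply: upd_ok. Qed.

(** With the other input fixed, a local relation at input [k] becomes the same relation between
    glued surfaces, whose validity is [okA]. *)
Lemma lin_act_congr f g : meq f g ->
  lin (fun C => mc (act_cob D (upd C))) f = lin (fun C => mc (act_cob D (upd C))) g.
Proof.
apply: meq_lin.
- move=> C C' iC; apply: mc_iso; apply: act_iso => i.
  have [->|ik] := eqVneq i k; first by rewrite !updk.
  by rewrite (updN C C' ik); apply: cob_iso_refl.
- move=> C okC; rewrite (mc_iso (act_sphere D (C := upd C) (k := k) (n := 0) _ _)).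
  + by apply/mclP; apply: meq_sphere; apply: okA.
  + by move=> i ik; apply: updN.
  by rewrite !updk.
- move=> C okC; rewrite (mc_iso (act_sphere D (C := upd C) (k := k) (n := 1) _ _)).
  + by apply/mclP; apply: meq_dotted_sphere; apply: okA.
  + by move=> i ik; apply: updN.
  by rewrite !updk.
- move=> C z okC dz; apply/mclP.
  have [z' dz'] : exists z' : surf (upd C k), (2 <= dots z')%N by rewrite updk; exists z.
  apply: (meq_two_dots (z := dsurf D (existT (fun i => surf (upd C i)) k z'))); first exact: okA.
  rewrite dots_act (bigD1 (existT (fun i => surf (upd C i)) k z')) //=.
  exact: leq_trans dz' (leq_addr _ _).
move=> C x y okC.
(* As [updk] is only a propositional equality, [x] and [y] have to be transported to [upd C k]. *)
have [x' [y' [e1 e2 e3]]] : exists x' y' : surf (upd C k),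
    [/\ cob_tube x y = cob_tube x' y', cob_dot x = cob_dot x' & cob_dot y = cob_dot y'].
  by move: (upd C k) (updk C) => Z e; case: C / e x y okC => x y _; exists x, y.
rewrite (mc_iso (act_tube D (C := upd C) (x := x') (y := y') _ _)); last 2 first.
- by move=> i ik; apply: updN.
- by rewrite updk.
rewrite (mc_iso (act_dot D (C := upd C) (C' := upd (cob_dot x)) (x := x') _ _)); last 2 first.
- by move=> i ik; apply: updN.
- by rewrite updk.
rewrite (mc_iso (act_dot D (C := upd C) (C' := upd (cob_dot y)) (x := y') _ _)); last 2 first.
- by move=> i ik; apply: updN.
- by rewrite updk.
rewrite -mcl_cat; apply/mclP; apply: meq_neck; exact: okA.
Qed.

End Congruence.

Section Act2.
Variables s t : forall i, smoothing (Bin i).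
Hypotheses (oks : forall i, smoothing_ok (s i)) (okt : forall i, smoothing_ok (t i)).
Local Notation fam := (fam2 (T := fun i => cob (s i) (t i))).

Definition actm (f : mor (s ord0) (t ord0)) (g : mor (s ord_max) (t ord_max)) :
    hom (act_smoothing D s) (act_smoothing D t) :=
  lin (fun C0 => lin (fun C1 => mc (act_cob D (fam C0 C1))) g) f.

Lemma mcl_act_mor F : mcl (act_mor D F) = actm (F ord0) (F ord_max).
Proof. by rewrite mcl_lin lin_act_mor. Qed.

Lemma actmC f g : actm f g = lin (fun C1 => lin (fun C0 => mc (act_cob D (fam C0 C1))) f) g.
Proof. exact: lin_exchange. Qed.

(** Validity of [g] makes the glued surfaces valid, as the local relations demand. *)
Lemma actm_congr0 f f' g : mor_ok g -> meq f f' -> actm f g = actm f' g.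
Proof.
move=> okg ff; rewrite !actmC; apply: (eq_lin_all okg) => C1 okC1.
apply: (lin_act_congr oks okt (k := ord0) (upd := fun C0 => fam C0 C1)) => //.
- by move=> C; rewrite fam2_0.
- by move=> C C'; apply: ord2P; rewrite ?eqxx // !fam2_1.
by move=> C okC; apply: ord2P; rewrite ?fam2_0 ?fam2_1.
Qed.

Lemma actm_congr1 f g g' : mor_ok f -> meq g g' -> actm f g = actm f g'.
Proof.
move=> okf gg; apply: (eq_lin_all okf) => C0 okC0.
apply: (lin_act_congr oks okt (k := ord_max) (upd := fun C1 => fam C0 C1)) => //.
- by move=> C; rewrite fam2_1.
- by move=> C C'; apply: ord2P; rewrite ?eqxx // !fam2_0.
by move=> C okC; apply: ord2P; rewrite ?fam2_0 ?fam2_1.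
Qed.

Lemma actm0l g : actm [::] g = 0.
Proof. by rewrite /actm /lin big_nil. Qed.

Lemma actm0r f : actm f [::] = 0.
Proof. by rewrite actmC /lin big_nil. Qed.

Lemma actm_bigl (I : finType) (F : I -> _) g :
  actm (\big[cat/[::]]_i F i) g = \sum_i actm (F i) g.
Proof. exact: lin_big. Qed.

Lemma actm_bigr (I : finType) f (F : I -> _) :
  actm f (\big[cat/[::]]_i F i) = \sum_i actm f (F i).
Proof. by rewrite actmC lin_big; apply: eq_bigr => i _; rewrite actmC. Qed.

End Act2.

(** Interchange law: for single surfaces it is [act_comp], and nested additive extensions may be
    exchanged. *)
Lemma actm_comp (s t u : forall i, smoothing (Bin i))
    (oks : forall i, smoothing_ok (s i)) (okt : forall i, smoothing_ok (t i))
    (F : forall i, mor (s i) (t i)) (G : forall i, mor (t i) (u i)) :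
    (forall i, mor_ok (F i)) ->
  mcl (mor_comp (act_mor D F) (act_mor D G))
  = actm (mor_comp (F ord0) (G ord0)) (mor_comp (F ord_max) (G ord_max)).
Proof.
move=> okF; rewrite mcl_lin lin_comp lin_act_mor /actm lin_comp.
apply: (eq_lin_all (okF ord0)) => C0 ok0.
rewrite (eq_lin_all (psi := fun C1 => lin (fun C0' => lin (fun C1' =>
    mc (act_cob D (fam2 (T := fun i => cob (s i) (u i)) (cob_comp C0 C0') (cob_comp C1 C1'))))
    (G ord_max)) (G ord0)) (okF ord_max)); last first.
  move=> C1 ok1; rewrite lin_act_mor; apply: eq_lin => C0'; apply: eq_lin => C1'.
  apply: mc_iso.
  have okT := act_smoothing_ok link okt.
  have okC i : cob_ok (fam2 (T := fun i => cob (s i) (t i)) C0 C1 i).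
    by move: i; apply: ord2P; rewrite ?fam2_0 ?fam2_1.
  pose C i := fam2 (T := fun i => cob (s i) (t i)) C0 C1 i.
  pose C' i := fam2 (T := fun i => cob (t i) (u i)) C0' C1' i.
  have -> : fam2 (T := fun i => cob (s i) (u i)) (cob_comp C0 C0') (cob_comp C1 C1')
    = fun i => cob_comp (C i) (C' i).
    apply: functional_extensionality_dep.
    by apply: ord2P; rewrite /C /C' ?fam2_0 ?fam2_1.
  have := @act_comp _ _ _ D s t u C C' okT okt (fun i => cob_ok_att (okC i)).
  (* [act_comp] provides the isomorphism in the other direction, so it is inverted. *)
  by case=> h [[g hg gh] h1 h2 h3]; exists g; split; [exists h|..] => //;
    [move=> x; rewrite h1 hg|move=> z; rewrite -{2}[z]gh h2|move=> z; rewrite -{2}[z]gh h3].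
rewrite lin_exchange; apply: eq_lin => C0'; rewrite lin_comp.
by [].
Qed.

End ActMor.

(** * Complexes *)

(** The product over a strand is a disc with one boundary circle, over a loop an annulus with two;
    the genus is 0 in both cases. *)
Lemma cob_id_ok B (s : smoothing B) : cob_ok (cob_id s).
Proof.
apply/andP; split; first by apply/forallP => p; rewrite /= eqxx.
apply/forallP => c; rewrite bd_circlesE /=.
pose q := qpi (bd_edge s s).
pose m (x : cmp s + cmp s) := match x with inl c => c | inr c => c end.
have cE : (\sum_(k : quo (bd_edge s s))
     (m (val k) == c) =
     #|[set q (inl c); q (inr c)]|)%N.
  rewrite -sum1_card [RHS]big_mkcond; apply: eq_bigr => k _; rewrite !inE.
  have vq : q (val k) = k by apply: qpi_val.
  have h a : q a = q (inl c) \/ q a = q (inr c) ->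
      m a = c.
    have cst x y : q x = q y -> m x = m y.
      by apply: (qpi_inv (f := m)) => x' y' /existsP[p /andP[/eqP-> /eqP->]].
    by case=> /cst ->.
  case: ifP => [/orP kq|/norP[/eqP k1 /eqP k2]].
    by rewrite h ?eqxx // vq; case: kq => /eqP; [left|right].
  case: eqP => // vc; move: k1 k2; rewrite -vq.
  by case: (val k) vc => a /= ->.
rewrite [X in X%:Z]cE cards2; case: ifPn => lc.
  suff -> : q (inl c) != q (inr c) by [].
  have inv x y : q x = q y -> (x == inl c) = (y == inl c).
    apply: (qpi_inv (f := fun x => x == inl c)) => x' y'.
    move=> /existsP[p /andP[/eqP-> /eqP->]]; apply/negbTE.
    by move/forallP: lc => /(_ p).
  by apply/eqP => /inv; rewrite eqxx.
have -> : q (inl c) = q (inr c); last by rewrite eqxx.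
move: lc; rewrite negb_forall => /existsP[p]; rewrite negbK => /eqP <-.
by apply: qpi_eq; apply/existsP; exists p; rewrite !eqxx.
Qed.

Lemma cob_id_deg B (s : smoothing B) : smoothing_ok s -> cob_deg (cob_id s) = 0.
Proof.
move=> oks; rewrite /cob_deg.
have -> : (\sum_(z : surf (cob_id s)) dots z = 0)%N by apply: big1.
have -> : \sum_(z : surf (cob_id s)) chi z = (half B)%:Z.
  rewrite -(card_strands oks) -sum1dep_card (big_morph Posz PoszD (erefl _)).
  by rewrite [RHS]big_mkcond; apply: eq_bigr => c _ /=; case: is_loop.
by rewrite subrr.
Qed.

Section IdEntry.
Variables (B : btype) (O : cplx B).

Lemma id_entry_eq (x : idx O) : id_entry x x = mor_id (smo x).
Proof. by rewrite /id_entry; case: eqP => // e; rewrite eq_axiomK. Qed.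

Lemma id_entry_neq (x y : idx O) : x != y -> id_entry x y = [::].
Proof. by rewrite /id_entry; case: eqP. Qed.

Lemma id_entry_ok (x y : idx O) : mor_ok (id_entry x y).
Proof.
have [->|xy] := eqVneq x y; last by rewrite id_entry_neq.
by rewrite id_entry_eq /= cob_id_ok.
Qed.

Lemma id_entry_deg (x y : idx O) : smoothing_ok (smo x) ->
  all (fun aC => cob_deg aC.2 + (qsh y - qsh x) == 0) (id_entry x y).
Proof.
have [->|xy] := eqVneq x y; last by rewrite id_entry_neq.
by move=> ok; rewrite id_entry_eq /= cob_id_deg // subrr addr0 eqxx.
Qed.

End IdEntry.

Lemma mor_scale_all B (s t : smoothing B) (P : pred (cob s t)) a f :
  all (fun x => P x.2) (mor_scale a f) = all (fun x => P x.2) f.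
Proof. by rewrite /mor_scale all_map; apply: eq_all. Qed.

Lemma mcl_comp_cat B (s t u : smoothing B) (f f' : mor s t) (g : mor t u) :
  mcl (mor_comp (f ++ f') g) = mcl (mor_comp f g) + mcl (mor_comp f' g).
Proof. by rewrite !mcl_lin !lin_comp lin_cat. Qed.

Lemma mcl_comp_catr B (s t u : smoothing B) (f : mor s t) (g g' : mor t u) :
  mcl (mor_comp f (g ++ g')) = mcl (mor_comp f g) + mcl (mor_comp f g').
Proof.
by rewrite !mcl_lin !lin_comp -linD; apply: eq_lin => C; rewrite lin_cat.
Qed.

Lemma mcl_comp_scale B (s t u : smoothing B) a (f : mor s t) (g : mor t u) :
  mcl (mor_comp (mor_scale a f) g) = mcl (mor_comp f g) *~ a.
Proof. by rewrite !mcl_lin !lin_comp lin_scale. Qed.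

Lemma mcl_comp_scaler B (s t u : smoothing B) a (f : mor s t) (g : mor t u) :
  mcl (mor_comp f (mor_scale a g)) = mcl (mor_comp f g) *~ a.
Proof.
by rewrite !mcl_lin !lin_comp -linM; apply: eq_lin => C; rewrite lin_scale.
Qed.

Lemma mor_comp_nilr B (s t u : smoothing B) (f : mor s t) :
  mor_comp f ([::] : mor t u) = [::].
Proof. by elim: f. Qed.

Lemma actm_unit (Bin : 'I_2 -> btype) Bout (D : diagram Bin Bout)
    (s t : forall i, smoothing (Bin i))
    (f : mor (s ord0) (t ord0)) (g : mor (s ord_max) (t ord_max)) :
  [/\ actm D (mor_comp f (mor_id _)) g = actm D f g,
      actm D (mor_comp (mor_id _) f) g = actm D f g,
      actm D f (mor_comp g (mor_id _)) = actm D f g &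
      actm D f (mor_comp (mor_id _) g) = actm D f g].
Proof.
have iso C0 C0' C1 C1' : cob_iso C0 C0' -> cob_iso C1 C1' ->
    mc (act_cob D (fam2 (T := fun i => cob (s i) (t i)) C0 C1))
    = mc (act_cob D (fam2 (T := fun i => cob (s i) (t i)) C0' C1')).
  by move=> e0 e1; apply/mc_iso/act_iso; apply: ord2P; rewrite ?fam2_0 ?fam2_1.
split.
- rewrite /actm lin_comp; apply: eq_lin => C0; rewrite {1}/lin big_seq1 mulr1z.
  by apply: eq_lin => C1; apply: iso (comp_id_iso _) (cob_iso_refl _).
- rewrite /actm lin_comp {1}/lin big_seq1 mulr1z; apply: eq_lin => C0.
  by apply: eq_lin => C1; apply: iso (id_comp_iso _) (cob_iso_refl _).
- apply: eq_lin => C0; rewrite lin_comp; apply: eq_lin => C1.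
  rewrite /lin big_seq1 mulr1z.
  by apply: iso (cob_iso_refl _) (comp_id_iso _).
apply: eq_lin => C0; rewrite lin_comp {1}/lin big_seq1 mulr1z; apply: eq_lin => C1.
by apply: iso (cob_iso_refl _) (id_comp_iso _).
Qed.

(** * The glued complex and its rotation constant *)

Section ActComplex.
Variables (Bin : 'I_2 -> btype) (Bout : btype) (D : diagram Bin Bout).
Variables (i0 i1 : 'I_2) (p0 : point (Bin i0)) (p1 : point (Bin i1)).
Hypothesis link : one_link D p0 p1.
Variables (O : forall i, cplx (Bin i)) (cst : 'I_2 -> rat).
Hypothesis dg : forall i, diagonal (O i) (cst i).

Local Notation A := (act_cplx D O).
Implicit Types x y z : idx A.

Let ok_smo i (x : idx (O i)) : smoothing_ok (smo x).
Proof. by case: (dg i) => -[]. Qed.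
Let ok_dif i (x y : idx (O i)) : mor_ok (dif x y).
Proof. by case: (dg i) => -[]. Qed.
Let dif_deg i (x y : idx (O i)) : hdeg y != hdeg x + 1 -> meq (dif x y) [::].
Proof. by case: (dg i) => -[_ _ h _] _ _; apply: h. Qed.
Let dif_dif i (x z : idx (O i)) :
  meq (\big[cat/[::]]_(y : idx (O i)) mor_comp (dif x y) (dif y z)) [::].
Proof. by case: (dg i) => -[]. Qed.
Let dif_deg0 i (x y : idx (O i)) : degree0 (qsh y - qsh x) (dif x y).
Proof. by case: (dg i). Qed.

Let ok_x x i : smoothing_ok (smo (x i)). Proof. exact: ok_smo. Qed.

Let sgn x : int := (-1) ^ hdeg (x ord0).

Let row0 x y i : mor (smo (x i)) (smo (y i)) :=
  if i == ord0 then dif (x i) (y i) else id_entry (x i) (y i).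
Let row1 x y i : mor (smo (x i)) (smo (y i)) :=
  if i == ord_max then dif (x i) (y i) else id_entry (x i) (y i).

(** The exponent of the sign is an empty sum for the first input and the degree of the first entry
    for the second. *)
Let difE x y : dif x y = act_mor D (row0 x y) ++ mor_scale (sgn x) (act_mor D (row1 x y)).
Proof.
rewrite [LHS]/= big_I2; congr (_ ++ mor_scale (_ ^ _) _).
  rewrite big_pred0 // expr0z /mor_scale -[RHS]map_id; apply: eq_map => -[a C].
  by rewrite mul1r.
by rewrite big_mkcond big_I2 /= addr0.
Qed.

Let ok_row0 x y i : mor_ok (row0 x y i).
Proof. by rewrite /row0; case: ifP => _; [apply: ok_dif|apply: id_entry_ok]. Qed.
Let ok_row1 x y i : mor_ok (row1 x y i).
Proof. by rewrite /row1; case: ifP => _; [apply: ok_dif|apply: id_entry_ok]. Qed.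

Local Notation act_ x y := (actm D (s := fun i => smo (x i)) (t := fun i => smo (y i))).

Let mcl_dif x y : mcl (dif x y)
  = act_ x y (dif (x ord0) (y ord0)) (id_entry (x ord_max) (y ord_max))
  + act_ x y (id_entry (x ord0) (y ord0)) (dif (x ord_max) (y ord_max)) *~ sgn x.
Proof. by rewrite difE mcl_cat mcl_scale !mcl_act_mor. Qed.

Lemma act_mor_ok (s t : forall i, smoothing (Bin i)) (F : forall i, mor (s i) (t i)) :
    (forall i, smoothing_ok (s i)) -> (forall i, smoothing_ok (t i)) ->
  (forall i, mor_ok (F i)) -> mor_ok (act_mor D F).
Proof.
move=> oks okt okF; apply: (act_mor_all (P := fun i => @cob_ok _ _ _)) => // C.
exact: (act_cob_ok link oks okt).
Qed.

Let act_dif_ok x y : mor_ok (dif x y).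
Proof.
rewrite difE /mor_ok all_cat (mor_scale_all (@cob_ok _ _ _)).
by apply/andP; split; apply: (act_mor_ok (ok_x x) (ok_x y)).
Qed.

Let act_dif_deg x y : hdeg y != hdeg x + 1 -> meq (dif x y) [::].
Proof.
move=> h; have {}h : hdeg (y ord0) + hdeg (y ord_max)
    != hdeg (x ord0) + hdeg (x ord_max) + 1 by move: h; rewrite /= !big_I2.
apply/mclP; rewrite mcl0 mcl_dif.
have -> : act_ x y (dif (x ord0) (y ord0)) (id_entry (x ord_max) (y ord_max)) = 0.
  have [e|ne] := eqVneq (x ord_max) (y ord_max); last by rewrite (id_entry_neq ne) actm0r.
  have d0 : meq (dif (x ord0) (y ord0)) [::].
    by apply: dif_deg; apply: contraNneq h => ->; rewrite e addrAC.
  by rewrite (actm_congr0 link (ok_x x) (ok_x y) (id_entry_ok _ _) d0) actm0l.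
have -> : act_ x y (id_entry (x ord0) (y ord0)) (dif (x ord_max) (y ord_max)) = 0.
  have [e|ne] := eqVneq (x ord0) (y ord0); last by rewrite (id_entry_neq ne) actm0l.
  have d0 : meq (dif (x ord_max) (y ord_max)) [::].
    by apply: dif_deg; apply: contraNneq h => ->; rewrite e addrA.
  by rewrite (actm_congr1 link (ok_x x) (ok_x y) (id_entry_ok _ _) d0) actm0r.
by rewrite mul0rz addr0.
Qed.

Let actm_comp2 x y z (F : forall i, mor (smo (x i)) (smo (y i)))
    (G : forall i, mor (smo (y i)) (smo (z i))) :
    (forall i, mor_ok (F i)) ->
  mcl (mor_comp (act_mor D F) (act_mor D G))
  = act_ x z (mor_comp (F ord0) (G ord0)) (mor_comp (F ord_max) (G ord_max)).
Proof. exact: (actm_comp link (ok_x x) (ok_x y)). Qed.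

Let dif_comp x y z : mcl (mor_comp (dif x y) (dif y z)) =
    act_ x z (mor_comp (dif (x ord0) (y ord0)) (dif (y ord0) (z ord0)))
        (mor_comp (id_entry (x ord_max) (y ord_max)) (id_entry (y ord_max) (z ord_max)))
  + act_ x z (mor_comp (dif (x ord0) (y ord0)) (id_entry (y ord0) (z ord0)))
        (mor_comp (id_entry (x ord_max) (y ord_max)) (dif (y ord_max) (z ord_max))) *~ sgn y
  + act_ x z (mor_comp (id_entry (x ord0) (y ord0)) (dif (y ord0) (z ord0)))
        (mor_comp (dif (x ord_max) (y ord_max)) (id_entry (y ord_max) (z ord_max))) *~ sgn x
  + act_ x z (mor_comp (id_entry (x ord0) (y ord0)) (id_entry (y ord0) (z ord0)))
        (mor_comp (dif (x ord_max) (y ord_max)) (dif (y ord_max) (z ord_max))) *~ (sgn x * sgn y).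
Proof.
rewrite !difE mcl_comp_cat !mcl_comp_catr !mcl_comp_scale !mcl_comp_scaler !actm_comp2 //.
by rewrite mulrC mulrzA !addrA.
Qed.

(** Terms with both differentials on one input sum to 0 because that input is a complex. Each mixed
    sum reduces to the single morphism [dd], with signs given by the degrees of [z ord0] and
    [x ord0]: they are opposite if the degree rises by one, and otherwise [dd] is 0. *)
Let act_dif_dif x z :
  meq (\big[cat/[::]]_(y : idx A) mor_comp (dif x y) (dif y z)) [::].
Proof.
apply/mclP; rewrite mcl0 mcl_big (eq_bigr _ (fun y _ => dif_comp x y z)) !big_split /=.
have -> : \sum_(y : idx A)
    act_ x z (mor_comp (dif (x ord0) (y ord0)) (dif (y ord0) (z ord0)))
      (mor_comp (id_entry (x ord_max) (y ord_max)) (id_entry (y ord_max) (z ord_max))) = 0.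
  apply: (etrans (@sum_dffun2 _ (fun i => idx (O i)) (fun a b =>
    act_ x z (mor_comp (dif (x ord0) a) (dif a (z ord0)))
      (mor_comp (id_entry (x ord_max) b) (id_entry b (z ord_max)))))).
  rewrite exchange_big (bigD1 (x ord_max)) //= [X in _ + X]big1 ?addr0; last first.
    move=> b xb; apply: big1 => a _.
    by rewrite (id_entry_neq (x := x ord_max)) 1?eq_sym // actm0r.
  rewrite id_entry_eq; transitivity (act_ x z [::] (id_entry (x ord_max) (z ord_max))); last exact: actm0l.
  rewrite -(actm_congr0 link (ok_x x) (ok_x z) (id_entry_ok _ _) (dif_dif (x ord0) (z ord0))).
  rewrite actm_bigl; apply: eq_bigr => a _.
  by case: (actm_unit D (s := fun i => smo (x i)) (t := fun i => smo (z i))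
    (mor_comp (dif (x ord0) a) (dif a (z ord0))) (id_entry (x ord_max) (z ord_max))).
have -> : \sum_(y : idx A)
    act_ x z (mor_comp (id_entry (x ord0) (y ord0)) (id_entry (y ord0) (z ord0)))
      (mor_comp (dif (x ord_max) (y ord_max)) (dif (y ord_max) (z ord_max))) *~ (sgn x * sgn y) = 0.
  apply: (etrans (@sum_dffun2 _ (fun i => idx (O i)) (fun a b =>
    act_ x z (mor_comp (id_entry (x ord0) a) (id_entry a (z ord0)))
      (mor_comp (dif (x ord_max) b) (dif b (z ord_max))) *~ (sgn x * (-1) ^ hdeg a)))).
  rewrite (bigD1 (x ord0)) //= [X in _ + X]big1 ?addr0; last first.
    move=> a xa; apply: big1 => b _.
    by rewrite (id_entry_neq (x := x ord0)) 1?eq_sym // actm0l mul0rz.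
  rewrite -mulrz_suml (_ : \sum_b _ = 0) ?mul0rz //.
  rewrite id_entry_eq; transitivity (act_ x z (id_entry (x ord0) (z ord0)) [::]); last exact: actm0r.
  rewrite -(actm_congr1 link (ok_x x) (ok_x z) (id_entry_ok _ _) (dif_dif (x ord_max) (z ord_max))).
  rewrite actm_bigr; apply: eq_bigr => b _.
  by case: (actm_unit D (s := fun i => smo (x i)) (t := fun i => smo (z i))
    (id_entry (x ord0) (z ord0)) (mor_comp (dif (x ord_max) b) (dif b (z ord_max)))).
pose dd := act_ x z
  (dif (x ord0) (z ord0)) (dif (x ord_max) (z ord_max)).
have -> : \sum_(y : idx A)
    act_ x z (mor_comp (dif (x ord0) (y ord0)) (id_entry (y ord0) (z ord0)))
      (mor_comp (id_entry (x ord_max) (y ord_max)) (dif (y ord_max) (z ord_max))) *~ sgn y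
    = dd *~ (-1) ^ hdeg (z ord0).
  apply: (etrans (@sum_dffun2 _ (fun i => idx (O i)) (fun a b =>
    act_ x z (mor_comp (dif (x ord0) a) (id_entry a (z ord0)))
      (mor_comp (id_entry (x ord_max) b) (dif b (z ord_max))) *~ (-1) ^ hdeg a))).
  rewrite (bigD1 (z ord0)) //= [X in _ + X]big1 ?addr0; last first.
    move=> a za; apply: big1 => b _.
    by rewrite (id_entry_neq (x := a)) // mor_comp_nilr actm0l mul0rz.
  rewrite (bigD1 (x ord_max)) //= [X in _ + X]big1 ?addr0; last first.
    move=> b xb.
    by rewrite (id_entry_neq (x := x ord_max)) 1?eq_sym // actm0r mul0rz.
  rewrite !id_entry_eq /dd.
  have [-> _ _ _] := actm_unit D (s := fun i => smo (x i)) (t := fun i => smo (z i))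
    (dif (x ord0) (z ord0)) (mor_comp (mor_id _) (dif (x ord_max) (z ord_max))).
  by have [_ _ _ ->] := actm_unit D (s := fun i => smo (x i)) (t := fun i => smo (z i))
    (dif (x ord0) (z ord0)) (dif (x ord_max) (z ord_max)).
have -> : \sum_(y : idx A)
    act_ x z (mor_comp (id_entry (x ord0) (y ord0)) (dif (y ord0) (z ord0)))
      (mor_comp (dif (x ord_max) (y ord_max)) (id_entry (y ord_max) (z ord_max))) *~ sgn x
    = dd *~ (-1) ^ hdeg (x ord0).
  apply: (etrans (@sum_dffun2 _ (fun i => idx (O i)) (fun a b =>
    act_ x z (mor_comp (id_entry (x ord0) a) (dif a (z ord0)))
      (mor_comp (dif (x ord_max) b) (id_entry b (z ord_max))) *~ sgn x))).
  rewrite (bigD1 (x ord0)) //= [X in _ + X]big1 ?addr0; last first.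
    move=> a xa; apply: big1 => b _.
    by rewrite (id_entry_neq (x := x ord0)) 1?eq_sym // actm0l mul0rz.
  rewrite (bigD1 (z ord_max)) //= [X in _ + X]big1 ?addr0; last first.
    move=> b zb.
    by rewrite (id_entry_neq (x := b)) // mor_comp_nilr actm0r mul0rz.
  rewrite !id_entry_eq /dd.
  have [_ -> _ _] := actm_unit D (s := fun i => smo (x i)) (t := fun i => smo (z i))
    (dif (x ord0) (z ord0)) (mor_comp (dif (x ord_max) (z ord_max)) (mor_id _)).
  by have [_ _ -> _] := actm_unit D (s := fun i => smo (x i)) (t := fun i => smo (z i))
    (dif (x ord0) (z ord0)) (dif (x ord_max) (z ord_max)).
rewrite add0r addr0; have [e|h] := eqVneq (hdeg (z ord0)) (hdeg (x ord0) + 1).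
  by rewrite e exprzDr ?unitrN1 // expr1z mulrN1 mulrNz addNr.
rewrite /dd (actm_congr0 link (ok_x x) (ok_x z) (ok_dif _ _) (dif_deg h)) actm0l.
by rewrite !mul0rz addr0.
Qed.

Lemma act_is_complex : is_complex A.
Proof.
split; [|exact: act_dif_ok|exact: act_dif_deg|exact: act_dif_dif].
by move=> x; apply: (act_smoothing_ok link).
Qed.

(** Degrees add up under gluing, so homogeneous representatives [g0] and [g1] of the input
    differentials give one for the glued differential. *)
Lemma act_degree0 x y : degree0 (qsh y - qsh x) (dif x y).
Proof.
have [g0 [e0 ok0 d0]] := dif_deg0 (x ord0) (y ord0).
have [g1 [e1 ok1 d1]] := dif_deg0 (x ord_max) (y ord_max).
pose F0 := fam2 (T := fun i => mor (smo (x i)) (smo (y i))) g0 (id_entry (x ord_max) (y ord_max)).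
pose F1 := fam2 (T := fun i => mor (smo (x i)) (smo (y i))) (id_entry (x ord0) (y ord0)) g1.
have okF0 i : mor_ok (F0 i).
  by move: i; apply: ord2P; rewrite /F0 ?fam2_0 ?fam2_1 // id_entry_ok.
have okF1 i : mor_ok (F1 i).
  by move: i; apply: ord2P; rewrite /F1 ?fam2_0 ?fam2_1 // id_entry_ok.
have degF (F : forall i, mor (smo (x i)) (smo (y i))) : (forall i, mor_ok (F i)) ->
    (forall i, all (fun aC => cob_deg aC.2 + (qsh (y i) - qsh (x i)) == 0) (F i)) ->
    all (fun aC => cob_deg aC.2 + (qsh y - qsh x) == 0) (act_mor D F).
  move=> okF dF.
  apply: (act_mor_all (P := fun i C => cob_ok C && (cob_deg C + (qsh (y i) - qsh (x i)) == 0))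
    (Q := fun C => cob_deg C + (qsh y - qsh x) == 0)).
    move=> i; rewrite all_predI; apply/andP; split; [exact: okF|exact: dF].
  move=> C PC; have okC i : cob_ok (C i) by case/andP: (PC i).
  have dC i : cob_deg (C i) + (qsh (y i) - qsh (x i)) = 0 by case/andP: (PC i) => _ /eqP.
  rewrite (act_cob_deg link (ok_x x) (ok_x y) C) /= !(big_link link).
  by have := dC i0; have := dC i1; move=> /= h1 h2; apply/eqP; lia.
exists (act_mor D F0 ++ mor_scale (sgn x) (act_mor D F1)); split.
- apply/mclP; rewrite mcl_dif mcl_cat mcl_scale !mcl_act_mor /F0 /F1 !fam2_0 !fam2_1.
  rewrite (actm_congr0 link (ok_x x) (ok_x y) (id_entry_ok _ _) e0).
  by rewrite (actm_congr1 link (ok_x x) (ok_x y) (id_entry_ok _ _) e1).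
- rewrite /mor_ok all_cat (mor_scale_all (@cob_ok _ _ _)).
  by apply/andP; split; apply: (act_mor_ok (ok_x x) (ok_x y)).
rewrite all_cat (mor_scale_all (fun C => cob_deg C + (qsh y - qsh x) == 0)).
apply/andP; split; apply: degF => //; apply: ord2P; rewrite /F0 /F1 ?fam2_0 ?fam2_1 //.
  by apply: id_entry_deg; apply: ok_smo.
by apply: id_entry_deg; apply: ok_smo.
Qed.

Theorem act_diagonal : diagonal A (cst i0 + cst i1).
Proof.
split; [exact: act_is_complex | exact: act_degree0 | move=> x].
rewrite /rot_shifted /= (rot_glue link (ok_x x)) !(big_link link) /=.
have h i : 2 * (hdeg (x i))%:~R - rot_shifted (x i) = cst i by case: (dg i).
by rewrite -!h /rot_shifted !intrD; ring.
Qed.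

End ActComplex.

Theorem mainTheorem1 (B1 B2 Bout : btype) (O1 : cplx B1) (O2 : cplx B2)
    (D : diagram (in2 B1 B2) Bout) :
  coherently_diagonal O1 -> coherently_diagonal O2 -> basic2 D ->
  exists C : rat, diagonal (act2 D O1 O2) C.
Proof.
move=> [C1 [d1 _]] [C2 [d2 _]] [inter curl].
have [i0 [i1 [p0 [p1 link]]]] := basic_one_link inter curl.
(* Either of [i0] and [i1] may be the first input; as they differ, the sum is that of [C1] and
   [C2]. *)
exists ((if i0 == ord0 then C1 else C2) + (if i1 == ord0 then C1 else C2)).
apply: (act_diagonal link (cst := fun i => if i == ord0 then C1 else C2)).
by apply: ord2P.
Qed.
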